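(* Let $\ell>0$ and let $\rho,\sigma\in H^2(0,\ell)$ and $q\in H^1(0,\ell)$ be real-valued functions such that, for some constants $\rho_0,\sigma_0>0$, $\rho(x)\ge\rho_0$, $\sigma(x)\ge\sigma_0$ and $q(x)\ge 0$ for all $x\in[0,\ell]$. Let $T>0$ and $\tilde y^0\in H^2_0(0,\ell)$. Then $$\int_0^T|\partial_x^2\tilde y(t,\ell)|^2\,dt\asymp\|\tilde y^0\|^2_{H^2_0(0,\ell)},$$ where $\tilde y$ is the solution of the problem $$ \begin{cases} i\rho(x)\partial_t\tilde y=-\partial_x^2\big(\sigma(x)\partial_x^2\tilde y\big)+\partial_x\big(q(x)\partial_x\tilde y\big), & (t,x)\in(0,T)\times(0,\ell),\\ \tilde y(t,0)=\partial_x\tilde y(t,0)=\tilde y(t,\ell)=\partial_x\tilde y(t,\ell)=0, & t\in(0,T),\\ \tilde y(0,x)=\tilde y^0(x), & x\in(0,\ell). \end{cases} $$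
   Context: $L^2_\rho(0,\ell)$ is the space of complex-valued functions $y$ with $\int_0^\ell|y|^2\rho\,dx<\infty$. $H^2_0(0,\ell)=\{y\in H^2(0,\ell): y(0)=y'(0)=y(\ell)=y'(\ell)=0\}$ with norm $\|u\|_{H^2_0(0,\ell)}=\|u''\|_{L^2_\rho(0,\ell)}$. The symbol $\asymp$ means that each side is bounded by a positive constant times the other, with constants independent of $\tilde y^0$ (they may depend on $T,\ell,\rho,\sigma,q$). Let $\mathcal Ay=\rho^{-1}\big((\sigma y'')''-(qy')'\big)$ on $\mathcal D(\mathcal A)=H^4(0,\ell)\cap H^2_0(0,\ell)$, a positive self-adjoint operator in $L^2_\rho(0,\ell)$ with compact inverse, with eigenvalues $(\lambda_n)_{n\ge1}$ and eigenfunctions $(\Phi_n)_{n\ge1}$ forming an orthonormal basis of $L^2_\rho(0,\ell)$. For $\tilde y^0=\sum_nc_n\Phi_n\in H_0^2(0,\ell)$, the solution is $\tilde y(t,x)=\sum_nc_ne^{i\lambda_nt}\Phi_n(x)\in C([0,T];H^2_0(0,\ell))$, and the trace is understood as $\partial_x^2\tilde y(t,\ell)=\sum_nc_ne^{i\lambda_nt}\Phi_n''(\ell)$ in $L^2(0,T)$. *)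

(* Defs.v *)
From mathcomp Require Import all_boot all_order all_algebra.
From mathcomp Require Import all_classical all_reals all_analysis.
From mathcomp Require Import complex.
Import Order.TTheory GRing.Theory Num.Theory.
Import numFieldNormedType.Exports.

Set Implicit Arguments.
Unset Strict Implicit.
Unset Printing Implicit Defensive.

Local Open Scope classical_set_scope.
Local Open Scope ring_scope.
Local Open Scope complex_scope.

Local Notation Rec := complex.Re.
Local Notation Imc := complex.Im.

Section Defs.
Context {R : realType}.
Notation mu := (@lebesgue_measure R).
Implicit Types (l T a b t x : R) (rho sigma q w : R -> R).
Implicit Types (f g u v phi : R -> R[i]).

(** Complex-valued functions of a real variable *)

Definition sqmod (z : R[i]) : R := Rec z ^+ 2 + Imc z ^+ 2.

Definition expi (theta : R) : R[i] := cos theta +i* sin theta.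

Definition cint a b f : R[i] :=
  (\int[mu]_(x in `[a, b]) Rec (f x)) +i* (\int[mu]_(x in `[a, b]) Imc (f x)).

Definition is_cderive f t (d : R[i]) : Prop :=
  is_derive t 1 (fun s => Rec (f s)) (Rec d) /\
  is_derive t 1 (fun s => Imc (f s)) (Imc d).

(** The weighted spaces L^2_w(a, b) *)

Definition L2 a b w f : Prop :=
  [/\ measurable_fun `[a, b] (fun x => Rec (f x)),
      measurable_fun `[a, b] (fun x => Imc (f x)) &
      (\int[mu]_(x in `[a, b]) (sqmod (f x) * w x)%:E < +oo)%E].

(* [Rintegral] is 0 on functions of infinite integral, so [sqnormL2] is only
   meaningful on elements of L^2_w(a, b). *)
Definition sqnormL2 a b w f : R :=
  \int[mu]_(x in `[a, b]) (sqmod (f x) * w x).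

Definition ipL2 a b w u v : R[i] :=
  cint a b (fun x => u x * (v x)^* * (w x)%:C).

(** Sobolev spaces on (0, l) *)

(* Derivative relative to [0, l]: two-sided inside, one-sided at 0 and l.
   Only the values of the function on [0, l] matter.  Where the limit does not
   exist the value is a default one. *)
Definition rderiv l (h : R -> R) x : R :=
  lim ((h z - h x) / (z - x) @[z --> within `[0, l] x^']).

Definition cderiv l u x : R[i] :=
  rderiv l (fun z => Rec (u z)) x +i* rderiv l (fun z => Imc (u z)) x.

(* Elements of H^k(0, l) are represented by their continuous representative:
   u is in H^(k+1) when it is absolutely continuous on [0, l], that is, when it
   is the integral of its (a.e. defined) derivative, and u' is in H^k.  The
   derivatives of order < k are then defined everywhere on [0, l], end points
   included, and the one of order k almost everywhere. *)
Fixpoint sobolev l (k : nat) u : Prop :=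
  if k is k'.+1 then
    (forall x, x \in `[0, l] -> u x = u 0 + cint 0 x (cderiv l u)) /\
    sobolev l k' (cderiv l u)
  else L2 0 l (fun=> 1) u.

Definition H20 l u : Prop :=
  sobolev l 2 u /\
  [/\ u 0 = 0, cderiv l u 0 = 0, u l = 0 & cderiv l u l = 0].

Definition sqnormH20 l rho u : R := sqnormL2 0 l rho (cderiv l (cderiv l u)).

(** The operator A and its eigenbasis *)

Definition domA l u : Prop := sobolev l 4 u /\ H20 l u.

Definition opA l rho sigma q u x : R[i] :=
  ((rho x)^-1)%:C *
  (cderiv l (cderiv l (fun z => (sigma z)%:C * cderiv l (cderiv l u) z)) x
   - cderiv l (fun z => (q z)%:C * cderiv l u z) x).

Definition coef l rho (Phi : nat -> R -> R[i]) u (n : nat) : R[i] :=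
  ipL2 0 l rho u (Phi n).

Definition eigenbasis l rho sigma q (lambda : nat -> R)
    (Phi : nat -> R -> R[i]) : Prop :=
  [/\ forall n, domA l (Phi n),
      forall n, {ae mu, forall x, x \in `[0, l] ->
        opA l rho sigma q (Phi n) x = (lambda n)%:C * Phi n x},
      forall m n, ipL2 0 l rho (Phi m) (Phi n) = (m == n)%:R &
      forall u, L2 0 l rho u ->
        sqnormL2 0 l rho
          (fun x => u x - \sum_(n < N) coef l rho Phi u n * Phi n x)
          @[N --> \oo] --> (0 : R)].

(** The evolution problem *)

Definition formA l sigma q u v : R[i] :=
  cint 0 l (fun x =>
    (sigma x)%:C * cderiv l (cderiv l u) x * (cderiv l (cderiv l v) x)^*
    + (q x)%:C * cderiv l u x * (cderiv l v x)^*).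

(* y is in C([0, T]; H^2_0(0, l)), which contains the boundary conditions,
   y(0) = y0, and the equation
     i rho y_t = - (sigma y_xx)_xx + (q y_x)_x
   holds in the dual of H^2_0(0, l), i.e. after multiplication by the conjugate
   of any phi in H^2_0(0, l) and integration by parts in x. *)
Definition solution l rho sigma q T (y0 : R -> R[i]) (y : R -> R -> R[i]) :
    Prop :=
  [/\ forall t, t \in `[0, T] -> H20 l (y t),
      forall t, t \in `[0, T] ->
        sqnormH20 l rho (fun x => y s x - y t x)
          @[s --> within `[0, T] (nbhs t)] --> (0 : R),
      forall x, x \in `[0, l] -> y 0 x = y0 x &
      forall phi, H20 l phi -> forall t, t \in `]0, T[ ->
        exists2 d, is_cderive (fun s => ipL2 0 l rho (y s) phi) t d
                 & (0 +i* 1) * d = - formA l sigma q (y t) phi].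

(* g is the trace y_xx(., l): with c_n the coefficients of y0,
     y(t) = sum_n c_n e^(i lambda_n t) Phi_n   in H^2_0(0, l), for t in [0, T],
     g = sum_n c_n e^(i lambda_n .) Phi_n''(l) in L^2(0, T). *)
Definition trace2 l rho (lambda : nat -> R) (Phi : nat -> R -> R[i]) T
    (y0 : R -> R[i]) (y : R -> R -> R[i]) (g : R -> R[i]) : Prop :=
  [/\ forall t, t \in `[0, T] ->
        sqnormH20 l rho (fun x => y t x -
          \sum_(n < N) coef l rho Phi y0 n * expi (lambda n * t) * Phi n x)
          @[N --> \oo] --> (0 : R),
      L2 0 T (fun=> 1) g &
      sqnormL2 0 T (fun=> 1) (fun t => g t -
        \sum_(n < N) coef l rho Phi y0 n * expi (lambda n * t)
                       * cderiv l (cderiv l (Phi n)) l)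
        @[N --> \oo] --> (0 : R)].

End Defs.

(* Main.v *)
(* The eigenfunctions are studied as solutions of the first-order system
   u' = v, v' = k, k' = k1, W' = rho lam u, with W + q v = sigma' k + sigma k1, on which
   integrations by parts only involve absolutely continuous functions.  The multiplier x
   gives |Phi''(l)|^2 <= C lambda.  The multiplier e^(K x) with K large gives an
   observability inequality at high frequency, also with a source term: applied to a
   single eigenfunction it yields |Phi''(l)|^2 >= c lambda, and applied to the difference
   of two eigenfunctions with the same trace at l it yields a gap between eigenvalues that
   grows like sqrt(lambda).  At low frequency the trace cannot vanish because the system,
   integrated from l, preserves signs; this also makes the eigenvalues simple, and Bessel's
   inequality for point evaluation leaves finitely many of them below any level.

   Ingham's inequality for a large gap follows from the weight t (T - t); finitely many
   frequencies are then added one at a time, by replacing f with the differences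
   e^(- i lambda s) f(t + s) - f(t).  As the gap tends to infinity, every T > 0 is reached,
   with constants depending on the set of eigenvalues only.

   The energy form is diagonal in the eigenbasis, so sum lambda_n |c_n|^2 is equivalent to
   the squared norm in H^2_0 (Parseval, by closability of the second derivative), and the
   traces being of size sqrt(lambda_n), Ingham's inequality for the coefficients
   c_n Phi_n''(l) gives the theorem. *)

Require Import Defs.
From mathcomp Require Import all_boot all_order all_algebra.
From mathcomp Require Import all_classical all_reals all_analysis.
From mathcomp Require Import complex.
From mathcomp Require Import measurable_realfun ring lra.
Import Order.TTheory GRing.Theory Num.Theory.
Import numFieldNormedType.Exports.

Set Implicit Arguments.
Unset Strict Implicit.
Unset Printing Implicit Defensive.

Local Open Scope classical_set_scope.
Local Open Scope ring_scope.
Local Open Scope complex_scope.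

(** * Integrals on a segment *)

Section Integrals.
Context {R : realType}.
Notation mu := (@lebesgue_measure R).
Implicit Types (a b c x y : R) (f g h : R -> R).

(** Every estimate is made on real functions: the coefficients and [lam] being real, the two parts
    of an eigenfunction solve the same system, and the complex structure returns only through the
    orthonormality relations. Low regularity shapes the rest. No asymptotic formula for the
    eigenvalues is used, a gap tending to infinity being all that is asked of the spectrum, and
    quantities are differentiated only once grouped into absolutely continuous ones. The gap rests
    on orthogonality: two eigenfunctions with the same trace differ by a function at least as large
    as either of them, whereas observability with zero trace bounds this difference by the distance
    between the eigenvalues. The final constants must not depend on the eigenbasis; hence the set
    [eigenval] is defined from the coefficients alone, Ingham's inequality holds for all its finite
    subsets with the same constants, and the bounds on the trace are homogeneous in the
    eigenfunction. The trace of the solution is constructed rather than given, which requires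
    completeness of the space of square-integrable functions. *)

Definition itg a b f : Prop := mu.-integrable `[a, b] (EFin \o f).
Definition Int a b f : R := \int[mu]_(x in `[a, b]) f x.
Definition cont a b f : Prop := {within `[a, b], continuous f}.
Definition meas a b f : Prop := measurable_fun `[a, b] f.

Lemma itg_meas a b f : itg a b f -> meas a b f.
Proof. by move/integrableP => [/measurable_EFinP]. Qed.

Lemma itg_ext a b f g : (forall x, a <= x <= b -> f x = g x) ->
  itg a b f -> itg a b g.
Proof.
move=> fg; apply: eq_integrable => // x; rewrite inE /= in_itv /= => xab.
by rewrite fg.
Qed.

Lemma Int_ext a b f g : (forall x, a <= x <= b -> f x = g x) ->
  Int a b f = Int a b g.
Proof.
by move=> fg; apply: eq_Rintegral => x; rewrite inE /= in_itv /=; exact: fg.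
Qed.

Lemma itg_cst a b c : itg a b (fun=> c).
Proof.
apply: measurable_bounded_integrable => //.
- by rewrite /= lebesgue_measure_itv/=; case: ifPn => _; rewrite ?ltry.
- exists `|c|; split => [|M cM x _ /=]; first exact: num_real.
  exact: ltW.
Qed.

Lemma Int_cst a b c : a <= b -> Int a b (fun=> c) = c * (b - a).
Proof.
move=> ab; rewrite /Int Rintegral_cst //=.
rewrite lebesgue_measure_itv /= lte_fin; case: ltP => // ba.
by have -> : a = b; [apply/eqP; rewrite eq_le ab ba|rewrite subrr].
Qed.

Lemma itgD a b f g : itg a b f -> itg a b g -> itg a b (fun x => f x + g x).
Proof. by move=> fi gi; exact: (integrableD _ fi gi). Qed.

Lemma itgZ a b c f : itg a b f -> itg a b (fun x => c * f x).
Proof. by move=> fi; exact: (integrableZl _ c fi). Qed.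

Lemma itgN a b f : itg a b f -> itg a b (fun x => - f x).
Proof.
by move=> fi; apply: (@itg_ext a b (fun x => (-1) * f x)) => [x _|];
   [rewrite mulN1r|exact: itgZ].
Qed.

Lemma itgB a b f g : itg a b f -> itg a b g -> itg a b (fun x => f x - g x).
Proof. by move=> fi gi; apply: itgD => //; exact: itgN. Qed.

Lemma itg_abs a b f : itg a b f -> itg a b (fun x => `|f x|).
Proof. by move=> fi; exact: integrable_norm. Qed.

Lemma itg_le a b f g : meas a b f -> itg a b g ->
  (forall x, a <= x <= b -> `|f x| <= g x) -> itg a b f.
Proof.
move=> mf gi fg; apply: (le_integrable _ _ _ gi) => //.
  exact/measurable_EFinP.
move=> x /=; rewrite in_itv /= => xab.
by rewrite lee_fin (le_trans (fg x xab)) // ler_norm.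
Qed.

Lemma itg_sub a b c d f : a <= c -> d <= b -> itg a b f -> itg c d f.
Proof.
move=> ac db; apply: integrableS => // x /=; rewrite !in_itv /=.
by move=> /andP[cx xd]; rewrite (le_trans ac cx) (le_trans xd db).
Qed.

Lemma itg_sum a b (I : Type) (s : seq I) (P : pred I) (F : I -> R -> R) :
  (forall i, P i -> itg a b (F i)) -> itg a b (fun x => \sum_(i <- s | P i) F i x).
Proof.
move=> Fi; elim: s => [|i s IH].
  by apply: (@itg_ext a b (fun=> 0)) => [x _|]; [rewrite big_nil|exact: itg_cst].
case Pi : (P i); last first.
  by apply: itg_ext IH => x _; rewrite big_cons Pi.
apply: (@itg_ext a b (fun x => F i x + \sum_(i <- s | P i) F i x)).
  by move=> x _; rewrite big_cons Pi.
by apply: itgD => //; exact: Fi.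
Qed.

Lemma IntD a b f g : itg a b f -> itg a b g ->
  Int a b (fun x => f x + g x) = Int a b f + Int a b g.
Proof. by move=> fi gi; exact: RintegralD. Qed.

Lemma IntZ a b c f : itg a b f -> Int a b (fun x => c * f x) = c * Int a b f.
Proof. by move=> fi; exact: RintegralZl. Qed.

Lemma IntN a b f : itg a b f -> Int a b (fun x => - f x) = - Int a b f.
Proof.
move=> fi; rewrite -mulN1r -IntZ //; apply: Int_ext => x _.
by rewrite mulN1r.
Qed.

Lemma IntB a b f g : itg a b f -> itg a b g ->
  Int a b (fun x => f x - g x) = Int a b f - Int a b g.
Proof. by move=> fi gi; exact: RintegralB. Qed.

Lemma Int_sum a b (I : Type) (s : seq I) (P : pred I) (F : I -> R -> R) :
  (forall i, P i -> itg a b (F i)) ->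
  Int a b (fun x => \sum_(i <- s | P i) F i x) = \sum_(i <- s | P i) Int a b (F i).
Proof.
move=> Fi; elim: s => [|i s IH].
  rewrite big_nil -(mul0r (b - a)) /Int.
  under eq_Rintegral do rewrite big_nil.
  by rewrite mul0r Rintegral_cst // mul0r.
rewrite big_cons -IH; case Pi : (P i); last first.
  by apply: Int_ext => x _; rewrite big_cons Pi.
rewrite -IntD //; [|exact: Fi|exact: itg_sum].
by apply: Int_ext => x _; rewrite big_cons Pi.
Qed.

Lemma Int_ge0 a b f : (forall x, a <= x <= b -> 0 <= f x) -> 0 <= Int a b f.
Proof. by move=> f0; apply: Rintegral_ge0 => x /=; rewrite in_itv /=; exact: f0. Qed.

Lemma Int_le a b f g : itg a b f -> itg a b g ->
  (forall x, a <= x <= b -> f x <= g x) -> Int a b f <= Int a b g.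
Proof.
by move=> fi gi fg; apply: le_Rintegral => // x /=; rewrite in_itv /=; exact: fg.
Qed.

Lemma Int_abs a b f : itg a b f -> `|Int a b f| <= Int a b (fun x => `|f x|).
Proof. by move=> fi; exact: le_normr_Rintegral. Qed.

Lemma Int_chasles a b c f : a <= b -> b <= c -> itg a c f ->
  Int a c f = Int a b f + Int b c f.
Proof.
move=> ab bc fi.
have := @Rintegral_itvB R f (BLeft a) (BRight c) b fi.
rewrite !bnd_simp => /(_ ab bc) /eqP.
rewrite subr_eq => /eqP; rewrite /Int => ->; rewrite addrC; congr (_ + _).
apply: Rintegral_itv_obnd_cbnd.
apply: (integrableS _ _ _ fi) => //=.
by move=> x /=; rewrite !in_itv /= => /andP[bx ->]; rewrite (le_trans ab (ltW bx)).
Qed.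

Lemma Int_same a f : Int a a f = 0.
Proof. by rewrite /Int set_itv1 Rintegral_set1. Qed.

Lemma ae_imp (P Q : R -> Prop) : (forall x, P x -> Q x) ->
  {ae mu, forall x, P x} -> {ae mu, forall x, Q x}.
Proof. by move=> PQ; apply: (@filterS _ _ (ae_filter_ringOfSetsType mu)). Qed.

Lemma ae_imp2 (P Q S : R -> Prop) : (forall x, P x -> Q x -> S x) ->
  {ae mu, forall x, P x} -> {ae mu, forall x, Q x} -> {ae mu, forall x, S x}.
Proof. by move=> PQ; apply: (@filterS2 _ _ (ae_filter_ringOfSetsType mu)). Qed.

Lemma Int_ae a b f g : meas a b f -> meas a b g ->
  {ae mu, forall x, x \in `[a, b] -> f x = g x} -> Int a b f = Int a b g.
Proof.
move=> fm gm fg; rewrite /Int /Rintegral; congr fine.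
apply: ae_eq_integral; [by []|exact/measurable_EFinP|exact/measurable_EFinP|].
by apply: ae_imp fg => x /= fg xab; congr EFin; exact: fg.
Qed.

Lemma itg_ae a b f g : meas a b g -> itg a b f ->
  {ae mu, forall x, x \in `[a, b] -> f x = g x} -> itg a b g.
Proof.
move=> mg fi fg; apply/integrableP; split; first exact/measurable_EFinP.
move: (fi) => /integrableP[mf]; congr (_ < _)%E.
apply: ae_eq_integral; first by [].
- exact: measurableT_comp.
- by apply: measurableT_comp => //; apply/measurable_EFinP.
by apply: ae_imp fg => x /= fg xab; rewrite fg.
Qed.

Lemma cont_itg a b f : cont a b f -> itg a b f.
Proof.
by move=> cf; apply: continuous_compact_integrable => //; exact: segment_compact.
Qed.

Lemma cont_meas a b f : cont a b f -> meas a b f.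
Proof. by move/cont_itg/itg_meas. Qed.

Lemma cont_bounded a b f : cont a b f ->
  exists2 M, 0 < M & forall x, a <= x <= b -> `|f x| <= M.
Proof.
move=> cf; have := continuous_compact cf (@segment_compact _ a b).
move=> /compact_bounded[M [_ HM]].
exists (`|M| + 1) => [|x xab]; first by rewrite ltr_wpDl.
apply: (HM (`|M| + 1)); first by rewrite (le_lt_trans (ler_norm _)) // ltrDl.
by exists x => //=; rewrite in_itv.
Qed.

Lemma itg_mulb a b f g : meas a b g -> itg a b f ->
  (exists2 M, 0 < M & forall x, a <= x <= b -> `|g x| <= M) ->
  itg a b (fun x => g x * f x).
Proof.
move=> gm fi [M M0 gM]; apply: (@itg_le a b _ (fun x => M * `|f x|)).
- by apply: measurable_funM => //; exact: itg_meas.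
- by apply: itgZ; exact: itg_abs.
- by move=> x xab; rewrite normrM ler_wpM2r // gM.
Qed.

Lemma itg_cmul a b f g : cont a b g -> itg a b f -> itg a b (fun x => g x * f x).
Proof.
by move=> cg fi; apply: itg_mulb => //; [exact: cont_meas|exact: cont_bounded].
Qed.

Lemma itg_mulc a b f g : itg a b f -> cont a b g -> itg a b (fun x => f x * g x).
Proof.
by move=> fi cg; apply: itg_ext (itg_cmul cg fi) => x _; rewrite mulrC.
Qed.

Lemma cont_ext a b f g : (forall x, a <= x <= b -> f x = g x) ->
  cont a b f -> cont a b g.
Proof.
move=> fg; rewrite /cont => cf; apply: subspace_eq_continuous cf => x.
by rewrite inE /= in_itv /=; exact: fg.
Qed.

Lemma contD a b f g : cont a b f -> cont a b g -> cont a b (fun x => f x + g x).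
Proof. by move=> cf cg x; apply: continuousD; [exact: cf|exact: cg]. Qed.
Lemma contM a b f g : cont a b f -> cont a b g -> cont a b (fun x => f x * g x).
Proof. by move=> cf cg x; apply: continuousM; [exact: cf|exact: cg]. Qed.
Lemma contN a b f : cont a b f -> cont a b (fun x => - f x).
Proof. by move=> cf x; apply: continuousN; exact: cf. Qed.
Lemma contB a b f g : cont a b f -> cont a b g -> cont a b (fun x => f x - g x).
Proof. by move=> cf cg; apply: contD => //; exact: contN. Qed.
Lemma cont_cst a b c : cont a b (fun=> c).
Proof. by move=> x; exact: cst_continuous. Qed.
Lemma contZ a b c f : cont a b f -> cont a b (fun x => c * f x).
Proof. by move=> cf; apply: contM => //; exact: cont_cst. Qed.

Lemma continuous_cont a b f : continuous f -> cont a b f.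
Proof. by move=> cf; exact: continuous_subspaceT. Qed.

Lemma contV a b f : (forall x, a <= x <= b -> f x != 0) -> cont a b f ->
  cont a b (fun x => (f x)^-1).
Proof.
move=> f0 cf; rewrite /cont; rewrite continuous_subspace_in => x xab.
apply: cvgV; last exact: cf.
by apply: f0; move: xab; rewrite inE /= in_itv.
Qed.

Lemma contX a b n f : cont a b f -> cont a b (fun x => f x ^+ n).
Proof.
move=> cf; elim: n => [|n IH]; first exact: cont_cst.
by apply: cont_ext (contM cf IH) => x _; rewrite exprS.
Qed.

Lemma cont_sum a b (I : Type) (s : seq I) (P : pred I) (F : I -> R -> R) :
  (forall i, P i -> cont a b (F i)) -> cont a b (fun x => \sum_(i <- s | P i) F i x).
Proof.
move=> Fi; elim: s => [|i s IH].
  by apply: (@cont_ext _ _ (fun=> 0)) => [x _|]; [rewrite big_nil|exact: cont_cst].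
case Pi : (P i); last by apply: cont_ext IH => x _; rewrite big_cons Pi.
apply: (@cont_ext _ _ (fun x => F i x + \sum_(i <- s | P i) F i x)).
  by move=> x _; rewrite big_cons Pi.
by apply: contD => //; exact: Fi.
Qed.

End Integrals.

Ltac cont_tac := repeat match goal with
  | |- cont _ _ (fun x => @?f x + @?g x) => apply: (@contD _ _ _ f g)
  | |- cont _ _ (fun x => - @?f x) => apply: (@contN _ _ _ f)
  | |- cont _ _ (fun x => @?f x * @?g x) => apply: (@contM _ _ _ f g)
  | |- cont _ _ (fun x => @?f x ^+ ?n) => apply: (@contX _ _ _ n f)
  | |- cont _ _ (fun=> ?c) => exact: cont_cst
  | |- _ => assumption
  end.

(** * Absolutely continuous functions *)

Section Primitives.
Context {R : realType}.
Notation mu := (@lebesgue_measure R).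
Implicit Types (a b c x y : R) (f g h F G D : R -> R).

(** Absolute continuity, encoded as being the indefinite integral of a density. The density is an
    argument because it is determined only up to null sets and each calculus rule below produces an
    explicit one. *)
Definition prim a b F f : Prop :=
  itg a b f /\ forall x, a <= x <= b -> F x = F a + Int a x f.

Lemma prim_itg a b F f : prim a b F f -> itg a b f.
Proof. by case. Qed.

Lemma prim_diff a b F f x y : prim a b F f -> a <= x -> x <= y -> y <= b ->
  F y - F x = Int x y f.
Proof.
move=> [fi HF] ax xy yb.
rewrite (HF y) ?(le_trans ax xy) // (HF x) ?ax ?(le_trans xy yb) //.
rewrite (@Int_chasles _ a x y) //; last exact: itg_sub fi.
by ring.
Qed.

Lemma prim_Int a b F f : prim a b F f -> a <= b -> Int a b f = F b - F a.
Proof. by move=> HF ab; rewrite (prim_diff HF). Qed.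

Lemma prim_ext a b F f G g :
  (forall x, a <= x <= b -> F x = G x) -> (forall x, a <= x <= b -> f x = g x) ->
  prim a b F f -> prim a b G g.
Proof.
move=> FG fg [fi HF]; split; first exact: itg_ext fi.
move=> x /andP[ax xb].
rewrite -!FG ?ax ?xb ?lexx ?(le_trans ax xb) // (HF x) ?ax // ; congr (_ + _).
by apply: Int_ext => y /andP[ay yx]; rewrite fg // ay (le_trans yx xb).
Qed.

Lemma prim_ae a b F f g : meas a b g ->
  {ae mu, forall x, x \in `[a, b] -> f x = g x} -> prim a b F f -> prim a b F g.
Proof.
move=> gm fg [fi HF]; have gi : itg a b g by exact: itg_ae fg.
split=> // x /andP[ax xb]; rewrite (HF x) ?ax //; congr (_ + _).
have fix_ : itg a x f by apply: itg_sub fi.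
have gix : itg a x g by apply: itg_sub gi.
apply: Int_ae; [exact: itg_meas|exact: itg_meas|].
apply: ae_imp fg => y fg; rewrite in_itv /= => /andP[ay yx].
by apply: fg; rewrite in_itv /= ay (le_trans yx xb).
Qed.

Lemma prim_sub a b c d F f : a <= c -> d <= b -> prim a b F f -> prim c d F f.
Proof.
move=> ac db HF; split; first by apply: itg_sub (prim_itg HF).
move=> x /andP[cx xd]; rewrite -(prim_diff HF ac cx (le_trans xd db)).
by rewrite addrC subrK.
Qed.

Lemma primD a b F f G g : prim a b F f -> prim a b G g ->
  prim a b (fun x => F x + G x) (fun x => f x + g x).
Proof.
move=> [fi HF] [gi HG]; split; first exact: itgD.
move=> x /andP[ax xb]; rewrite HF ?ax // HG ?ax // IntD //.
- by rewrite addrACA.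
- exact: itg_sub fi.
- exact: itg_sub gi.
Qed.

Lemma primZ a b c F f : prim a b F f -> prim a b (fun x => c * F x) (fun x => c * f x).
Proof.
move=> [fi HF]; split; first exact: itgZ.
move=> x /andP[ax xb]; rewrite HF ?ax // IntZ ?mulrDr //.
exact: itg_sub fi.
Qed.

Lemma primN a b F f : prim a b F f -> prim a b (fun x => - F x) (fun x => - f x).
Proof.
move=> HF; apply: prim_ext (primZ (-1) HF) => x _; rewrite mulN1r //.
Qed.

Lemma primB a b F f G g : prim a b F f -> prim a b G g ->
  prim a b (fun x => F x - G x) (fun x => f x - g x).
Proof. by move=> HF HG; apply: primD => //; exact: primN. Qed.

Lemma prim_cst a b c : prim a b (fun=> c) (fun=> 0).
Proof.
split; first exact: itg_cst.
by move=> x /andP[ax _]; rewrite Int_cst // mul0r addr0.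
Qed.

Lemma prim_id a b : prim a b (fun x => x) (fun=> 1).
Proof.
split; first exact: itg_cst.
by move=> x /andP[ax _]; rewrite Int_cst // mul1r addrC subrK.
Qed.

Lemma prim_sum a b (I : Type) (s : seq I) (P : pred I) (F f : I -> R -> R) :
  (forall i, P i -> prim a b (F i) (f i)) ->
  prim a b (fun x => \sum_(i <- s | P i) F i x) (fun x => \sum_(i <- s | P i) f i x).
Proof.
move=> Fi; elim: s => [|i s IH].
  by apply: prim_ext (prim_cst a b 0) => x _; rewrite big_nil.
case Pi : (P i); last first.
  by apply: prim_ext IH => x _; rewrite big_cons Pi.
by apply: prim_ext (primD (Fi i Pi) IH) => x _; rewrite big_cons Pi.
Qed.

Lemma prim_cont a b F f : prim a b F f -> cont a b F.
Proof.
move=> [fi HF]; have [ab|ba] := leP a b; last first.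
  by rewrite /cont set_itv_ge ?bnd_simp -?ltNge // => x; apply: continuous_subspace0.
apply: (@cont_ext _ _ _ (fun x => F a + Int a x f)) => [x xab|].
  by rewrite -HF.
apply: contD; first exact: cont_cst.
exact: parameterized_integral_continuous.
Qed.

(** Absolute continuity of the Lebesgue integral, applied to [f] extended by zero outside
    [[a, b]]. *)
Lemma prim_unif a b F f : prim a b F f -> forall e, 0 < e ->
  exists2 d, 0 < d & forall x y, a <= x -> x <= y -> y <= b -> y - x < d ->
    `|F y - F x| < e.
Proof.
move=> HF e e0; have fi := prim_itg HF.
have fi' : mu.-integrable setT (EFin \o (f \_ `[a, b])).
  rewrite -restrict_EFin; apply/integrable_restrict => //=.
  by rewrite setTI.
have [d [d0 Hd]] := integral_normr_continuous fi' e0.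
exists d => // x y ax xy yb yxd.
rewrite (prim_diff HF) //.
have fxy : itg x y f by apply: itg_sub fi.
apply: (le_lt_trans (Int_abs fxy)).
rewrite (_ : Int x y _ = \int[mu]_(t in `[x, y]) `|(f \_ `[a, b]) t|).
  apply: Hd => //=; rewrite lebesgue_measure_itv /= lte_fin.
  by case: ifP => _; rewrite -?EFinB lte_fin.
apply: Int_ext => t /andP[xt ty]; rewrite patchE mem_set //=.
by rewrite in_itv /= (le_trans ax xt) (le_trans ty yb).
Qed.

(** Adding the increments over a fine subdivision bounds [|D b - D a|] by [e * Int a b h] for every
    [e]. This replaces the mean value theorem for functions differentiable only almost
    everywhere. *)
Lemma small_increments_const a b D h : a <= b -> itg a b h ->
  (forall e, 0 < e -> exists2 d, 0 < d &
    forall x y, a <= x -> x <= y -> y <= b -> y - x < d ->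
      `|D y - D x| <= e * Int x y h) ->
  D b = D a.
Proof.
move=> ab hi HD; apply/eqP; rewrite -subr_eq0 -normr_le0.
apply/ler_addgt0Pl => e e0; rewrite addr0.
(* The added 1 keeps the divisor positive when the integral of [h] vanishes. *)
pose H := `|Int a b h| + 1.
have H0 : 0 < H by rewrite ltr_wpDl.
have [d d0 Hd] := HD (e / H) (divr_gt0 e0 H0).
pose N := (Num.truncn ((b - a) / d)).+1.
have N0 : 0 < N%:R :> R by rewrite ltr0n.
have Nd : (b - a) / N%:R < d.
  rewrite ltr_pdivrMr // mulrC -ltr_pdivrMr //.
  exact: truncnS_gt.
pose p k : R := a + k%:R * ((b - a) / N%:R).
have stp : 0 <= (b - a) / N%:R by rewrite divr_ge0 ?subr_ge0 // ltW.
have pa k : a <= p k by rewrite /p lerDl mulr_ge0.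
have pS k : p k.+1 = p k + (b - a) / N%:R by rewrite /p -natr1 mulrDl mul1r addrA.
have pb k : (k <= N)%N -> p k <= b.
  move=> kN; rewrite /p -lerBrDl mulrCA ler_piMr ?subr_ge0 //.
  by rewrite ler_pdivrMr // mul1r ler_nat.
have main k : (k <= N)%N -> `|D (p k) - D a| <= e / H * Int a (p k) h.
  elim: k => [_|k IH kN].
    by rewrite /p mul0r addr0 subrr normr0 Int_same mulr0.
  have kN' := ltnW kN.
  have pkS : p k <= p k.+1 by rewrite pS lerDl.
  rewrite (@Int_chasles _ a (p k) (p k.+1)) //; last first.
    by apply: itg_sub hi => //; exact: pb.
  rewrite mulrDr -[D (p k.+1)](subrK (D (p k))) -addrA addrC.
  apply: (le_trans (ler_normD _ _)); apply: lerD; first exact: IH.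
  by apply: Hd => //; [exact: pb|rewrite pS addrAC subrr add0r].
have pN : p N = b.
  by rewrite /p mulrC divfK ?gt_eqF // addrC subrK.
have := main N (leqnn _); rewrite pN => /le_trans; apply.
rewrite mulrAC ler_pdivrMr // ler_wpM2l ?(ltW e0) //.
by rewrite (le_trans (ler_norm _)) // lerDl.
Qed.

(** Let [D] be the difference between [phi (F x)] and the candidate integral. An increment of [D] is
    a Taylor remainder plus the error made by freezing [dphi (F y)] at the left end; each is at most
    [K] times the oscillation of [F] times the integral of [|f|]. Only a Lipschitz derivative is
    asked of [phi], so as to include the squared negative part. *)
Lemma prim_comp a b F f (phi dphi : R -> R) (K : R) :
  (forall x y, `|phi y - phi x - dphi x * (y - x)| <= K * (y - x) ^+ 2) ->
  (forall x y, `|dphi y - dphi x| <= K * `|y - x|) ->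
  prim a b F f -> prim a b (fun x => phi (F x)) (fun x => dphi (F x) * f x).
Proof.
move=> Hphi Hdphi HF; have fi := prim_itg HF.
have K0 : 0 <= K.
  by have := Hdphi 0 1; rewrite subr0 normr1 mulr1; exact: le_trans.
have dcont : continuous dphi.
  move=> x; apply/cvgrPdist_le => /= e e0.
  have d0 : 0 < e / (K + 1) by rewrite divr_gt0 // ltr_wpDl.
  near=> t; apply: (le_trans (Hdphi _ _)).
  have : `|x - t| <= e / (K + 1) by near: t; exact: cvgr_dist_le.
  move=> Ht; apply: (@le_trans _ _ ((K + 1) * (e / (K + 1)))).
    by apply: ler_pM => //; rewrite lerDl.
  by rewrite mulrC divfK // gt_eqF // ltr_wpDl.
have dFc : cont a b (fun x => dphi (F x)).
  move=> x; apply: continuous_comp; first exact: (prim_cont HF).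
  exact: dcont.
have dfi : itg a b (fun x => dphi (F x) * f x) by exact: itg_cmul.
split=> // x /andP[ax xb].
pose D y := phi (F y) - Int a y (fun x => dphi (F x) * f x).
suff : D x = D a by rewrite /D Int_same subr0 => <-; rewrite subrK.
have fix_ : itg a x f by apply: itg_sub fi.
apply: (small_increments_const ax (itg_abs fix_)) => e e0.
pose C := K + K + 1.
have C0 : 0 < C by rewrite ltr_wpDl // addr_ge0.
have [d d0 Hd] := prim_unif HF (divr_gt0 e0 C0).
exists d => // s t as_ st tx stl.
have tb := le_trans tx xb; have sb := le_trans st tb; have at_ := le_trans as_ st.
have fst : itg s t f by apply: itg_sub fi.
have dfst : itg s t (fun x => dphi (F x) * f x) by apply: itg_sub dfi.
have I0 : 0 <= Int s t (fun y => `|f y|) by apply: Int_ge0.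
have -> : D t - D s = (phi (F t) - phi (F s) - dphi (F s) * (F t - F s))
     - Int s t (fun y => (dphi (F y) - dphi (F s)) * f y).
  have -> : Int s t (fun y => (dphi (F y) - dphi (F s)) * f y) =
      Int s t (fun y => dphi (F y) * f y) - dphi (F s) * (F t - F s).
    rewrite (prim_diff HF) // -IntZ // -IntB //; last exact: itgZ.
    by apply: Int_ext => y _; rewrite mulrBl.
  rewrite /D (@Int_chasles _ a s t) //; last by apply: itg_sub dfi.
  by ring.
apply: (@le_trans _ _ (K * (e / C) * Int s t (fun y => `|f y|) +
   K * (e / C) * Int s t (fun y => `|f y|))); last first.
  rewrite -mulrDl -mulrDl ler_wpM2r // mulrA ler_pdivrMr // mulrC.
  by rewrite ler_wpM2l ?(ltW e0) // lerDl.
apply: (le_trans (ler_normB _ _)); apply: lerD.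
  apply: (le_trans (Hphi _ _)).
  rewrite -mulrA ler_wpM2l // -[leLHS]ger0_norm ?sqr_ge0 // expr2 normrM ler_pM //.
    by apply/ltW/Hd.
  by rewrite (prim_diff HF) //; exact: Int_abs.
have gi : itg s t (fun y => (dphi (F y) - dphi (F s)) * f y).
  apply: (@itg_ext _ _ _ (fun y => dphi (F y) * f y - dphi (F s) * f y)).
    by move=> y _; rewrite mulrBl.
  by apply: itgB => //; exact: itgZ.
apply: (le_trans (Int_abs gi)); rewrite -IntZ; last exact: itg_abs.
apply: Int_le; [exact: itg_abs|by apply: itgZ; exact: itg_abs|].
move=> y /andP[sy yt]; rewrite normrM ler_wpM2r //.
apply: (le_trans (Hdphi _ _)); rewrite ler_wpM2l //.
apply/ltW/Hd => //; first exact: le_trans yt tb.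
by apply: le_lt_trans stl; rewrite lerD2r.
Unshelve. all: by end_near. Qed.

Lemma prim_sqr a b F f : prim a b F f ->
  prim a b (fun x => F x ^+ 2) (fun x => 2 * F x * f x).
Proof.
apply: (@prim_comp _ _ _ _ (fun x => x ^+ 2) (fun x => 2 * x) 2) => x y.
  rewrite (_ : _ - _ = (y - x) ^+ 2); last ring.
  by rewrite ger0_norm ?sqr_ge0 //; have := sqr_ge0 (y - x); lra.
by rewrite -mulrBr normrM ger0_norm.
Qed.

(** Polarization: the product is a quarter of the difference of the squares of [F + G] and
    [F - G]. *)
Lemma prim_mul a b F f G g : prim a b F f -> prim a b G g ->
  prim a b (fun x => F x * G x) (fun x => f x * G x + F x * g x).
Proof.
move=> HF HG; have HD := prim_sqr (primD HF HG).
have HB := prim_sqr (primB HF HG).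
by apply: prim_ext (primZ (1/4) (primB HD HB)) => x _; field.
Qed.

(** The squared negative part has a Lipschitz derivative without being twice differentiable at 0. It
    serves the Gronwall argument on signs. *)
Lemma prim_min2 a b F f : prim a b F f ->
  prim a b (fun x => Num.min (F x) 0 ^+ 2) (fun x => 2 * Num.min (F x) 0 * f x).
Proof.
apply: (@prim_comp _ _ _ _ (fun x => Num.min x 0 ^+ 2) (fun x => 2 * Num.min x 0) 2) => x y.
  have := sqr_ge0 (y - x); have := sqr_ge0 x; have := sqr_ge0 y.
  rewrite ler_norml; have [x0|x0] := leP x 0; have [y0|y0] := leP y 0 => h1 h2 h3.
  - by apply/andP; split; nra.
  - by have xy := mulr_le0_ge0 x0 (ltW y0); apply/andP; split; nra.
  - by have xy := mulr_ge0_le0 (ltW x0) y0; apply/andP; split; nra.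
  - by apply/andP; split; nra.
rewrite -mulrBr normrM ger0_norm // ler_pM2l // ler_norml.
have [xy|yx] := leP x y; [rewrite ger0_norm ?subr_ge0 //|rewrite ltr0_norm ?subr_lt0 //];
  have [x0|x0] := leP x 0; have [y0|y0] := leP y 0; apply/andP; split; lra.
Qed.

Lemma prim_classic a b F f : (forall x, is_derive x (1 : R) F (f x)) ->
  continuous f -> prim a b F f.
Proof.
move=> dF cf; split; first exact/cont_itg/continuous_cont.
move=> x /andP[]; rewrite le_eqVlt => /predU1P[<- _|ax xb].
  by rewrite Int_same addr0.
have cF : continuous F.
  move=> y; apply: differentiable_continuous.
  by apply/derivable1_diffP; case: (dF y).
suff H : (\int[mu]_(x in `[a, x]) (f x)%:E = (F x)%:E - (F a)%:E)%E.
  by rewrite /Int /Rintegral H /=; ring.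
apply: continuous_FTC2 => //; first exact: continuous_cont.
- split => [y _|//|//]; first by case: (dF y).
  + by apply: cvg_at_right_filter; exact: cF.
  + by apply: cvg_at_left_filter; exact: cF.
- by move=> y _; rewrite derive1E; case: (dF y).
Qed.

Lemma prim_le a b F f : a <= b -> prim a b F f ->
  (forall x, a <= x <= b -> 0 <= f x) -> F a <= F b.
Proof.
by move=> ab HF f0; rewrite -subr_ge0 -(prim_Int HF ab); exact: Int_ge0.
Qed.

Lemma prim_by_parts a b F f G g : a <= b -> prim a b F f -> prim a b G g ->
  Int a b (fun x => f x * G x) = F b * G b - F a * G a - Int a b (fun x => F x * g x).
Proof.
move=> ab HF HG; have H := prim_mul HF HG.
rewrite -(prim_Int H ab) IntD ?addrK //.
  exact: itg_mulc (prim_itg HF) (prim_cont HG).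
exact: itg_cmul (prim_cont HF) (prim_itg HG).
Qed.

End Primitives.

(** * Square-integrable functions *)

Section SquareIntegrable.
Context {R : realType}.
Implicit Types (a b c x y : R) (f g h F G D : R -> R).

Definition L2r a b f : Prop := meas a b f /\ itg a b (fun x => f x ^+ 2).
Definition sq a b f : R := Int a b (fun x => f x ^+ 2).

Lemma sq_ge0 a b f : 0 <= sq a b f.
Proof. by apply: Int_ge0 => x _; exact: sqr_ge0. Qed.

Lemma L2r_ext a b f g : (forall x, a <= x <= b -> f x = g x) ->
  L2r a b f -> L2r a b g.
Proof.
move=> fg [mf fi]; split.
  apply: eq_measurable_fun mf => x; rewrite inE /= in_itv /=; exact: fg.
by apply: itg_ext fi => x xab; rewrite fg.
Qed.

Lemma sq_ext a b f g : (forall x, a <= x <= b -> f x = g x) -> sq a b f = sq a b g.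
Proof. by move=> fg; apply: Int_ext => x xab; rewrite fg. Qed.

Lemma L2r_mul a b f g : L2r a b f -> L2r a b g -> itg a b (fun x => f x * g x).
Proof.
move=> [mf fi] [mg gi]; apply: (itg_le _ (itgD fi gi)).
  exact: measurable_funM.
move=> x _; rewrite normrM -(real_normK (num_real (f x))) -(real_normK (num_real (g x))).
have := sqr_ge0 (`|f x| - `|g x|); have := normr_ge0 (f x); have := normr_ge0 (g x).
set u := `|f x|; set v := `|g x|; nra.
Qed.

Lemma L2r_cst a b c : L2r a b (fun=> c).
Proof. by split; [exact: itg_meas (itg_cst _ _ _)|exact: itg_cst]. Qed.

Lemma L2r_cont a b f : cont a b f -> L2r a b f.
Proof.
move=> cf; split; first exact: cont_meas.
by apply/cont_itg; apply: contM.
Qed.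

Lemma L2r_itg a b f : L2r a b f -> itg a b f.
Proof.
by move=> fi; apply: itg_ext (L2r_mul fi (L2r_cst a b 1)) => x _; rewrite mulr1.
Qed.

Lemma L2rD a b f g : L2r a b f -> L2r a b g -> L2r a b (fun x => f x + g x).
Proof.
move=> fi gi; split; first by apply: measurable_funD; [case: fi|case: gi].
apply: (@itg_ext _ _ _ (fun x => f x ^+ 2 + (2 * (f x * g x) + g x ^+ 2))).
  by move=> x _; ring.
apply: itgD; first by case: fi.
apply: itgD; last by case: gi.
by apply: itgZ; exact: L2r_mul.
Qed.

Lemma L2rZ a b c f : L2r a b f -> L2r a b (fun x => c * f x).
Proof.
move=> [mf fi]; split; first by apply: measurable_funM.
by apply: itg_ext (itgZ (c ^+ 2) fi) => x _; ring.
Qed.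

Lemma L2rB a b f g : L2r a b f -> L2r a b g -> L2r a b (fun x => f x - g x).
Proof.
move=> fi gi; apply: L2r_ext (L2rD fi (L2rZ (-1) gi)) => x _; by rewrite mulN1r.
Qed.

Lemma L2r_sum a b (I : Type) (s : seq I) (P : pred I) (F : I -> R -> R) :
  (forall i, P i -> L2r a b (F i)) -> L2r a b (fun x => \sum_(i <- s | P i) F i x).
Proof.
move=> Fi; elim: s => [|i s IH].
  by apply: L2r_ext (L2r_cst a b 0) => x _; rewrite big_nil.
case Pi : (P i); last by apply: L2r_ext IH => x _; rewrite big_cons Pi.
by apply: L2r_ext (L2rD (Fi i Pi) IH) => x _; rewrite big_cons Pi.
Qed.

Lemma L2r_cmul a b f g : cont a b g -> L2r a b f -> L2r a b (fun x => g x * f x).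
Proof.
move=> cg [mf fi]; split; first by apply: measurable_funM => //; exact: cont_meas.
apply: (@itg_ext _ _ _ (fun x => g x ^+ 2 * f x ^+ 2)) => [x _|]; first by ring.
by apply: itg_cmul => //; exact: contM.
Qed.

Lemma sqD_le a b f g : L2r a b f -> L2r a b g ->
  sq a b (fun x => f x + g x) <= 2 * sq a b f + 2 * sq a b g.
Proof.
move=> fi gi; have [_ fi2] := fi; have [_ gi2] := gi.
have [_ fgi] := L2rD fi gi.
rewrite /sq -!IntZ // -IntD; [|exact: itgZ|exact: itgZ].
apply: Int_le => //; first by apply: itgD; exact: itgZ.
by move=> x _; have := sqr_ge0 (f x - g x); lra.
Qed.

Lemma sqB_le a b f g : L2r a b f -> L2r a b g ->
  sq a b (fun x => f x - g x) <= 2 * sq a b f + 2 * sq a b g.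
Proof.
move=> fi gi; have := sqD_le fi (L2rZ (-1) gi).
rewrite (_ : sq a b (fun x => -1 * g x) = sq a b g); last first.
  by apply: Int_ext => x _; ring.
by congr (_ <= _); apply: sq_ext => x _; rewrite mulN1r.
Qed.

Lemma sqZ a b c f : L2r a b f -> sq a b (fun x => c * f x) = c ^+ 2 * sq a b f.
Proof. by move=> [_ fi]; rewrite /sq -IntZ //; apply: Int_ext => x _; ring. Qed.

Lemma cauchy_schwarz a b f g : L2r a b f -> L2r a b g ->
  Int a b (fun x => f x * g x) ^+ 2 <= sq a b f * sq a b g.
Proof.
move=> fi gi; set A := sq a b f; set C := sq a b g; set B := Int a b _.
have H t : 0 <= A + 2 * t * B + t ^+ 2 * C.
  suff -> : A + 2 * t * B + t ^+ 2 * C = sq a b (fun x => f x + t * g x).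
    exact: sq_ge0.
  rewrite /sq (@Int_ext _ _ _ _ (fun x => f x ^+ 2 + (2 * t * (f x * g x) + t ^+ 2 * g x ^+ 2))).
    have [_ fi2] := fi; have [_ gi2] := gi; have fgi := L2r_mul fi gi.
    rewrite IntD //; last by apply: itgD; exact: itgZ.
    rewrite IntD; [|exact: itgZ|exact: itgZ].
    by rewrite !IntZ // addrA.
  by move=> x _; ring.
have C0 : 0 <= C by exact: sq_ge0.
have A0 : 0 <= A by exact: sq_ge0.
have [C1|C1] := eqVneq C 0.
  rewrite C1 mulr0; have [->|B0] := eqVneq B 0; first by rewrite expr0n.
  (* With [C = 0] the polynomial is affine in [t]; at this point it would equal -1. *)
  have := H (- (A + 1) / (2 * B)); rewrite C1 mulr0 addr0.
  have -> : 2 * (- (A + 1) / (2 * B)) * B = - (A + 1) by field.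
  by lra.
have Cp : 0 < C by rewrite lt_neqAle eq_sym C1.
have := H (- B / C).
have -> : A + 2 * (- B / C) * B + (- B / C) ^+ 2 * C = (A * C - B ^+ 2) / C by field.
by rewrite divr_ge0_eq ?subr_ge0 // || (rewrite pmulr_lge0 ?invr_gt0 // subr_ge0).
Qed.

Lemma Int_sqr_le a b f : a <= b -> L2r a b f -> Int a b f ^+ 2 <= (b - a) * sq a b f.
Proof.
move=> ab fi; have := cauchy_schwarz (L2r_cst a b 1) fi.
rewrite {1}/sq (@Int_ext _ _ _ _ f) => [|x _]; last by rewrite mul1r.
by rewrite (@Int_ext _ _ _ (fun x => 1 ^+ 2) (fun=> 1)) ?Int_cst ?mul1r // => x _; rewrite expr1n.
Qed.

Lemma sq_young a b f g (e : R) : 0 < e -> L2r a b f -> L2r a b g ->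
  2 * Int a b (fun x => `|f x * g x|) <= e * sq a b f + e^-1 * sq a b g.
Proof.
move=> e0 fi gi; have [_ fi2] := fi; have [_ gi2] := gi.
have fgi := itg_abs (L2r_mul fi gi).
rewrite /sq -!IntZ // -IntD; [|exact: itgZ|exact: itgZ].
apply: Int_le; [exact: itgZ|by apply: itgD; exact: itgZ|].
move=> x _; rewrite normrM -(real_normK (num_real (f x))) -(real_normK (num_real (g x))).
have := sqr_ge0 (e * `|f x| - `|g x|).
set u := `|f x|; set v := `|g x| => uv.
have : 0 <= e^-1 * (e * u - v) ^+ 2 by rewrite mulr_ge0 // invr_ge0 ltW.
have -> : e^-1 * (e * u - v) ^+ 2 = e * u ^+ 2 - 2 * (u * v) + e^-1 * v ^+ 2.
  by field; rewrite gt_eqF.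
by lra.
Qed.

End SquareIntegrable.

(** * Completeness of the space of square-integrable functions *)

Section RieszFischer.
Context {R : realType}.
Notation mu := (@lebesgue_measure R).

Lemma abs_series_cvg (u : nat -> R) (S : R) :
  (forall n, \sum_(0 <= k < n) `|u k.+1 - u k| <= S) -> cvgn u.
Proof.
move=> HS; pose d k := u k.+1 - u k.
have cd : cvgn (series d).
  apply: normed_cvg; apply: nondecreasing_is_cvgn.
    by apply/nondecreasing_seqP => n; rewrite -subr_ge0 [X in 0 <= X]seriesSB /=.
  by exists S => _ [n _ <-]; exact: HS.
have -> : u = (fun n => u 0%N + series d n).
  apply/funext => n; rewrite /series /= telescope_sumr //.
  by rewrite addrC subrK.
by apply: is_cvgD => //; exact: is_cvg_cst.
Qed.

(** Riesz-Fischer: a subsequence whose consecutive squared distances are at most [4^-k] has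
    integrable total variation, hence converges almost everywhere, and Fatou's lemma turns this into
    convergence in mean square of the whole sequence. *)
Lemma L2_complete (a b : R) (f : nat -> R -> R) : (forall n, L2r a b (f n)) ->
  (forall e, 0 < e -> exists N, forall m n, (N <= m)%N -> (N <= n)%N ->
     sq a b (fun x => f m x - f n x) <= e) ->
  exists2 g, L2r a b g & forall e, 0 < e -> exists N, forall n, (N <= n)%N ->
     sq a b (fun x => f n x - g x) <= e.
Proof.
move=> fL fC.
have [phi kphi Hphi] : exists2 phi : nat -> nat, (forall k, (k <= phi k)%N) &
    forall k m n, (phi k <= m)%N ->
      (phi k <= n)%N -> sq a b (fun x => f m x - f n x) <= 4^-1 ^+ k.
  have /choice[phi Hphi] : forall k, exists N, forall m n, (N <= m)%N -> (N <= n)%N ->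
      sq a b (fun x => f m x - f n x) <= 4^-1 ^+ k.
    by move=> k; apply: fC; rewrite exprn_gt0 // invr_gt0.
  exists (fun k => maxn (phi k) k) => [k|k m n]; first exact: leq_maxr.
  by rewrite !geq_max => /andP[km _] /andP[kn _]; exact: Hphi.
(* The running maximum makes the indices nondecreasing, so that [nn k] and [nn k.+1] both lie beyond
   [phi k]. *)
pose nn := fix nn k := if k is k'.+1 then maxn (nn k') (phi k) else phi 0%N.
have nnphi k : (phi k <= nn k)%N by case: k => //= k; exact: leq_maxr.
have nnS k : (nn k <= nn k.+1)%N by exact: leq_maxl.
pose u k := f (nn k); pose d k x := `|u k.+1 x - u k x|.
have d0 k x : 0 <= d k x by exact: normr_ge0.
have uL k : L2r a b (u k) by exact: fL.
have duL k : L2r a b (fun x => u k.+1 x - u k x) by exact: L2rB.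
have di k : itg a b (d k) by apply: itg_abs; exact: L2r_itg.
pose L := `|b - a| + 1.
(* Young's inequality with parameter [2^-k] turns the bound [4^-k] on the squared norms into a
   summable bound on the integrals. *)
have dI k : Int a b (d k) <= L * 2^-1 ^+ k.
  have e0 : 0 < 2^-1 ^+ k :> R by rewrite exprn_gt0.
  have := sq_young e0 (L2r_cst a b 1) (duL k).
  have -> : Int a b (fun x => `|1 * (u k.+1 x - u k x)|) = Int a b (d k).
    by apply: Int_ext => x _; rewrite mul1r.
  have h1 : sq a b (fun=> 1) <= L.
    rewrite /sq (@Int_ext _ _ _ _ (fun=> 1)) => [|x _]; last by rewrite expr1n.
    have [ab|ba] := leP a b; first by rewrite Int_cst // mul1r /L ger0_norm ?subr_ge0 // lerDl.
    rewrite /Int set_itv_ge ?bnd_simp -?ltNge // Rintegral_set0.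
    by rewrite addr_ge0.
  have h2 : sq a b (fun x => u k.+1 x - u k x) <= 2^-1 ^+ k * 2^-1 ^+ k.
    rewrite -exprMn (_ : 2^-1 * 2^-1 = 4^-1); last by field.
    by apply: Hphi; [exact: leq_trans (nnphi k) (nnS k)|exact: nnphi].
  have h3 : (2^-1 ^+ k)^-1 * sq a b (fun x => u k.+1 x - u k x) <= 2^-1 ^+ k.
    by rewrite mulrC ler_pdivrMr.
  have h4 : 2^-1 ^+ k * sq a b (fun=> 1) <= 2^-1 ^+ k * L by rewrite ler_pM2l.
  have h5 : 2^-1 ^+ k <= 2^-1 ^+ k * L by rewrite ler_pMr // lerDr.
  by lra.
have dI_fin k : (\int[mu]_(x in `[a, b]) (d k x)%:E = (Int a b (d k))%:E)%E.
  by rewrite /Int /Rintegral fineK //; exact: integrable_fin_num (di k).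
have ser : (\int[mu]_(x in `[a, b]) (\sum_(0 <= k <oo) (d k x)%:E) < +oo)%E.
  rewrite integral_nneseries //; first last.
  - by move=> n x _; rewrite lee_fin d0.
  - by move=> n; apply/measurable_EFinP; exact: itg_meas (di n).
  apply: (@le_lt_trans _ _ (L * 2)%:E); last by rewrite ltry.
  apply: lime_le.
    by apply: is_cvg_nneseries => n _ _; apply: integral_ge0 => x _; rewrite lee_fin d0.
  apply: nearW => n; under eq_bigr do rewrite dI_fin.
  rewrite sumEFin lee_fin.
  apply: (@le_trans _ _ (\sum_(0 <= k < n) L * 2^-1 ^+ k)).
    by apply: ler_sum => k _; exact: dI.
  rewrite -mulr_sumr ler_pM2l ?ltr_wpDl //.
  elim: n => [|n IH]; first by rewrite big_nil.
  have -> : \sum_(0 <= k < n.+1) 2^-1 ^+ k = 2 - 2 * 2^-1 ^+ n.+1 :> R.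
    elim: n {IH} => [|n IH]; first by rewrite big_nat1 expr1; field.
    by rewrite big_nat_recr //= IH !exprS; field.
  by rewrite lerBlDr lerDl mulr_ge0 // exprn_ge0.
have mser : measurable_fun `[a, b] (fun x => \sum_(0 <= k <oo) (d k x)%:E)%E.
  apply: ge0_emeasurable_sum => [k x _ _|k _]; first by rewrite lee_fin d0.
  by apply/measurable_EFinP; exact: itg_meas.
have [A [mA A0 HA]] : mu.-negligible
    [set x | ~ ((x \in `[a, b]) -> cvgn (u ^~ x))].
  have serI : mu.-integrable `[a, b] (fun x => \sum_(0 <= k <oo) (d k x)%:E)%E.
    apply/integrableP; split => //; apply: le_lt_trans ser.
    apply: ge0_le_integral => //.
    - exact: measurableT_comp.
    - move=> x _; rewrite gee0_abs //.
      by apply: nneseries_ge0 => k _ _; rewrite lee_fin d0.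
  have mI : measurable (`[a, b]%classic : set (measurableTypeR R)) by [].
  have := integrable_ae mI serI.
  apply: negligibleS => x /= H1 H2; apply: H1 => xab.
  have := H2 xab; rewrite ge0_fin_numE; last first.
    by apply: nneseries_ge0 => k _ _; rewrite lee_fin d0.
  move=> sfin; apply: (@abs_series_cvg (u ^~ x) (fine (\sum_(0 <= k <oo) (d k x)%:E)%E)) => n.
  rewrite -lee_fin fineK; last first.
    by rewrite ge0_fin_numE //; apply: nneseries_ge0 => k _ _; rewrite lee_fin d0.
  rewrite -sumEFin; apply: nneseries_lim_ge => k _ _; by rewrite lee_fin d0.
(* Cancelling the subsequence on the exceptional null set makes it converge at every point of
   [[a, b]], hence to a measurable limit. *)
pose v k x : R := u k x * \1_(~` A) x.
have vE k x : v k x = if x \in A then 0 else u k x.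
  by rewrite /v indicE in_setC; case: (x \in A); rewrite ?mulr0 ?mulr1.
pose g x := limn (v ^~ x).
have vu k : {ae mu, forall x, x \in `[a, b] -> u k x = v k x}.
  exists A; split => // x /= /not_implyP[_]; rewrite vE.
  by case: ifP => // xA; move: xA; rewrite inE.
have vg x : a <= x <= b -> v ^~ x @ \oo --> g x.
  move=> xab; rewrite /g; have [xA|xA] := boolP (x \in A).
    have -> : v ^~ x = fun=> 0 by apply/funext => k; rewrite vE xA.
    exact: is_cvg_cst.
  have -> : v ^~ x = u ^~ x by apply/funext => k; rewrite vE (negbTE xA).
  apply: contrapT => H; move/negP: xA; apply; rewrite inE; apply: HA => /=.
  by move=> H1; apply: H; apply: H1; rewrite in_itv.
have mv k : meas a b (v k).
  apply: measurable_funM; first exact: (uL k).1.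
  by apply: measurable_indic; exact: measurableC.
have mg : meas a b g.
  apply: measurable_fun_cvg mv _ => x /=; rewrite in_itv /=; exact: vg.
have key e : 0 < e -> exists N, forall n, (N <= n)%N ->
   (\int[mu]_(x in `[a, b]) ((f n x - g x) ^+ 2)%:E <= e%:E)%E.
  move=> e0; have [N HN] := fC e e0.
  (* The shift [K] brings the whole subsequence beyond the Cauchy rank [N] before Fatou's lemma is
     applied. *)
  have [K HK] : exists K, forall k, (N <= nn (k + K))%N.
    exists N => k; apply: leq_trans (nnphi _); apply: leq_trans (kphi _).
    exact: leq_addl.
  exists N => n Nn.
  have mI : measurable (`[a, b]%classic : set (measurableTypeR R)) by [].
  pose w k x := ((f n x - v (k + K)%N x) ^+ 2)%:E.
  have mw k : measurable_fun `[a, b] (w k).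
    apply/measurable_EFinP; apply: measurable_funX.
    by apply: measurable_funB; [exact: (fL n).1|exact: mv].
  have := @fatou _ _ _ mu `[a, b] mI w mw.
  have w0 k x : `[a, b]%classic x -> (0 <= w k x)%E by rewrite lee_fin sqr_ge0.
  move=> /(_ w0) H.
  have -> : (\int[mu]_(x in `[a, b]) ((f n x - g x) ^+ 2)%:E =
      \int[mu]_(x in `[a, b]) limn_einf (w ^~ x))%E.
    apply: eq_integral => x; rewrite inE /= in_itv /= => xab.
    apply/esym; apply: (cvg_limn_einf_sup _).1.
    apply: cvg_EFin; first exact: nearW.
    have vgK : v (k + K)%N x @[k --> \oo] --> g x.
      by have := vg x xab; rewrite -(cvg_shiftn K).
    have dK : (f n x - v (k + K)%N x) @[k --> \oo] --> f n x - g x.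
      by apply: cvgB => //; exact: cvg_cst.
    rewrite expr2; apply: cvg_trans (cvgM dK dK).
    by apply: near_eq_cvg; apply: nearW => k /=; rewrite expr2.
  apply: (le_trans H); rewrite limn_einf_lim; apply: lime_le; first exact: is_cvg_einfs.
  apply: nearW => k; apply: (@le_trans _ _ (\int[mu]_(x in `[a, b]) w k x)%E).
    by apply: ereal_inf_lbound; exists k => /=.
  rewrite (_ : \int[mu]_(x in `[a, b]) w k x =
     \int[mu]_(x in `[a, b]) ((f n x - u (k + K)%N x) ^+ 2)%:E)%E; last first.
    apply: ae_eq_integral => //; first exact: mw.
      apply/measurable_EFinP; apply: measurable_funX.
      by apply: measurable_funB; [exact: (fL n).1|exact: (uL _).1].
    by apply: ae_imp (vu (k + K)%N) => x H1 /= xab; rewrite /w H1.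
  have [_ i2] := L2rB (fL n) (uL (k + K)%N).
  have := HN n (nn (k + K)) Nn (HK k); rewrite -lee_fin /sq /Int /Rintegral.
  by rewrite fineK //; exact: integrable_fin_num i2.
have [N0 H0] := key 1 ltr01.
have gL : L2r a b g.
  have dL : L2r a b (fun x => f N0 x - g x).
    split; first by apply: measurable_funB; [exact: (fL N0).1|].
    have mN : meas a b (fun x => (f N0 x - g x) ^+ 2).
      apply: measurable_funX.
      by apply: measurable_funB; [exact: (fL N0).1|].
    apply/integrableP; split; first exact/measurable_EFinP.
    apply: (@le_lt_trans _ _ 1%:E); last by rewrite ltry.
    apply: le_trans (H0 N0 (leqnn _)).
    apply: ge0_le_integral => //=.
    - apply/measurable_EFinP; apply: measurableT_comp => //; exact: mN.
    - exact/measurable_EFinP.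
    - by move=> x _; rewrite lee_fin ger0_norm ?sqr_ge0.
  by apply: L2r_ext (L2rB (fL N0) dL) => x _; rewrite opprB addrC subrK.
exists g => // e e0; have [N HN] := key e e0; exists N => n Nn.
have [_ i2] := L2rB (fL n) gL.
rewrite -lee_fin; apply: le_trans (HN n Nn); rewrite /sq /Int /Rintegral.
by rewrite fineK //; exact: integrable_fin_num i2.
Qed.

End RieszFischer.

(** * The derivative relative to a segment *)

Section RelativeDerivative.
Context {R : realType}.
Notation mu := (@lebesgue_measure R).
Implicit Types (a b c l x y : R) (f g h F G D : R -> R).

(** Each point of [[0, l]] is approached from within the segment, on the right if it lies in the
    left half and on the left otherwise. The limit in [rderiv] is therefore unique. *)
Lemma within_dnbhs_proper l x : 0 < l -> 0 <= x <= l ->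
  ProperFilter (within `[0, l]%classic (dnbhs x)).
Proof.
move=> l0 /andP[x0 xl]; apply: Build_ProperFilter_ex => P; rewrite /within /dnbhs /= => -[e /= e0 He].
have [xl2|xl2] := ltP x (l / 2).
  pose z := x + Num.min (e / 2) (l / 2).
  have m0 : 0 < Num.min (e / 2) (l / 2) by rewrite lt_min !divr_gt0.
  have ml : Num.min (e / 2) (l / 2) <= l / 2 by rewrite ge_min lexx orbT.
  have me : Num.min (e / 2) (l / 2) <= e / 2 by rewrite ge_min lexx.
  exists z; apply: He => /=.
  - by rewrite /z opprD addNKr normrN gtr0_norm // (le_lt_trans me) // ltr_pdivrMr // ltr_pMr // ltr1n.
  - by rewrite /z gt_eqF // ltrDl.
  - by rewrite in_itv /= /z; lra.
pose z := x - Num.min (e / 2) (l / 2).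
have m0 : 0 < Num.min (e / 2) (l / 2) by rewrite lt_min !divr_gt0.
have ml : Num.min (e / 2) (l / 2) <= l / 2 by rewrite ge_min lexx orbT.
have me : Num.min (e / 2) (l / 2) <= e / 2 by rewrite ge_min lexx.
exists z; apply: He => /=.
- by rewrite /z opprB addrC subrK gtr0_norm // (le_lt_trans me) // ltr_pdivrMr // ltr_pMr // ltr1n.
- by rewrite /z lt_eqF // ltrBlDr ltrDl.
- by rewrite in_itv /= /z; lra.
Qed.

Lemma rderiv_eq l h x d : 0 < l -> 0 <= x <= l ->
  (forall e, 0 < e -> exists2 del, 0 < del & forall z, 0 <= z <= l -> z != x ->
     `|z - x| < del -> `|(h z - h x) / (z - x) - d| <= e) ->
  rderiv l h x = d.
Proof.
move=> l0 xl H; have PF := within_dnbhs_proper l0 xl.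
apply: cvg_lim; first exact: Rhausdorff.
apply/cvgrPdist_le => e e0; have [del del0 Hd] := H e e0.
rewrite /within /dnbhs /=; exists del => //= z /= zx zne zl.
rewrite distrC; apply: Hd; [by move: zl; rewrite in_itv|by []|by rewrite distrC].
Qed.

Lemma rderiv_ext l F G x : 0 <= x <= l -> (forall y, 0 <= y <= l -> F y = G y) ->
  rderiv l F x = rderiv l G x.
Proof.
move=> xl FG; rewrite /rderiv; congr lim; apply/seteqP; split => P /=.
  rewrite /within /dnbhs /= => -[e e0 He]; exists e => // z zx zne zl.
  have zl' : 0 <= z <= l by move: zl; rewrite in_itv.
  by have := He z zx zne zl; rewrite /= !FG.
rewrite /within /dnbhs /= => -[e e0 He]; exists e => // z zx zne zl.
have zl' : 0 <= z <= l by move: zl; rewrite in_itv.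
by have := He z zx zne zl; rewrite /= !FG.
Qed.

Lemma cont_at a b f x : cont a b f -> a <= x <= b -> forall e, 0 < e ->
  exists2 d, 0 < d & forall z, a <= z <= b -> `|z - x| < d -> `|f z - f x| <= e.
Proof.
move=> /subspace_continuousP cf xab e e0.
have /cf : [set` `[a, b]] x by rewrite /= in_itv.
move/cvgrPdist_le => /(_ e e0); rewrite /within /= => -[d /= d0 Hd].
exists d => // z zab zx; rewrite distrC; apply: Hd => /=; first by rewrite distrC.
by rewrite in_itv.
Qed.

Lemma prim_rderiv l F f x : 0 < l -> prim 0 l F f -> cont 0 l f -> 0 <= x <= l ->
  rderiv l F x = f x.
Proof.
move=> l0 HF cf xl; apply: rderiv_eq => // e e0.
have [d d0 Hd] := cont_at cf xl e0.
exists d => // z zl zx zxd.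
have /andP[x0 xl'] := xl; have /andP[z0 zl'] := zl.
have aux s t : 0 <= s -> s <= t -> t <= l ->
  (forall y, s <= y <= t -> `|y - x| < d) ->
  `|(F t - F s) - f x * (t - s)| <= e * (t - s).
  move=> s0 st tl Hst; have fi : itg s t f by apply: itg_sub (prim_itg HF).
  rewrite (prim_diff HF) // -Int_cst // -IntB //; last exact: itg_cst.
  have fci : itg s t (fun y => f y - f x) by apply: itgB => //; exact: itg_cst.
  apply: (le_trans (Int_abs fci)); rewrite -(Int_cst e st).
  apply: Int_le; [exact: itg_abs|exact: itg_cst|].
  move=> y yst; apply: Hd; last exact: Hst.
  by have /andP[sy yt] := yst; rewrite (le_trans s0 sy) (le_trans yt tl).
rewrite -[f x](mulfK (_ : z - x != 0)) ?subr_eq0 // -mulrBl normrM normrV ?unitfE ?subr_eq0 //.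
rewrite ler_pdivrMr ?normr_gt0 ?subr_eq0 //.
have [zx'|xz] := ltP z x.
  have e1 : `|z - x| = x - z by rewrite ltr0_norm ?subr_lt0 // opprB.
  rewrite e1 -normrN.
  rewrite [X in `|X|](_ : _ = (F x - F z) - f x * (x - z)); last by ring.
  apply: aux => // [|y /andP[zy yx]]; first exact: ltW.
  move: zxd; rewrite ltr0_norm ?subr_lt0 // ler0_norm ?subr_le0 //.
  by rewrite !opprB; apply: le_lt_trans; rewrite lerD2l lerN2.
have e1 : `|z - x| = z - x by rewrite ger0_norm // subr_ge0.
rewrite e1; apply: aux => // y /andP[xy yz].
move: zxd; rewrite ger0_norm ?subr_ge0 // ger0_norm ?subr_ge0 //.
by apply: le_lt_trans; rewrite lerD2r.
Qed.

Lemma prim_uniq_cont l F f g : 0 < l -> prim 0 l F f -> prim 0 l F g ->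
  cont 0 l f -> cont 0 l g -> forall x, 0 <= x <= l -> f x = g x.
Proof. by move=> l0 Hf Hg cf cg x xl; rewrite -(prim_rderiv l0 Hf cf xl) (prim_rderiv l0 Hg). Qed.

Lemma ae_neq (c : R) : {ae mu, forall x, x != c}.
Proof.
exists [set c]; split => //; first exact: lebesgue_measure_set1.
by move=> x /= /negP; rewrite negbK => /eqP.
Qed.

(** Lebesgue's differentiation theorem for [f] extended by zero; the end points, where [rderiv] is
    one-sided, are removed as a null set. *)
Lemma prim_rderiv_ae l F f : 0 < l -> prim 0 l F f ->
  {ae mu, forall x, x \in `[0, l] -> rderiv l F x = f x}.
Proof.
move=> l0 HF; have fi := prim_itg HF; pose f0 := f \_ `[0, l].
have f0i : mu.-integrable setT (EFin \o f0).
  rewrite -restrict_EFin; apply/integrable_restrict => //=.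
  by rewrite setTI.
have loc : locally_integrable setT f0 by exact: integrable_locally.
have f0y y : mu.-integrable [set` Interval (BLeft 0) (BRight y)] (EFin \o f0).
  exact: integrableS f0i.
have := FTC1 f0y loc; set G := fun x => _.
move=> HG; apply: ae_imp2 (ae_neq 0) (ae_imp2 _ (ae_neq l) HG); last first.
  by move=> x H1 H2; exact: (conj H1 H2).
move=> x xne0 [xnel Hx]; rewrite in_itv /= => /andP[x0 xl].
have {}x0 : 0 < x by rewrite lt_neqAle eq_sym xne0.
have {}xl : x < l by rewrite lt_neqAle xnel.
have {}Hx : derivable G x 1 /\ G^`()%classic x = f0 x by apply: Hx; rewrite (@lte_fin R).
have [dG G'] := Hx.
have xG : is_derive x (1 : R) G (f x).
  apply: DeriveDef => //; rewrite -derive1E G' /f0 patchE mem_set //=.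
  by rewrite in_itv /= !ltW.
apply: rderiv_eq => //; first by rewrite !ltW.
move=> e e0; move: xG => [+ +]; rewrite /derivable /derive => cG eG.
have : h^-1 *: ((G \o shift x) (h *: 1) - G x) @[h --> 0^'] --> f x by rewrite -eG.
move/cvgrPdist_le => /(_ e e0); rewrite near_withinE => -[d /= d0 Hd].
exists d => // z /andP[z0 zl] zx zxd.
have GF y : 0 <= y <= l -> F y = F 0 + G y.
  move=> /andP[y0 yl]; rewrite (HF.2 y) ?y0 //; congr (_ + _); rewrite /G.
  apply: eq_Rintegral => t; rewrite inE /= in_itv /= => /andP[t0 ty].
  by rewrite /f0 patchE mem_set //= in_itv /= t0 (le_trans ty yl).
rewrite (GF z) ?z0 // (GF x) ?(ltW x0) ?(ltW xl) // opprD addrACA subrr add0r distrC.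
have := Hd (z - x); rewrite /ball_ /= sub0r normrN subr_eq0 => /(_ zxd zx).
by rewrite /GRing.scale /= mulr1 subrK mulrC.
Qed.

Lemma prim_uniq_ae l F f g : 0 < l -> prim 0 l F f -> prim 0 l F g ->
  {ae mu, forall x, x \in `[0, l] -> f x = g x}.
Proof.
move=> l0 Hf Hg; apply: ae_imp2 (prim_rderiv_ae l0 Hf) (prim_rderiv_ae l0 Hg).
by move=> x H1 H2 xl; rewrite -H1 // H2.
Qed.

End RelativeDerivative.

(** * Integrals of functions equal almost everywhere to a measurable one *)

Section Nonmeasurable.
Import HBNNSimple.
Context {R : realType}.
Notation mu := (@lebesgue_measure R).
Implicit Types (a b : R) (f g : R -> R).

(* No measurability is required of [f]: almost everywhere derivatives are only
   known to coincide almost everywhere with a measurable function. *)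
Lemma Int_ae_ge0 a b f g : (forall x, a <= x <= b -> 0 <= f x) ->
  (forall x, a <= x <= b -> 0 <= g x) -> meas a b g ->
  {ae mu, forall x, x \in `[a, b] -> f x = g x} -> Int a b f = Int a b g.
Proof.
move=> f0 g0 mg [A [mA A0 HA]].
have fg x : a <= x <= b -> ~ A x -> f x = g x.
  move=> xab nA; apply: contrapT => H; apply: nA; apply: HA => /= /(_ _); apply: contra_not H.
  by apply; rewrite in_itv.
pose g1 x : R := g x * \1_(~` A) x.
have mg1 : meas a b g1.
  by apply: measurable_funM => //; apply: measurable_indic => //; exact: measurableC.
pose f1 x : R := f x * \1_(~` A) x.
have fg1 x : a <= x <= b -> f1 x = g1 x.
  rewrite /f1 /g1 indicE in_setC => xab; have [xA|/negP xA] := boolP (x \in A).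
    by rewrite !mulr0.
  by rewrite fg // => Ax; apply: xA; rewrite inE.
have Ig : Int a b g = Int a b g1.
  apply: Int_ae => //; exists A; split => // x /= /not_implyP[_].
  rewrite /g1 indicE in_setC; case: (boolP (x \in A)); first by rewrite inE.
  by rewrite mulr1.
rewrite Ig -(Int_ext fg1) /Int /Rintegral; congr fine.
have f10 x : a <= x <= b -> 0 <= f1 x.
  by move=> xab; rewrite /f1 mulr_ge0 // f0.
rewrite !ge0_integralE; last 2 first.
- by move=> x /=; rewrite in_itv /= lee_fin; exact: f10.
- by move=> x /=; rewrite in_itv /= lee_fin; exact: f0.
apply/eqP; rewrite eq_le; apply/andP; split; last first.
  apply: ub_ereal_sup => _ [h Hh <-]; apply: ereal_sup_ubound; exists h => // x.
  apply: le_trans (Hh x) _; rewrite !patchE; case: ifP => //.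
  rewrite inE /= in_itv /= => xab; rewrite lee_fin /f1 indicE.
  by case: (_ \in _); rewrite ?mulr1 ?mulr0 ?f0.
(* The integral of a nonnegative function is a supremum over the simple functions below it.
   Multiplied by the indicator of the complement of the null set [A], the minorant [h] of [f]
   becomes a minorant of [f1] with the same integral. *)
apply: ub_ereal_sup => _ [h Hh <-].
apply: ereal_sup_ubound; have mAc := measurableC mA.
exists (proj_nnsfun h mAc).
  move=> x; have -> : proj_nnsfun h mAc x = h x * \1_(~` A) x by rewrite /= mindicE indicE.
  have := Hh x; rewrite !patchE; case: ifP => [xab|_]; rewrite !lee_fin => hx.
    by rewrite ler_wpM2r.
  by rewrite mulr_le0_ge0.
rewrite -!integralT_nnsfun; apply: ae_eq_integral => //.
- exact/measurable_EFinP.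
- exact/measurable_EFinP.
exists A; split => // x /= /not_implyP[_].
rewrite mindicE in_setC; case: (boolP (x \in A)); first by rewrite inE.
by rewrite mulr1.
Qed.

End Nonmeasurable.

(** * Sobolev functions and their derivatives *)

Section Sobolev.
Context {R : realType}.
Notation mu := (@lebesgue_measure R).
Implicit Types (a b c l x y : R) (f g h : R -> R) (u v : R -> R[i]).

Fixpoint sobR l (k : nat) h : Prop :=
  if k is k'.+1 then prim 0 l h (rderiv l h) /\ sobR l k' (rderiv l h)
  else L2r 0 l h.

(** [sobolev] writes a function as an integral without asking that the derivative be integrable.
    Integrability comes from the next level, at which the derivative is either square-integrable or
    continuous. *)
Lemma sobR_itg l k h : sobR l k h -> itg 0 l h.
Proof.
case: k => [|k] /=; first exact: L2r_itg.
by case=> /prim_cont/cont_itg.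
Qed.

Lemma L2_parts a b u : L2 a b (fun=> 1) u ->
  L2r a b (fun x => complex.Re (u x)) /\ L2r a b (fun x => complex.Im (u x)).
Proof.
move=> [mr mi fin].
have H : itg a b (fun x => sqmod (u x) * 1).
  apply/integrableP; split.
    apply/measurable_EFinP; apply: measurable_funM => //.
    by apply: measurable_funD; apply: measurable_funX.
  apply: le_lt_trans fin; apply: ge0_le_integral => //=.
  - apply/measurable_EFinP; apply: measurableT_comp => //.
    apply: measurable_funM => //.
    by apply: measurable_funD; apply: measurable_funX.
  - apply/measurable_EFinP; apply: measurable_funM => //.
    by apply: measurable_funD; apply: measurable_funX.
  - move=> x _; rewrite lee_fin ger0_norm // mulr1 /sqmod.
    by rewrite addr_ge0 ?sqr_ge0.
split; split => //.
- apply: (itg_le _ H); first exact: measurable_funX.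
  move=> x _; rewrite ger0_norm ?sqr_ge0 // mulr1 /sqmod lerDl sqr_ge0 //.
- apply: (itg_le _ H); first exact: measurable_funX.
  move=> x _; rewrite ger0_norm ?sqr_ge0 // mulr1 /sqmod lerDr sqr_ge0 //.
Qed.

Lemma sobolev_parts l k u : sobolev l k u ->
  sobR l k (fun x => complex.Re (u x)) /\ sobR l k (fun x => complex.Im (u x)).
Proof.
elim: k u => [|k IH] u; first exact: L2_parts.
move=> [Hu Hd]; have [Hr Hi] := IH _ Hd; split.
- split; last exact: Hr.
  split; first exact: (sobR_itg Hr).
  move=> x xl; rewrite Hu ?in_itv //= /cint /Int.
  by case: (u 0).
- split; last exact: Hi.
  split; first exact: (sobR_itg Hi).
  move=> x xl; rewrite Hu ?in_itv //= /cint /Int.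
  by case: (u 0).
Qed.

(* [u1] and [u2] are representatives of the first two weak derivatives of [u]. *)
Definition W2 l (u u1 u2 : R -> R) : Prop :=
  [/\ prim 0 l u u1, prim 0 l u1 u2 & L2r 0 l u2].

Definition clamped l (u u1 : R -> R) : Prop :=
  [/\ u 0 = 0, u1 0 = 0, u l = 0 & u1 l = 0].

Lemma W2Z l c f f1 f2 : W2 l f f1 f2 ->
  W2 l (fun x => c * f x) (fun x => c * f1 x) (fun x => c * f2 x).
Proof. by move=> [? ? ?]; split; [exact: primZ|exact: primZ|exact: L2rZ]. Qed.

Lemma W2B l f f1 f2 g g1 g2 : W2 l f f1 f2 -> W2 l g g1 g2 ->
  W2 l (fun x => f x - g x) (fun x => f1 x - g1 x) (fun x => f2 x - g2 x).
Proof. by move=> [? ? ?] [? ? ?]; split; [exact: primB|exact: primB|exact: L2rB]. Qed.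

Lemma W2_sum l (I : Type) (s : seq I) (P : pred I) (F F1 F2 : I -> R -> R) :
  (forall i, P i -> W2 l (F i) (F1 i) (F2 i)) ->
  W2 l (fun x => \sum_(i <- s | P i) F i x) (fun x => \sum_(i <- s | P i) F1 i x)
    (fun x => \sum_(i <- s | P i) F2 i x).
Proof.
move=> H; split.
- by apply: prim_sum => i Pi; case: (H i Pi).
- by apply: prim_sum => i Pi; case: (H i Pi).
- by apply: L2r_sum => i Pi; case: (H i Pi).
Qed.

Lemma clamped_sum l (I : Type) (s : seq I) (P : pred I) (F F1 : I -> R -> R) :
  (forall i, P i -> clamped l (F i) (F1 i)) ->
  clamped l (fun x => \sum_(i <- s | P i) F i x) (fun x => \sum_(i <- s | P i) F1 i x).
Proof. by move=> H; split; apply: big1 => i Pi; case: (H i Pi). Qed.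

Lemma clampedB l f f1 g g1 : clamped l f f1 -> clamped l g g1 ->
  clamped l (fun x => f x - g x) (fun x => f1 x - g1 x).
Proof. by move=> [? ? ? ?] [? ? ? ?]; split; apply/eqP; rewrite subr_eq0; apply/eqP; congruence. Qed.

Lemma W2_rderiv l f f1 f2 : 0 < l -> W2 l f f1 f2 ->
  forall x, 0 <= x <= l -> rderiv l f x = f1 x.
Proof. by move=> l0 [H1 H2 _] x xl; apply: prim_rderiv => //; exact: prim_cont H2. Qed.

Lemma W2_rderiv2 l f f1 f2 : 0 < l -> W2 l f f1 f2 ->
  {ae mu, forall x, x \in `[0, l] -> rderiv l (rderiv l f) x = f2 x}.
Proof.
move=> l0 H; have [_ H2 _] := H; apply: ae_imp (prim_rderiv_ae l0 H2) => x Hx xl.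
rewrite -Hx //; apply: rderiv_ext; first by move: xl; rewrite in_itv.
exact: (W2_rderiv l0 H).
Qed.

Lemma sobR_W2 l f : sobR l 2 f -> W2 l f (rderiv l f) (rderiv l (rderiv l f)).
Proof. by move=> [H1 [H2 H3]]; split. Qed.

Lemma H20_parts l u : H20 l u ->
  (W2 l (fun x => complex.Re (u x)) (fun x => complex.Re (cderiv l u x))
     (fun x => complex.Re (cderiv l (cderiv l u) x)) /\
   clamped l (fun x => complex.Re (u x)) (fun x => complex.Re (cderiv l u x))) /\
  (W2 l (fun x => complex.Im (u x)) (fun x => complex.Im (cderiv l u x))
     (fun x => complex.Im (cderiv l (cderiv l u) x)) /\
   clamped l (fun x => complex.Im (u x)) (fun x => complex.Im (cderiv l u x))).
Proof.
move=> [Hs [h1 h2 h3 h4]]; have [Hr Hi] := sobolev_parts Hs.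
by split; split; [exact: sobR_W2|split; rewrite ?h1 ?h2 ?h3 ?h4
                 |exact: sobR_W2|split; rewrite ?h1 ?h2 ?h3 ?h4].
Qed.

(** Trades the second derivatives, defined as iterated limits, for arbitrary representatives [a2]
    and [b2], which can be combined linearly. *)
Lemma sqnormH20E l rho u (a1 a2 b1 b2 : R -> R) : 0 < l -> cont 0 l rho ->
  (forall x, 0 <= x <= l -> 0 <= rho x) ->
  W2 l (fun x => complex.Re (u x)) a1 a2 -> W2 l (fun x => complex.Im (u x)) b1 b2 ->
  sqnormH20 l rho u = Int 0 l (fun x => rho x * a2 x ^+ 2) + Int 0 l (fun x => rho x * b2 x ^+ 2).
Proof.
move=> l0 crho rho0 Ha Hb; have [_ _ [ma a2i]] := Ha; have [_ _ [mb b2i]] := Hb.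
rewrite -IntD; [|exact: itg_cmul|exact: itg_cmul].
apply: Int_ae_ge0.
- by move=> x xl; rewrite mulr_ge0 ?rho0 // addr_ge0 ?sqr_ge0.
- by move=> x xl; rewrite addr_ge0 // mulr_ge0 ?rho0 ?sqr_ge0.
- by apply: itg_meas; apply: itgD; exact: itg_cmul.
- apply: ae_imp2 (W2_rderiv2 l0 Ha) (W2_rderiv2 l0 Hb) => x H1 H2 xl.
  by rewrite /sqmod /= H1 // H2 // mulrC mulrDr.
Qed.

End Sobolev.

(** * The eigenvalue equation as a first-order system *)

Section EigenSystem.
Context {R : realType}.
Notation mu := (@lebesgue_measure R).
Variables (l : R) (rho sigma sigma1 q : R -> R).

(* First-order form of [(sigma u'')'' - (q u')' = rho (lam u + f)] with clamped
   ends: [v = u'], [k = u''], [k1 = u'''] and [W = (sigma u'')' - q u']. *)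
Definition beam (lam : R) (f u v k k1 W : R -> R) : Prop :=
  [/\ prim 0 l u v, prim 0 l v k, prim 0 l k k1,
      prim 0 l W (fun x => rho x * (lam * u x + f x)) &
      forall x, 0 <= x <= l -> W x + q x * v x = sigma1 x * k x + sigma x * k1 x]
  /\ clamped l u v.

(** On the domain of the operator [k1] is itself absolutely continuous, hence so are [(sigma k)']
    and [W]. The equation, valid almost everywhere, only replaces the density of [W] by the
    continuous function [rho lam u]. *)
Lemma opA_part (sigma2 q1 : R -> R) (lam : R) (u v k k1 k2 : R -> R) : 0 < l ->
  prim 0 l sigma sigma1 -> prim 0 l sigma1 sigma2 -> prim 0 l q q1 -> cont 0 l rho ->
  (forall x, 0 <= x <= l -> 0 < rho x) ->
  prim 0 l u v -> prim 0 l v k -> prim 0 l k k1 -> prim 0 l k1 k2 -> clamped l u v ->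
  {ae mu, forall x, x \in `[0, l] -> (rho x)^-1 *
     (rderiv l (rderiv l (fun z => sigma z * k z)) x - rderiv l (fun z => q z * v z) x)
     = lam * u x} ->
  exists k1 W, beam lam (fun=> 0) u v k k1 W.
Proof.
move=> l0 Hs Hs1 Hq crho rho0 H1 H2 H3 H4 Hc Hae.
pose P x := sigma1 x * k x + sigma x * k1 x.
pose W x := P x - q x * v x.
exists k1, W; split; last exact: Hc.
split; [exact: H1|exact: H2|exact: H3| |by move=> x _; rewrite /W subrK].
have HM := prim_mul Hs H3.
have HP := primD (prim_mul Hs1 H3) (prim_mul Hs H4).
have HQ := prim_mul Hq H2.
apply: prim_ae (primB HP HQ).
  apply: itg_meas; apply: cont_itg; apply: contM => //.
  by apply: contD; [apply: contZ; exact: prim_cont H1|exact: cont_cst].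
have PQ := ae_imp2 (fun x h1 h2 => conj h1 h2) (prim_rderiv_ae l0 HP) (prim_rderiv_ae l0 HQ).
apply: ae_imp2 PQ Hae => x [h1 h2] h3 xl.
have xl' : 0 <= x <= l by move: xl; rewrite in_itv.
rewrite -h1 // -h2 // addr0 -h3 // mulVKf ?gt_eqF ?rho0 //; congr (_ - _).
by apply: rderiv_ext => // y yl; rewrite (prim_rderiv l0 HM (prim_cont HP) yl).
Qed.

(** Multiplication by real coefficients and by [lam] does not mix real and imaginary parts, so each
    of them satisfies the equation. *)
Lemma eigenfunction_parts (lam : R) (Phi : R -> R[i]) : 0 < l ->
  sobR l 2 sigma -> sigma1 = rderiv l sigma -> sobR l 1 q -> cont 0 l rho ->
  (forall x, 0 <= x <= l -> 0 < rho x) -> domA l Phi ->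
  {ae mu, forall x, x \in `[0, l] -> opA l rho sigma q Phi x = lam%:C * Phi x} ->
  (exists k1 W, beam lam (fun=> 0) (fun x => complex.Re (Phi x))
     (fun x => complex.Re (cderiv l Phi x))
     (fun x => complex.Re (cderiv l (cderiv l Phi) x)) k1 W) /\
  (exists k1 W, beam lam (fun=> 0) (fun x => complex.Im (Phi x))
     (fun x => complex.Im (cderiv l Phi x))
     (fun x => complex.Im (cderiv l (cderiv l Phi) x)) k1 W).
Proof.
move=> l0 Hs s1E [Hq _] crho rho0 [H4 HPhi] Hae.
have [[_ cr] [_ ci]] := H20_parts HPhi.
have [Hr Hi] := sobolev_parts H4.
have [Hs1 [Hs2 _]] := Hs; rewrite -s1E in Hs1 Hs2.
have [Hr1 [Hr2 [Hr3 [Hr4 _]]]] := Hr; have [Hi1 [Hi2 [Hi3 [Hi4 _]]]] := Hi.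
split; [apply: (opA_part l0 Hs1 Hs2 Hq crho rho0 Hr1 Hr2 Hr3 Hr4 cr)|
        apply: (opA_part l0 Hs1 Hs2 Hq crho rho0 Hi1 Hi2 Hi3 Hi4 ci)].
- apply: ae_imp Hae => x H xl; have := congr1 (@complex.Re R) (H xl).
  rewrite /opA /cderiv /=; case: (Phi x) => pr pi /=.
  rewrite !mul0r !subr0 => <-.
  have e (s g h : R -> R) : (fun z => s z * g z - 0 * h z) = (fun z => s z * g z).
    by apply/funext => z; rewrite mul0r subr0.
  by rewrite !e.
- apply: ae_imp Hae => x H xl; have := congr1 (@complex.Im R) (H xl).
  rewrite /opA /cderiv /=; case: (Phi x) => pr pi /=.
  rewrite !mul0r !addr0 => <-.
  have e (s g h : R -> R) : (fun z => s z * g z + 0 * h z) = (fun z => s z * g z).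
    by apply/funext => z; rewrite mul0r addr0.
  by rewrite !e.
Qed.

End EigenSystem.

(** * Ingham's inequality *)

Section SeparatedSum.
Context {R : realType}.

(** Telescoping of [1 / (n + 1) ^ 2 <= 1 / n - 1 / (n + 1)]. At [n = 0] the right-hand side is 2,
    since the inverse of 0 is 0. *)
Lemma sum_inv_sqr_le2 (n : nat) : \sum_(1 <= k < n.+1) (k%:R ^+ 2)^-1 <= 2 - (n%:R)^-1 :> R.
Proof.
elim: n => [|n IH]; first by rewrite big_geq // invr0 subr0.
rewrite big_nat_recr //=.
case: n IH => [_|n IH]; first by rewrite big_geq // add0r expr1n invr1; lra.
apply: (le_trans (lerD IH (lexx _))).
have n1 : 0 < n.+1%:R :> R by rewrite ltr0n.
have n2 : n.+2%:R = n.+1%:R + 1 :> R by rewrite -natr1.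
rewrite n2; set a : R := n.+1%:R in n1 *.
have a1 : 0 < a + 1 by rewrite addr_gt0.
rewrite -subr_ge0.
have -> : 2 - (a + 1)^-1 - (2 - a^-1 + ((a + 1) ^+ 2)^-1) = (a * (a + 1) ^+ 2)^-1.
  by field; rewrite !gt_eqF.
by rewrite invr_ge0 mulr_ge0 ?sqr_ge0 // ltW.
Qed.

Lemma sum_inv_sqr_inj (I : finType) (P : pred I) (k : I -> nat) :
  (forall i, P i -> (0 < k i)%N) -> (forall i j, P i -> P j -> k i = k j -> i = j) ->
  \sum_(i | P i) ((k i)%:R ^+ 2)^-1 <= 2 :> R.
Proof.
move=> k0 kinj; pose n := \max_(i | P i) k i.
pose s := [seq k i | i <- enum P].
have us : uniq s.
  rewrite map_inj_in_uniq ?enum_uniq // => i j; rewrite !mem_enum; exact: kinj.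
have -> : \sum_(i | P i) ((k i)%:R ^+ 2)^-1 = \sum_(m <- s) (m%:R ^+ 2)^-1 :> R.
  by rewrite big_map big_enum.
have ps : perm_eq s [seq m <- index_iota 1 n.+1 | m \in s].
  apply: uniq_perm => //; first by rewrite filter_uniq // iota_uniq.
  move=> m; rewrite mem_filter; case ms : (m \in s) => //=.
  move/mapP: ms => [j]; rewrite mem_enum => Pi ->.
  by apply/esym; rewrite mem_index_iota k0 //= ltnS; exact: (leq_bigmax_cond _ Pi).
rewrite (perm_big _ ps) /= big_filter.
apply: (@le_trans _ _ (\sum_(1 <= m < n.+1) (m%:R ^+ 2)^-1)).
  by rewrite [leRHS](bigID (mem s)) /= lerDl sumr_ge0.
by apply: (le_trans (sum_inv_sqr_le2 n)); rewrite lerBlDr lerDl invr_ge0.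
Qed.

(** On each side of [lam i], the integer part of the distance divided by [G] is at least 1 and takes
    each value at most once. Each side thus contributes at most the sum of the inverse squares,
    bounded by 2. *)
Lemma separated_sum (I : finType) (P : pred I) (lam : I -> R) (G : R) (i : I) :
  0 < G -> (forall j k, P j -> P k -> j != k -> G <= `|lam j - lam k|) -> P i ->
  \sum_(j | P j && (j != i)) ((lam i - lam j) ^+ 2)^-1 <= 4 / G ^+ 2.
Proof.
move=> G0 sep Pi.
have half (d : I -> R) (Q : pred I) : (forall j, Q j -> G <= d j) ->
    (forall j k, Q j -> Q k -> j != k -> G <= `|d j - d k|) ->
    \sum_(j | Q j) (d j ^+ 2)^-1 <= 2 / G ^+ 2.
  move=> Qd Qsep; pose k j := Num.truncn (d j / G).
  have dk j : Q j -> (k j)%:R <= d j / G < (k j).+1%:R.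
    by move=> Qj; apply: truncn_itv; rewrite divr_ge0 ?(le_trans (ltW G0) (Qd j Qj)) // ltW.
  have k0 j : Q j -> (0 < k j)%N.
    by move=> Qj; rewrite /k truncn_gt0 ler_pdivlMr // mul1r; exact: Qd.
  have kinj j m : Q j -> Q m -> k j = k m -> j = m.
    move=> Qj Qm kjm; apply/eqP; apply: contraT => jm.
    have := Qsep j m Qj Qm jm; rewrite leNgt => /negP[].
    have /andP[h1 h2] := dk j Qj; have /andP[h3 h4] := dk m Qm.
    rewrite kjm in h1 h2; rewrite -natr1 in h2; rewrite -natr1 in h4.
    have : `|d j / G - d m / G| < 1 by rewrite ltr_norml; apply/andP; split; lra.
    by rewrite -mulrBl normrM (gtr0_norm (_ : 0 < G^-1)) ?invr_gt0 // ltr_pdivrMr // mul1r.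
  apply: (@le_trans _ _ (\sum_(j | Q j) ((k j)%:R ^+ 2)^-1 / G ^+ 2)).
    apply: ler_sum => j Qj; rewrite -invfM -exprMn.
    have kj : 0 < (k j)%:R :> R by rewrite ltr0n k0.
    rewrite lef_pV2 ?posrE ?exprn_gt0 ?mulr_gt0 ?(lt_le_trans G0 (Qd j Qj)) //.
    rewrite lerXn2r ?nnegrE ?mulr_ge0 ?(ltW kj) ?(ltW G0) ?(le_trans (ltW G0) (Qd j Qj)) //.
    by rewrite -ler_pdivlMr //; case/andP: (dk j Qj).
  rewrite -mulr_suml ler_wpM2r ?invr_ge0 ?sqr_ge0 //.
  exact: sum_inv_sqr_inj.
rewrite (bigID (fun j => lam i < lam j)) /= (_ : 4 / G ^+ 2 = 2 / G ^+ 2 + 2 / G ^+ 2); last first.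
  by rewrite -mulrDl; congr (_ / _); lra.
apply: lerD.
- rewrite (eq_bigr (fun j => ((lam j - lam i) ^+ 2)^-1)) => [|j _]; last first.
    by rewrite -sqrrN opprB.
  apply: half => [j /andP[/andP[Pj ji] lt]|j k /andP[/andP[Pj ji] _] /andP[/andP[Pk ki] _] jk].
    by have := sep j i Pj Pi ji; rewrite gtr0_norm // subr_gt0.
  by rewrite opprB addrA subrK; exact: sep.
- apply: half => [j /andP[/andP[Pj ji] nlt]|j k /andP[/andP[Pj ji] _] /andP[/andP[Pk ki] _] jk].
    have := sep j i Pj Pi ji; rewrite distrC ger0_norm // subr_ge0 leNgt //.
  rewrite opprB addrC addrA subrK distrC; exact: sep.
Qed.

End SeparatedSum.

(** * Trigonometric integrals against a parabolic weight *)

Section TrigIntegrals.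
Context {R : realType}.
Implicit Types (a b x : R).

Lemma continuous_sin_scaled x : continuous (fun t : R => sin (x * t)).
Proof.
move=> t; apply: continuous_comp; last exact: continuous_sin.
exact: mulrl_continuous.
Qed.

Lemma continuous_cos_scaled x : continuous (fun t : R => cos (x * t)).
Proof.
move=> t; apply: continuous_comp; last exact: continuous_cos.
exact: mulrl_continuous.
Qed.

Lemma cont_sin_scaled a b x : cont a b (fun t => sin (x * t)).
Proof. exact/continuous_cont/continuous_sin_scaled. Qed.

Lemma cont_cos_scaled a b x : cont a b (fun t => cos (x * t)).
Proof. exact/continuous_cont/continuous_cos_scaled. Qed.

Lemma prim_sin_scaled a b x : prim a b (fun t => sin (x * t)) (fun t => x * cos (x * t)).
Proof.
apply: prim_classic => [t|t]; first by apply: is_derive_eq; rewrite /GRing.scale /=; ring.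
by apply: cvgM; [exact: cvg_cst|exact: continuous_cos_scaled].
Qed.

Lemma prim_cos_scaled a b x : prim a b (fun t => cos (x * t)) (fun t => - x * sin (x * t)).
Proof.
apply: prim_classic => [t|t]; first by apply: is_derive_eq; rewrite /GRing.scale /=; ring.
by apply: cvgM; [exact: cvg_cst|exact: continuous_sin_scaled].
Qed.

Lemma prim_weight a b : prim a b (fun t => (t - a) * (b - t)) (fun t => a + b - 2 * t).
Proof.
have H := prim_mul (primB (prim_id a b) (prim_cst a b a)) (primB (prim_cst a b b) (prim_id a b)).
by apply: prim_ext H => t _; ring.
Qed.

Lemma Int_weight a b : a <= b -> Int a b (fun t => (t - a) * (b - t)) = (b - a) ^+ 3 / 6.
Proof.
move=> ab.
(* An antiderivative of the weight with the factor [(t - a) ^ 2], hence zero at [a]. *)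
have P1 := prim_mul (prim_sqr (primB (prim_id a b) (prim_cst a b a)))
  (primB (primZ (1 / 2) (prim_cst a b b)) (primB (primZ (1 / 3) (prim_id a b)) (primZ (-1 / 6) (prim_cst a b a)))).
have := prim_Int P1 ab; rewrite subrr expr0n mul0r [RHS]subr0 => E.
transitivity ((b - a) ^+ 2 * (1 / 2 * b - (1 / 3 * b - -1 / 6 * a))); last by field.
by rewrite -E; apply: Int_ext => t _; field.
Qed.

(** The weight vanishes at both ends, so two integrations by parts leave boundary terms of order
    [1 / x ^ 2]: at most [2 (b - a) + 4 / |x|] over [x ^ 2], and the lower bound on [|x|] gives
    [4 / |x| <= b - a]. *)
Lemma Int_weight_cos a b x : a < b -> 4 / (b - a) <= `|x| ->
  `|Int a b (fun t => (t - a) * (b - t) * cos (x * t))| <= 3 * (b - a) / x ^+ 2.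
Proof.
move=> ab xl; have D0 : 0 < b - a by rewrite subr_gt0.
have xp : 0 < `|x| by apply: lt_le_trans xl; rewrite divr_gt0.
have x0 : x != 0 by rewrite -normr_gt0.
have P := primD (primD (primZ x^-1 (prim_mul (prim_weight a b) (prim_sin_scaled a b x)))
  (primZ (x ^+ 2)^-1 (prim_mul (primB (prim_cst a b (a + b)) (primZ 2 (prim_id a b))) (prim_cos_scaled a b x))))
  (primZ (2 * (x ^+ 3)^-1) (prim_sin_scaled a b x)).
rewrite (@Int_ext _ _ _ _ (fun x0 : R => x^-1 * ((a + b - 2 * x0) * sin (x * x0) + (x0 - a) * (b - x0) * (x * cos (x * x0))) +
  (x ^+ 2)^-1 * ((0 - 2 * 1) * cos (x * x0) + (a + b - 2 * x0) * (- x * sin (x * x0))) +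
  2 * (x ^+ 3)^-1 * (x * cos (x * x0)))); last first.
  by move=> t _; field.
rewrite (prim_Int P (ltW ab)).
rewrite [X in `|X|](_ : _ = (- (b - a) * (cos (x * b) + cos (x * a)) + 2 * (sin (x * b) - sin (x * a)) / x) / x ^+ 2); last by field.
rewrite normrM normfV (ger0_norm (sqr_ge0 x)) ler_wpM2r ?invr_ge0 ?sqr_ge0 //.
apply: (le_trans (ler_normD _ _)).
have h1 : `|cos (x * b) + cos (x * a)| <= 2.
  have := cos_le1 (x * b); have := cos_le1 (x * a).
  by have := cos_geN1 (x * b); have := cos_geN1 (x * a) => *; rewrite ler_norml; apply/andP; split; lra.
have h2 : `|sin (x * b) - sin (x * a)| <= 2.
  have := sin_le1 (x * b); have := sin_le1 (x * a).
  by have := sin_geN1 (x * b); have := sin_geN1 (x * a) => *; rewrite ler_norml; apply/andP; split; lra.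
have h3 : `|- (b - a) * (cos (x * b) + cos (x * a))| <= 2 * (b - a).
  by rewrite normrM normrN (gtr0_norm D0) mulrC ler_wpM2r // ltW.
have h4 : `|2 * (sin (x * b) - sin (x * a)) / x| <= b - a.
  rewrite !normrM normfV ler_pdivrMr // (ger0_norm (_ : (0 : R) <= 2)) //.
  move: xl; rewrite ler_pdivrMr // mulrC => xl; apply: le_trans xl; lra.
by lra.
Qed.

Lemma Int_weight_sin a b x : a < b -> 4 / (b - a) <= `|x| ->
  `|Int a b (fun t => (t - a) * (b - t) * sin (x * t))| <= 3 * (b - a) / x ^+ 2.
Proof.
move=> ab xl; have D0 : 0 < b - a by rewrite subr_gt0.
have xp : 0 < `|x| by apply: lt_le_trans xl; rewrite divr_gt0.
have x0 : x != 0 by rewrite -normr_gt0.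
have P := primD (primD (primZ (- x^-1) (prim_mul (prim_weight a b) (prim_cos_scaled a b x)))
  (primZ (x ^+ 2)^-1 (prim_mul (primB (prim_cst a b (a + b)) (primZ 2 (prim_id a b))) (prim_sin_scaled a b x))))
  (primZ (- (2 * (x ^+ 3)^-1)) (prim_cos_scaled a b x)).
rewrite (@Int_ext _ _ _ _ (fun x0 : R => - x^-1 * ((a + b - 2 * x0) * cos (x * x0) + (x0 - a) * (b - x0) * (- x * sin (x * x0))) +
  (x ^+ 2)^-1 * ((0 - 2 * 1) * sin (x * x0) + (a + b - 2 * x0) * (x * cos (x * x0))) +
  - (2 * (x ^+ 3)^-1) * (- x * sin (x * x0)))); last first.
  by move=> t _; field.
rewrite (prim_Int P (ltW ab)).
rewrite [X in `|X|](_ : _ = (- (b - a) * (sin (x * b) + sin (x * a)) - 2 * (cos (x * b) - cos (x * a)) / x) / x ^+ 2); last by field.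
rewrite normrM normfV (ger0_norm (sqr_ge0 x)) ler_wpM2r ?invr_ge0 ?sqr_ge0 //.
apply: (le_trans (ler_normB _ _)).
have h1 : `|cos (x * b) - cos (x * a)| <= 2.
  have := cos_le1 (x * b); have := cos_le1 (x * a).
  by have := cos_geN1 (x * b); have := cos_geN1 (x * a) => *; rewrite ler_norml; apply/andP; split; lra.
have h2 : `|sin (x * b) + sin (x * a)| <= 2.
  have := sin_le1 (x * b); have := sin_le1 (x * a).
  by have := sin_geN1 (x * b); have := sin_geN1 (x * a) => *; rewrite ler_norml; apply/andP; split; lra.
have h3 : `|- (b - a) * (sin (x * b) + sin (x * a))| <= 2 * (b - a).
  by rewrite normrM normrN (gtr0_norm D0) mulrC ler_wpM2r // ltW.
have h4 : `|2 * (cos (x * b) - cos (x * a)) / x| <= b - a.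
  rewrite !normrM normfV ler_pdivrMr // (ger0_norm (_ : (0 : R) <= 2)) //.
  move: xl; rewrite ler_pdivrMr // mulrC => xl; apply: le_trans xl; lra.
by lra.
Qed.

Lemma Int_shift a b s (F : R -> R) : a <= b -> continuous F ->
  Int a b (fun t => F (t + s)) = Int (a + s) (b + s) F.
Proof.
move=> ab cF; rewrite /Int /Rintegral; congr fine.
have d1 t : is_derive t (1 : R) (fun t : R => t + s) 1.
  by apply: is_derive_eq; rewrite addr0.
have d1E : (fun t : R => t + s)^`()%classic = cst 1.
  by apply/funext => t; rewrite derive1E; case: (d1 t).
have ct : continuous (fun t : R => t + s).
  by move=> t; apply: cvgD; [exact: cvg_id|exact: cvg_cst].
have := @integration_by_substitution_increasing R (fun t => t + s) F a b ab.
rewrite d1E => -> //.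
- by apply: eq_integral => t _ /=; rewrite mulr1.
- by move=> x y _ _; rewrite ltrD2r.
- by move=> x _; exact: cst_continuous.
- exact: is_cvg_cst.
- exact: is_cvg_cst.
- split.
  + by move=> t _; case: (d1 t).
  + by apply: cvg_at_right_filter; exact: ct.
  + by apply: cvg_at_left_filter; exact: ct.
- exact: continuous_cont.
Qed.

(** Integrating [1 - cos] gives the weak inequality; up to 2, the double angle formula with
    [cos (x / 2) < 1] makes it strict. *)
Lemma sin_lt_id x : 0 < x -> sin x < x.
Proof.
have le (y : R) : 0 <= y -> sin y <= y.
  move=> y0; have P := primB (prim_id 0 y) (prim_sin_scaled 0 y 1).
  have := prim_le y0 P; rewrite mulr0 sin0 subr0 mul1r subr_ge0; apply => t _.
  by rewrite mul1r subr_ge0 mul1r cos_le1.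
move=> x0; have [x2|x2] := leP x 2; last by apply: le_lt_trans (sin_le1 x) _; lra.
have -> : sin x = cos (x / 2) * sin (x / 2) *+ 2 by rewrite -sin_mulr2n; congr sin; lra.
have s0 : 0 < sin (x / 2) by apply: sin_gt0_pi; have := @pi_ge2 R; lra.
have c1 : cos (x / 2) < 1.
  rewrite lt_neqAle cos_le1 andbT; apply/eqP => c1.
  by have := sin2cos2 (x / 2); rewrite c1 expr1n subrr => /eqP; rewrite sqrf_eq0 gt_eqF.
have h := le (x / 2) _; have {}h : sin (x / 2) <= x / 2 by apply: h; lra.
have : cos (x / 2) * sin (x / 2) < 1 * sin (x / 2) by rewrite ltr_pM2r.
by lra.
Qed.

(** The mean of [2 - 2 cos (m s)] over [0 <= s <= d] is [2 (1 - sin y / y)] with [y = |m| d]. This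
    keeps it away from zero, uniformly for [y >= x0]. *)
Lemma one_minus_sinc x0 : 0 < x0 ->
  exists2 e, 0 < e & forall x, x0 <= `|x| -> e * `|x| <= `|x| - sin `|x|.
Proof.
(* Up to 2, [y - sin y] is at least its value at [x0] whereas [e * y <= 2 * e]; beyond 2,
   [sin y <= 1 <= y / 2]. *)
move=> x0p; pose e := Num.min (1 / 2) ((x0 - sin x0) / 2).
have e0 : 0 < e by rewrite lt_min !divr_gt0 // subr_gt0 sin_lt_id.
have e1 : e <= 1 / 2 by rewrite ge_min lexx.
have e2 : e <= (x0 - sin x0) / 2 by rewrite ge_min lexx orbT.
exists e => // x; set y := `|x| => xy; have yp : 0 < y by exact: lt_le_trans xy.
have [y2|y2] := leP y 2.
  have P := primB (prim_id x0 y) (prim_sin_scaled x0 y 1).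
  have := prim_le xy P; rewrite !mul1r => h.
  have {}h : x0 - sin x0 <= y - sin y by apply: h => t _; rewrite !mul1r subr_ge0 cos_le1.
  have : e * y <= e * 2 by rewrite ler_pM2l.
  by lra.
have : e * y <= 1 / 2 * y by rewrite ler_pM2r.
by have := sin_le1 y; lra.
Qed.

End TrigIntegrals.

(** * Nonharmonic trigonometric polynomials *)

Section TrigPolynomials.
Context {R : realType}.

Lemma continuous_sumr (I : Type) (s : seq I) (P : pred I) (F : I -> R -> R) :
  (forall i, continuous (F i)) -> continuous (fun t => \sum_(i <- s | P i) F i t).
Proof.
move=> cF; elim: s => [|i s IH].
  rewrite (_ : (fun t => _) = fun=> 0); first exact: cst_continuous.
  by apply/funext => t; rewrite big_nil.
case Pi : (P i).
  rewrite (_ : (fun t => _) = fun t => F i t + \sum_(i <- s | P i) F i t).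
    by move=> t; apply: cvgD; [exact: cF|exact: IH].
  by apply/funext => t; rewrite big_cons Pi.
by rewrite (_ : (fun t => _) = fun t => \sum_(i <- s | P i) F i t) //;
   apply/funext => t; rewrite big_cons Pi.
Qed.

(* Real and imaginary parts of [\sum_i (al i + i be i) e^(i lam i t)]. *)
Definition tre (I : finType) (P : pred I) (al be lam : I -> R) (t : R) : R :=
  \sum_(i | P i) (al i * cos (lam i * t) - be i * sin (lam i * t)).
Definition tim (I : finType) (P : pred I) (al be lam : I -> R) (t : R) : R :=
  \sum_(i | P i) (al i * sin (lam i * t) + be i * cos (lam i * t)).
Definition tsq (I : finType) (P : pred I) (al be lam : I -> R) (t : R) : R :=
  tre P al be lam t ^+ 2 + tim P al be lam t ^+ 2.
Definition nrm (I : finType) (P : pred I) (al be : I -> R) : R :=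
  \sum_(i | P i) (al i ^+ 2 + be i ^+ 2).

Section Fixed.
Context {I : finType} {P : pred I} {al be lam : I -> R}.

Lemma tsq_ge0 t : 0 <= tsq P al be lam t.
Proof. by rewrite addr_ge0 ?sqr_ge0. Qed.

Lemma nrm_ge0 : 0 <= nrm P al be.
Proof. by apply: sumr_ge0 => i _; rewrite addr_ge0 ?sqr_ge0. Qed.

Lemma continuous_tre : continuous (tre P al be lam).
Proof.
apply: continuous_sumr => i t; apply: cvgB.
  by apply: cvgM; [exact: cvg_cst|exact: continuous_cos_scaled].
by apply: cvgM; [exact: cvg_cst|exact: continuous_sin_scaled].
Qed.

Lemma continuous_tim : continuous (tim P al be lam).
Proof.
apply: continuous_sumr => i t; apply: cvgD.
  by apply: cvgM; [exact: cvg_cst|exact: continuous_sin_scaled].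
by apply: cvgM; [exact: cvg_cst|exact: continuous_cos_scaled].
Qed.

Lemma continuous_tsq : continuous (tsq P al be lam).
Proof.
by move=> t; apply: cvgD; apply: cvgM; solve [exact: continuous_tre|exact: continuous_tim].
Qed.

Lemma cont_tsq a b : cont a b (tsq P al be lam).
Proof. exact/continuous_cont/continuous_tsq. Qed.

Lemma tsq_expand t : tsq P al be lam t = \sum_(i | P i) \sum_(j | P j)
  ((al i * al j + be i * be j) * cos ((lam i - lam j) * t) -
   (be i * al j - al i * be j) * sin ((lam i - lam j) * t)).
Proof.
rewrite /tsq !expr2 /tre /tim !big_distrlr /= -big_split; apply: eq_bigr => i _ /=.
rewrite -big_split; apply: eq_bigr => j _ /=.
by rewrite (mulrBl t (lam i) (lam j)) cosB sinB; ring.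
Qed.

(** With [D = b - a], the diagonal terms of the expanded square give [D ^ 3 / 6]. The others are
    bounded through the decay in [1 / x ^ 2] and [separated_sum] by [24 / 17 ^ 2] times [D ^ 3],
    which is less than [D ^ 3 / 12]: 17 is the least integer whose square reaches 288. *)
Lemma tsq_weighted a b : a < b ->
  (forall i j, P i -> P j -> i != j -> 17 / (b - a) <= `|lam i - lam j|) ->
  (b - a) ^+ 3 / 12 * nrm P al be <=
    Int a b (fun t => (t - a) * (b - t) * tsq P al be lam t) <=
  (b - a) ^+ 3 / 4 * nrm P al be.
Proof.
move=> ab sep; pose D := b - a; have D0 : 0 < D by rewrite subr_gt0.
pose w t := (t - a) * (b - t).
have cw : cont a b w by exact: prim_cont (prim_weight a b).
pose n i := al i ^+ 2 + be i ^+ 2.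
have n0 i : 0 <= n i by rewrite addr_ge0 ?sqr_ge0.
pose A i j := (al i * al j + be i * be j) * Int a b (fun t => w t * cos ((lam i - lam j) * t)) -
   (be i * al j - al i * be j) * Int a b (fun t => w t * sin ((lam i - lam j) * t)).
have cc x : cont a b (fun t => cos (x * t)) by exact: cont_cos_scaled.
have cs x : cont a b (fun t => sin (x * t)) by exact: cont_sin_scaled.
have E : Int a b (fun t => w t * tsq P al be lam t) = \sum_(i | P i) \sum_(j | P j) A i j.
  transitivity (Int a b (fun t => \sum_(i | P i) \sum_(j | P j)
      ((al i * al j + be i * be j) * (w t * cos ((lam i - lam j) * t)) -
       (be i * al j - al i * be j) * (w t * sin ((lam i - lam j) * t))))).
    apply: Int_ext => t _; rewrite tsq_expand mulr_sumr; apply: eq_bigr => i _.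
    by rewrite mulr_sumr; apply: eq_bigr => j _; ring.
  have ic x : itg a b (fun t => w t * cos (x * t)) by apply: cont_itg; exact: contM.
  have is_ x : itg a b (fun t => w t * sin (x * t)) by apply: cont_itg; exact: contM.
  rewrite Int_sum => [|i _]; last by apply: itg_sum => j _; apply: itgB; exact: itgZ.
  apply: eq_bigr => i _; rewrite Int_sum => [|j _]; last by apply: itgB; exact: itgZ.
  apply: eq_bigr => j _; rewrite IntB; [|exact: itgZ|exact: itgZ].
  by rewrite !IntZ.
have Ad i : A i i = D ^+ 3 / 6 * n i.
  have c0 : be i * al i - al i * be i = 0 by ring.
  rewrite /A c0 mul0r subr0 mulrC -!expr2 -(Int_weight (ltW ab)).
  by congr (_ * _); apply: Int_ext => t _; rewrite subrr mul0r cos0 mulr1.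
have Ao i j : P i -> P j -> i != j ->
    `|A i j| <= 3 * D * (n i / (lam i - lam j) ^+ 2 + n j / (lam i - lam j) ^+ 2).
  move=> Pi Pj ij; have xl := sep i j Pi Pj ij.
  have xl' : 4 / (b - a) <= `|lam i - lam j|.
    by apply: le_trans xl; rewrite ler_pM2r ?invr_gt0 //; lra.
  have h1 := Int_weight_cos ab xl'; have h2 := Int_weight_sin ab xl'.
  rewrite -/D in h1 h2.
  set X := (lam i - lam j) in h1 h2 *; set B := 3 * D / X ^+ 2 in h1 h2.
  have B0 : 0 <= B by rewrite divr_ge0 ?sqr_ge0 // mulr_ge0 // ltW.
  have -> : 3 * D * (n i / X ^+ 2 + n j / X ^+ 2) = (n i + n j) / 2 * B + (n i + n j) / 2 * B.
    by rewrite /B; lra.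
  have m1 : `|al i * al j + be i * be j| <= (n i + n j) / 2.
    rewrite /n ler_norml.
    have := sqr_ge0 (al i - al j); have := sqr_ge0 (be i - be j).
    have := sqr_ge0 (al i + al j); have := sqr_ge0 (be i + be j).
    by move=> *; apply/andP; split; lra.
  have m2 : `|be i * al j - al i * be j| <= (n i + n j) / 2.
    rewrite /n ler_norml.
    have := sqr_ge0 (be i - al j); have := sqr_ge0 (al i - be j).
    have := sqr_ge0 (be i + al j); have := sqr_ge0 (al i + be j).
    by move=> *; apply/andP; split; lra.
  by apply: (le_trans (ler_normB _ _)); rewrite !normrM; apply: lerD; apply: ler_pM.
pose off := \sum_(i | P i) \sum_(j | P j && (j != i)) A i j.
have Eo : Int a b (fun t => w t * tsq P al be lam t) = D ^+ 3 / 6 * nrm P al be + off.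
  rewrite E /off /nrm mulr_sumr -big_split /=; apply: eq_bigr => i Pi.
  by rewrite (bigD1 i) //= Ad.
have G0 : 0 < 17 / D by rewrite divr_gt0.
pose q := \sum_(i | P i) \sum_(j | P j && (j != i)) n i / (lam i - lam j) ^+ 2.
have q_le : q <= 4 / (17 / D) ^+ 2 * nrm P al be.
  rewrite /q /nrm mulr_sumr; apply: ler_sum => i Pi; rewrite -mulr_sumr mulrC ler_wpM2r //.
  exact: separated_sum.
(* Exchanging the two indices shows that both halves of the bound in [Ao] have the same sum. *)
have q_sym : q = \sum_(i | P i) \sum_(j | P j && (j != i)) n j / (lam i - lam j) ^+ 2.
  rewrite /q (exchange_big_dep P) /=; last by move=> i j Pi /andP[].
  apply: eq_bigr => j Pj; apply: eq_big => [i|i _].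
    by rewrite Pj /= eq_sym.
  by rewrite -sqrrN opprB.
have off_le : `|off| <= D ^+ 3 / 12 * nrm P al be.
  apply: (@le_trans _ _ (3 * D * (q + q))).
    rewrite {2}q_sym /q -big_split mulr_sumr /=.
    apply: (le_trans (ler_norm_sum _ _ _)); apply: ler_sum => i Pi.
    rewrite -big_split mulr_sumr /=.
    apply: (le_trans (ler_norm_sum _ _ _)); apply: ler_sum => j /andP[Pj ji].
    by apply: Ao => //; rewrite eq_sym.
  have : 3 * D * (q + q) <= 3 * D * (2 * (4 / (17 / D) ^+ 2 * nrm P al be)).
    by rewrite ler_pM2l ?mulr_gt0 //; lra.
  move/le_trans; apply.
  have -> : 3 * D * (2 * (4 / (17 / D) ^+ 2 * nrm P al be)) = (24 / 289) * (D ^+ 3 * nrm P al be).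
    by field; rewrite gt_eqF.
  have : 0 <= D ^+ 3 * nrm P al be by rewrite mulr_ge0 ?nrm_ge0 // exprn_ge0 // ltW.
  by lra.
move: off_le; rewrite ler_norml => /andP[of1 of2].
rewrite -/D Eo; apply/andP; split; lra.
Qed.

End Fixed.

(** The constants depend on [S] and [T] only and serve all finite families of distinct frequencies
    in [S], so the inequality survives the passage to infinite sums and the choice of an
    eigenbasis. *)
Definition ingham (S : R -> Prop) (T : R) : Prop := exists c C, [/\ 0 < c, 0 < C &
  forall (I : finType) (P : pred I) (al be lam : I -> R),
    (forall i, P i -> S (lam i)) ->
    (forall i j, P i -> P j -> lam i = lam j -> i = j) ->
    c * nrm P al be <= Int 0 T (tsq P al be lam) <= C * nrm P al be].

Lemma ingham_sub (S S' : R -> Prop) T : (forall x, S' x -> S x) ->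
  ingham S T -> ingham S' T.
Proof.
move=> SS [c [C [c0 C0 H]]]; exists c, C; split => // I P al be lam HS inj.
by apply: H => // i Pi; apply: SS; exact: HS.
Qed.

(** For the lower bound, [t (T - t) <= T ^ 2] on [[0, T]]. For the upper bound the weight is taken
    on the larger interval [[- T, 2 T]], where [(t + T) (2 T - t) = 2 T ^ 2 + t (T - t)] is at least
    [2 T ^ 2] on [[0, T]]. *)
Lemma ingham_separated (S : R -> Prop) (T G : R) : 0 < T -> 17 / T <= G ->
  (forall x y, S x -> S y -> x != y -> G <= `|x - y|) -> ingham S T.
Proof.
move=> T0 GT sep.
exists (T / 12), (27 * T / 8); split; [by rewrite divr_gt0|by rewrite divr_gt0 // mulr_gt0|].
move=> I P al be lam HS inj.
have sepI i j : P i -> P j -> i != j -> G <= `|lam i - lam j|.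
  move=> Pi Pj ij; apply: sep; [exact: HS|exact: HS|].
  by apply: contra ij => /eqP /(inj _ _ Pi Pj) ->.
have N0 := @nrm_ge0 I P al be.
have ct a b := @cont_tsq I P al be lam a b.
have cw a b : cont a b (fun t : R => (t - a) * (b - t)) by exact: prim_cont (prim_weight a b).
have cwt a b : itg a b (fun t => (t - a) * (b - t) * tsq P al be lam t).
  by apply: cont_itg; exact: contM.
apply/andP; split.
  have := @tsq_weighted I P al be lam 0 T T0; rewrite subr0 => H.
  have /andP[{}H _] := H (fun i j Pi Pj ij => le_trans GT (sepI i j Pi Pj ij)).
  have T2 : 0 < T ^+ 2 by rewrite exprn_gt0.
  rewrite -(ler_pM2l T2).
  have -> : T ^+ 2 * (T / 12 * nrm P al be) = T ^+ 3 / 12 * nrm P al be by field.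
  apply: (le_trans H); rewrite -IntZ; last exact: cont_itg.
  apply: Int_le => //; first by apply: itgZ; exact: cont_itg.
  move=> t /andP[t0 tT]; rewrite ler_wpM2r ?tsq_ge0 // subr0 expr2.
  by apply: ler_pM => //; rewrite ?subr_ge0 // lerBlDr lerDl.
have ab : - T < 2 * T by lra.
have Dp : 2 * T - - T = 3 * T by ring.
have := @tsq_weighted I P al be lam (- T) (2 * T) ab; rewrite Dp => H.
have G' : 17 / (3 * T) <= G.
  apply: le_trans GT; rewrite ler_pM2l // lef_pV2 ?posrE ?mulr_gt0 //; lra.
have /andP[_ {}H] := H (fun i j Pi Pj ij => le_trans G' (sepI i j Pi Pj ij)).
have T2 : 0 < 2 * T ^+ 2 by rewrite mulr_gt0 // exprn_gt0.
rewrite -(ler_pM2l T2).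
have -> : 2 * T ^+ 2 * (27 * T / 8 * nrm P al be) = (3 * T) ^+ 3 / 4 * nrm P al be by field.
apply: le_trans H; rewrite -IntZ; last exact: cont_itg.
rewrite (@Int_chasles _ (- T) 0 (2 * T)) //; [|lra|lra].
rewrite (@Int_chasles _ 0 T (2 * T)) //; [|lra|lra|]; last first.
  by apply: itg_sub (cwt (- T) (2 * T)) => //; lra.
have i1 : itg 0 T (fun t => (t - - T) * (2 * T - t) * tsq P al be lam t).
  by apply: itg_sub (cwt (- T) (2 * T)) => //; lra.
have pos (a b : R) : - T <= a -> b <= 2 * T ->
    0 <= Int a b (fun t => (t - - T) * (2 * T - t) * tsq P al be lam t).
  move=> h1 h2; apply: Int_ge0 => t /andP[t0 tT]; rewrite mulr_ge0 ?tsq_ge0 //.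
  by apply: mulr_ge0; lra.
have p1 := pos (- T) 0 (lexx _) _; have p2 := pos T (2 * T) _ (lexx _).
have {}p1 := p1 _; have {}p2 := p2 _.
apply: (@le_trans _ _ (Int 0 T (fun t => (t - - T) * (2 * T - t) * tsq P al be lam t))).
  apply: Int_le => //; first by apply: itgZ; exact: cont_itg.
  move=> t /andP[t0 tT]; rewrite ler_wpM2r ?tsq_ge0 //.
  have : 0 <= t * (T - t) by rewrite mulr_ge0 // subr_ge0.
  by lra.
by rewrite addrCA lerDl addr_ge0 //; [apply: pos; lra|apply: pos; lra].
Qed.

Section Difference.
Context {I : finType} {P : pred I} {al be lam : I -> R} (l0 s : R).
Let th i := (lam i - l0) * s.
Let al' i := al i * (cos (th i) - 1) - be i * sin (th i).
Let be' i := be i * (cos (th i) - 1) + al i * sin (th i).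

(* The polynomial with these coefficients is [e^(- i l0 s) f (t + s) - f t], where
   the frequency [l0] has disappeared. *)
Lemma tsq_difference t : tsq P al' be' lam t <=
  2 * tsq P al be lam (t + s) + 2 * tsq P al be lam t.
Proof.
have th_cos i : cos (th i) = cos (lam i * s) * cos (l0 * s) + sin (lam i * s) * sin (l0 * s).
  by rewrite /th mulrBl cosB.
have th_sin i : sin (th i) = sin (lam i * s) * cos (l0 * s) - cos (lam i * s) * sin (l0 * s).
  by rewrite /th mulrBl sinB.
have cE i : cos (lam i * (t + s)) = cos (lam i * t) * cos (lam i * s) - sin (lam i * t) * sin (lam i * s).
  by rewrite mulrDr cosD.
have sE i : sin (lam i * (t + s)) = sin (lam i * t) * cos (lam i * s) + cos (lam i * t) * sin (lam i * s).
  by rewrite mulrDr sinD.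
have E1 : tre P al' be' lam t = cos (l0 * s) * tre P al be lam (t + s)
    + sin (l0 * s) * tim P al be lam (t + s) - tre P al be lam t.
  rewrite /tre /tim !mulr_sumr -big_split -sumrB; apply: eq_bigr => i _ /=.
  by rewrite /al' /be' th_cos th_sin cE sE; ring.
have E2 : tim P al' be' lam t = cos (l0 * s) * tim P al be lam (t + s)
    - sin (l0 * s) * tre P al be lam (t + s) - tim P al be lam t.
  rewrite /tre /tim !mulr_sumr -!sumrB; apply: eq_bigr => i _ /=.
  by rewrite /al' /be' th_cos th_sin cE sE; ring.
rewrite /tsq E1 E2.
set c := cos (l0 * s); set d := sin (l0 * s).
set A := tre P al be lam (t + s); set B := tim P al be lam (t + s).
set A0 := tre P al be lam t; set B0 := tim P al be lam t.
have cd : c ^+ 2 + d ^+ 2 = 1 by exact: cos2Dsin2.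
have -> : A ^+ 2 + B ^+ 2 = (c * A + d * B) ^+ 2 + (c * B - d * A) ^+ 2.
  by rewrite -[LHS]mul1r -cd; ring.
have := sqr_ge0 (c * A + d * B + A0); have := sqr_ge0 (c * B - d * A + B0).
by lra.
Qed.

(** [2 - 2 cos theta] is the squared modulus of [e^(i theta) - 1]. *)
Lemma nrm_difference : nrm P al' be' =
  \sum_(i | P i) (al i ^+ 2 + be i ^+ 2) * (2 - 2 * cos ((lam i - l0) * s)).
Proof.
apply: eq_bigr => i _; rewrite /al' /be' -/(th i).
have := cos2Dsin2 (th i); set c := cos _; set d := sin _ => cd.
transitivity ((al i ^+ 2 + be i ^+ 2) * (c ^+ 2 + d ^+ 2 + 1 - 2 * c)); first by ring.
by rewrite cd; ring.
Qed.

End Difference.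

Lemma Int_two_sub_cos (d m : R) : 0 <= d -> m != 0 ->
  Int 0 d (fun s => 2 - 2 * cos (m * s)) = 2 * (`|m| * d - sin (`|m| * d)) / `|m|.
Proof.
move=> d0 m0.
have P := primB (primZ 2 (prim_id 0 d)) (primZ (2 / m) (prim_sin_scaled 0 d m)).
transitivity (Int 0 d (fun x => 2 * 1 - 2 / m * (m * cos (m * x)))).
  by apply: Int_ext => x _; field.
rewrite (prim_Int P d0) !mulr0 sin0 mulr0 subr0 subr0.
have [mp|mn] := ltP 0 m; first by rewrite gtr0_norm //; field.
by rewrite ler0_norm // mulNr sinN; field.
Qed.

(** Half of the excess [T - T0] is spent on shifts. The differences no longer contain [l0], so the
    inequality for [S] at the shorter time controls the other coefficients; the coefficient at [l0]
    follows by subtraction. The range of times [T0 < T] is recovered unchanged, which permits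
    iteration. *)
Lemma ingham_add (S : R -> Prop) (T0 l0 d : R) : 0 <= T0 -> 0 < d ->
  (forall x, S x -> d <= `|x - l0|) ->
  (forall T, T0 < T -> ingham S T) ->
  forall T, T0 < T -> ingham (fun x => S x \/ x = l0) T.
Proof.
move=> T00 d0 Sd HS T TT.
pose dl := (T - T0) / 2; pose T1 := T - dl.
have dl0 : 0 < dl by rewrite /dl; lra.
have T1T : T0 < T1 by rewrite /T1 /dl; lra.
have Tp : 0 < T by exact: le_lt_trans T00 TT.
have T1p : 0 < T1 by exact: le_lt_trans T00 T1T.
have [c1 [C1 [c10 C10 H1]]] := HS T1 T1T.
have [c2 [C2 [c20 C20 H2]]] := HS T TT.
have [e e0 He] := one_minus_sinc (mulr_gt0 d0 dl0).
(* [B] is the factor in [nrm Q al be <= B * E] drawn from [avg]; [K] adds the factor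
   [(2 + 2 * C2 * B) / T] for the coefficient at [l0]. *)
pose B := 2 / (c1 * e); have B0 : 0 < B by rewrite divr_gt0 // mulr_gt0.
pose K := B + (2 + 2 * C2 * B) / T.
have CB0 : 0 < 2 * C2 * B by rewrite mulr_gt0 // mulr_gt0.
have K0 : 0 < K by rewrite /K addr_gt0 // divr_gt0 //; lra.
exists (Num.min c2 K^-1), (C2 + (2 * T + 2 * C2)); split.
- by rewrite lt_min c20 invr_gt0.
- by rewrite addr_gt0 // addr_gt0 // mulr_gt0.
move=> I P al be lam HP inj.
have ct (Q : pred I) a b x y := @cont_tsq I Q a b lam x y.
have [[i0 [Pi0 li0]]|none] := pselect (exists i, P i /\ lam i = l0); last first.
  have HP' i : P i -> S (lam i).
    by move=> Pi; case: (HP i Pi) => // li; exfalso; apply: none; exists i.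
  have /andP[h1 h2] := H2 I P al be lam HP' inj; apply/andP; split.
    by apply: le_trans h1; rewrite ler_wpM2r ?nrm_ge0 // ge_min lexx.
  apply: (le_trans h2); rewrite ler_wpM2r ?nrm_ge0 // lerDl.
  by rewrite addr_ge0 // mulr_ge0 // ltW.
pose Q := [pred i | P i && (i != i0)].
have QS i : Q i -> S (lam i).
  move=> /andP[Pi ii0]; case: (HP i Pi) => // li.
  by move: ii0; rewrite (inj i i0 Pi Pi0) ?eqxx // li li0.
have Qinj i j : Q i -> Q j -> lam i = lam j -> i = j.
  by move=> /andP[Pi _] /andP[Pj _]; exact: inj.
set E := Int 0 T (tsq P al be lam).
pose n0 := al i0 ^+ 2 + be i0 ^+ 2.
have nE : nrm P al be = n0 + nrm Q al be by rewrite /nrm (bigD1 i0).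
have n00 : 0 <= n0 by rewrite addr_ge0 ?sqr_ge0.
have E0 : 0 <= E by apply: Int_ge0 => t _; exact: tsq_ge0.
have NQ := @nrm_ge0 I Q al be.
have split_tsq t : [/\ tsq P al be lam t <= 2 * n0 + 2 * tsq Q al be lam t &
    n0 <= 2 * tsq P al be lam t + 2 * tsq Q al be lam t].
  pose a0 := al i0 * cos (lam i0 * t) - be i0 * sin (lam i0 * t).
  pose b0 := al i0 * sin (lam i0 * t) + be i0 * cos (lam i0 * t).
  have -> : n0 = a0 ^+ 2 + b0 ^+ 2.
    by rewrite /n0 -[LHS]mul1r -(cos2Dsin2 (lam i0 * t)) /a0 /b0; ring.
  have eA : tre P al be lam t = a0 + tre Q al be lam t by rewrite /tre (bigD1 i0).
  have eB : tim P al be lam t = b0 + tim Q al be lam t by rewrite /tim (bigD1 i0).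
  rewrite /tsq eA eB; set u := tre Q al be lam t; set v := tim Q al be lam t.
  have := sqr_ge0 (a0 - u); have := sqr_ge0 (b0 - v).
  have := sqr_ge0 (a0 + u + u); have := sqr_ge0 (b0 + v + v).
  by split; lra.
have iP : itg 0 T (tsq P al be lam) by apply: cont_itg.
have iQ : itg 0 T (tsq Q al be lam) by apply: cont_itg.
have shift s : 0 <= s <= dl -> Int 0 T1 (fun t => tsq P al be lam (t + s)) <= E.
  move=> /andP[s0 sd]; rewrite Int_shift ?(ltW T1p) //; last exact: continuous_tsq.
  rewrite add0r /E (@Int_chasles _ 0 s T) //; last by rewrite (le_trans sd) // /dl; lra.
  rewrite (@Int_chasles _ s (T1 + s) T); [|by rewrite lerDr ltW|by rewrite /T1; lra|exact: cont_itg].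
  by rewrite addrCA lerDl addr_ge0 //; apply: Int_ge0 => t _; exact: tsq_ge0.
have E1 : Int 0 T1 (tsq P al be lam) <= E.
  rewrite /E (@Int_chasles _ 0 T1 T) ?(ltW T1p) //; last by rewrite /T1; lra.
  by rewrite lerDl; apply: Int_ge0 => t _; exact: tsq_ge0.
have low s : 0 <= s <= dl ->
   c1 * (\sum_(i | Q i) (al i ^+ 2 + be i ^+ 2) * (2 - 2 * cos ((lam i - l0) * s))) <= 4 * E.
  move=> sd; rewrite -nrm_difference.
  have /andP[h _] := H1 I Q (fun i => al i * (cos ((lam i - l0) * s) - 1) - be i * sin ((lam i - l0) * s))
    (fun i => be i * (cos ((lam i - l0) * s) - 1) + al i * sin ((lam i - l0) * s)) lam QS Qinj.
  apply: (le_trans h).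
  have cs : cont 0 T1 (fun t => tsq P al be lam (t + s)).
    apply: continuous_cont => t.
    apply: (@continuous_comp _ _ _ (fun t => t + s) (tsq P al be lam)); last exact: continuous_tsq.
    by apply: cvgD; [exact: cvg_id|exact: cvg_cst].
  apply: (@le_trans _ _ (Int 0 T1 (fun t => 2 * tsq P al be lam (t + s) + 2 * tsq P al be lam t))).
    apply: Int_le; [exact: cont_itg|by apply: cont_itg; apply: contD; exact: contZ|].
    move=> t _; apply: le_trans (tsq_difference l0 s t).
    have z0 : (lam i0 - l0) * s = 0 by rewrite li0 subrr mul0r.
    rewrite /tsq /tre /tim (bigD1 i0 Pi0) (bigD1 i0 Pi0 (F := fun i => _ + _)) /= z0 cos0 sin0.
    by rewrite !subrr !mulr0 subrr addr0 !mul0r subrr addr0 !add0r.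
  rewrite IntD ?IntZ //; try (by apply: cont_itg); try (by apply: cont_itg; exact: contZ).
  by have := shift s sd; lra.
(* For a single shift [s] some factor [2 - 2 cos ((lam i - l0) s)] may vanish or be small; averaging
   over [s] bounds all of them from below, since [|lam i - l0| >= d]. *)
have avg : c1 * (2 * e * dl * nrm Q al be) <= 4 * E * dl.
  have icos m : itg 0 dl (fun s => 2 - 2 * cos (m * s)).
    by apply: cont_itg; apply: contB; [exact: cont_cst|apply: contZ; exact: cont_cos_scaled].
  have -> : 4 * E * dl = Int 0 dl (fun=> 4 * E) by rewrite Int_cst ?subr0 // ltW.
  apply: (@le_trans _ _ (Int 0 dl (fun s => c1 * (\sum_(i | Q i) (al i ^+ 2 + be i ^+ 2) *
     (2 - 2 * cos ((lam i - l0) * s)))))); last first.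
    apply: Int_le; [|exact: itg_cst|exact: low].
    by apply: itgZ; apply: itg_sum => i _; exact: itgZ.
  rewrite IntZ; last by apply: itg_sum => i _; exact: itgZ.
  rewrite ler_pM2l // Int_sum => [|i _]; last exact: itgZ.
  rewrite /nrm mulr_sumr; apply: ler_sum => i Qi; rewrite IntZ // [leLHS]mulrC.
  rewrite ler_wpM2l ?addr_ge0 ?sqr_ge0 //.
  have dm := Sd _ (QS i Qi); set m := lam i - l0 in dm *.
  have mp : 0 < `|m| by exact: lt_le_trans dm.
  rewrite Int_two_sub_cos ?(ltW dl0) -?normr_gt0 // ler_pdivlMr //.
  have yE : `| `|m| * dl | = `|m| * dl by rewrite normrM normr_id (gtr0_norm dl0).
  have md : d * dl <= `| `|m| * dl | by rewrite yE ler_pM2r.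
  have := He (`|m| * dl) md; rewrite yE.
  by lra.
have bQ : nrm Q al be <= B * E.
  have dl2 : 0 < 2 * dl by rewrite mulr_gt0.
  rewrite /B mulrAC ler_pdivlMr ?mulr_gt0 // -(ler_pM2r dl2).
  by move: avg; lra.
have /andP[_ hQ] := H2 I Q al be lam QS Qinj.
have b0 : T * n0 <= (2 + 2 * C2 * B) * E.
  have -> : T * n0 = Int 0 T (fun=> n0) by rewrite Int_cst ?(ltW Tp) // subr0 mulrC.
  apply: (@le_trans _ _ (Int 0 T (fun t => 2 * tsq P al be lam t + 2 * tsq Q al be lam t))).
    apply: Int_le; [exact: itg_cst|by apply: itgD; exact: itgZ|].
    by move=> t _; case: (split_tsq t).
  rewrite IntD ?IntZ //; try exact: itgZ.
  have : C2 * nrm Q al be <= C2 * (B * E) by rewrite ler_pM2l.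
  by rewrite -/E; lra.
apply/andP; split.
  have main : nrm P al be <= K * E.
    rewrite nE /K; move: b0; rewrite mulrC -ler_pdivlMr // => b0.
    rewrite mulrDl addrC; apply: lerD => //.
    by rewrite mulrAC.
  apply: (@le_trans _ _ (K^-1 * nrm P al be)).
    by rewrite ler_wpM2r ?nrm_ge0 // ge_min lexx orbT.
  by rewrite mulrC ler_pdivrMr // mulrC.
apply: (@le_trans _ _ (Int 0 T (fun t => 2 * n0 + 2 * tsq Q al be lam t))).
  apply: Int_le => //; first by apply: itgD; [exact: itg_cst|exact: itgZ].
  by move=> t _; case: (split_tsq t).
rewrite IntD; [|exact: itg_cst|exact: itgZ].
rewrite Int_cst ?(ltW Tp) // IntZ // nE subr0.
have : 0 <= C2 * n0 by rewrite mulr_ge0 // ltW.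
have : 0 <= T * nrm Q al be by rewrite mulr_ge0 // ltW.
have : 0 <= C2 * nrm Q al be by rewrite mulr_ge0 // ltW.
by move=> *; lra.
Qed.

Lemma list_distance (t : seq R) (x : R) :
  exists2 d, 0 < d & forall y, y \in t -> y != x -> d <= `|y - x|.
Proof.
elim: t => [|z t [d d0 Hd]]; first by exists 1.
exists (if z == x then d else Num.min d `|z - x|).
  by case: ifPn => // zx; rewrite lt_min d0 normr_gt0 subr_eq0.
move=> y; rewrite inE => /predU1P[->|yt] yx; first by rewrite (negbTE yx) ge_min lexx orbT.
by case: ifP => _; [exact: Hd|rewrite ge_min Hd].
Qed.

(** Beyond some level the gap is at least [17 / T'] with [T' = T / 2], which settles all times
    larger than [T']. Each further frequency is added without shrinking this range, which contains
    [T]. *)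
Theorem ingham_asymptotic_gap (S : R -> Prop) (T : R) : 0 < T ->
  (forall L, exists t : seq R, forall x, S x -> x <= L -> x \in t) ->
  (forall G, exists L, forall x y, S x -> S y -> L <= x -> L <= y -> x != y -> G <= `|x - y|) ->
  ingham S T.
Proof.
move=> T0 fin sep; pose T' := T / 2.
have T'0 : 0 < T' by rewrite /T'; lra.
have [L HL] := sep (17 / T').
have [t Ht] := fin L.
have main (s : seq R) : forall T1, T' < T1 -> ingham (fun x => S x /\ (L < x \/ x \in s)) T1.
  elim: s => [|z s IH] T1 TT1.
    have T10 := lt_trans T'0 TT1.
    apply: (@ingham_separated _ _ (17 / T')) => //.
      by rewrite ler_pM2l // lef_pV2 ?posrE // ltW.
    by move=> x y [Sx [Lx|//]] [Sy [Ly|//]]; apply: HL => //; exact: ltW.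
  have [[Sz zn]|Hz] := pselect (S z /\ ~ (L < z \/ z \in s)); last first.
    apply: ingham_sub (IH T1 TT1) => x [Sx Hx]; split => //.
    case: Hx => [|]; first by left.
    rewrite inE => /predU1P[xz|]; last by right.
    by subst x; apply: contrapT => H; apply: Hz.
  (* [z] is at positive distance from the other frequencies: finitely many lie below [z + 1], and
     the ones above are at distance at least 1. *)
  have [t2 Ht2] := fin (z + 1).
  have [d d0 Hd] := list_distance t2 z.
  apply: (@ingham_sub (fun x => (S x /\ (L < x \/ x \in s)) \/ x = z)).
    move=> x [Sx [Lx|]]; first by left; split => //; left.
    by rewrite inE => /predU1P[->|xs]; [right|left; split => //; right].
  apply: (@ingham_add _ T' z (Num.min d 1)) => //; first exact: ltW.
    by rewrite lt_min d0 ltr01.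
  move=> x [Sx Hx]; have xz : x != z by apply/eqP => xz; apply: zn; rewrite -xz.
  have [xz1|xz1] := leP x (z + 1).
    by rewrite ge_min Hd // Ht2.
  rewrite ge_min; apply/orP; right.
  by rewrite ger0_norm; lra.
apply: ingham_sub (main t T _); last by rewrite /T'; lra.
move=> x Sx; split => //; have [xL|xL] := ltP L x; first by left.
by right; apply: Ht.
Qed.

End TrigPolynomials.

(** * Poincare inequalities and closability of the second derivative *)

Section Closability.
Context {R : realType}.

Lemma sum_ord_diff (V : zmodType) (F : nat -> V) (m n : nat) : (m <= n)%N ->
  \sum_(i < n) F i - \sum_(i < m) F i = \sum_(i < n | (m <= i)%N) F i.
Proof.
move=> mn; rewrite (bigID (fun i : 'I_n => (m <= i)%N)) /=.
rewrite (big_ord_widen n F mn) (_ : \sum_(i < n | ~~ (m <= i)%N) F i = \sum_(i < n | (i < m)%N) F i).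
  by rewrite addrK.
by apply: eq_bigl => i; rewrite -ltnNge.
Qed.

Lemma sq_eq0 (l : R) f : 0 < l -> cont 0 l f -> sq 0 l f = 0 -> forall x, 0 <= x <= l -> f x = 0.
Proof.
move=> l0 cf f0 x xl.
have cf2 : cont 0 l (fun x => f x ^+ 2) by exact: contX.
have Hi y : 0 <= y <= l -> Int 0 y (fun x => f x ^+ 2) = 0.
  move=> /andP[y0 yl]; have := f0; rewrite /sq (Int_chasles y0 yl (cont_itg cf2)).
  have g x1 y1 : 0 <= Int x1 y1 (fun x => f x ^+ 2) by apply: Int_ge0 => z _; exact: sqr_ge0.
  by have := g 0 y; have := g y l; lra.
have P1 : prim 0 l (fun=> 0) (fun x => f x ^+ 2).
  by split; [exact: cont_itg|move=> y yl; rewrite Hi // addr0].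
have := prim_uniq_cont l0 P1 (prim_cst 0 l 0) cf2 (@cont_cst _ 0 l 0) xl.
by move/eqP; rewrite sqrf_eq0 => /eqP.
Qed.

Lemma prim_exists (l c : R) f : itg 0 l f -> prim 0 l (fun x => c + Int 0 x f) f.
Proof. by move=> fi; split => // x _; rewrite Int_same addr0. Qed.

Lemma poincare (l : R) u v : prim 0 l u v -> L2r 0 l v -> u 0 = 0 ->
  forall x, 0 <= x <= l -> u x ^+ 2 <= l * sq 0 l v.
Proof.
move=> Hu vL u0 x /andP[x0 xl].
have vLx : L2r 0 x v.
  split; last by apply: itg_sub vL.2.
  by apply: itg_meas; apply: itg_sub (L2r_itg vL).
rewrite (Hu.2 x) ?x0 // u0 add0r; apply: (le_trans (Int_sqr_le x0 vLx)); rewrite subr0.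
apply: ler_pM => //; first exact: sq_ge0.
rewrite /sq (@Int_chasles _ 0 x l) //; last exact: vL.2.
by rewrite lerDl Int_ge0 // => y _; exact: sqr_ge0.
Qed.

Lemma poincare_sq (l : R) u v : 0 < l -> prim 0 l u v -> L2r 0 l v -> u 0 = 0 ->
  sq 0 l u <= l ^+ 2 * sq 0 l v.
Proof.
move=> l0 Hu vL u0; have uL := L2r_cont (prim_cont Hu); have lge0 := ltW l0.
rewrite expr2 -mulrA [X in _ <= X]mulrC -[X in _ * X](subr0 l) -Int_cst //.
by apply: Int_le; [exact: uL.2|exact: itg_cst|exact: poincare].
Qed.

(* Second derivatives are closable: the limit of [w2 n] is the second derivative of the
   limit of [w n], which is 0. *)
Lemma W2_closable (l : R) (w w1 w2 : nat -> R -> R) : 0 < l ->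
  (forall n, W2 l (w n) (w1 n) (w2 n)) -> (forall n, w n 0 = 0) -> (forall n, w1 n 0 = 0) ->
  (forall e, 0 < e -> exists N, forall m n, (N <= m)%N -> (N <= n)%N ->
     sq 0 l (fun x => w2 m x - w2 n x) <= e) ->
  (forall e, 0 < e -> exists N, forall n, (N <= n)%N -> sq 0 l (w n) <= e) ->
  forall e, 0 < e -> exists N, forall n, (N <= n)%N -> sq 0 l (w2 n) <= e.
Proof.
move=> l0 HW z0 z1 HC HL; have l0' := ltW l0.
have [G GL HG] := L2_complete (fun n => let: And3 _ _ h := HW n in h) HC.
(* [V] has second derivative [G], the limit of [w2 n], and zero value and slope at 0, like every
   [w n]. *)
pose V1 x := 0 + Int 0 x G; pose V x := 0 + Int 0 x V1.
have P1 : prim 0 l V1 G by apply: prim_exists; exact: L2r_itg.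
have P0 : prim 0 l V V1 by apply: prim_exists; apply: cont_itg; exact: prim_cont P1.
have V10 : V1 0 = 0 by rewrite /V1 Int_same addr0.
have V0 : V 0 = 0 by rewrite /V Int_same addr0.
have cV := prim_cont P0; have cV1 := prim_cont P1.
(* The Poincare inequality, applied twice to [w n - V], shows that [w n] tends to [V]; since [w n]
   also tends to zero, [V] vanishes. *)
have bound n : sq 0 l V <= 2 * sq 0 l (w n) + 2 * (l ^+ 2 * (l ^+ 2 * sq 0 l (fun x => w2 n x - G x))).
  have [H0 H1 H2] := HW n.
  have D1 := primB H1 P1; have D0 := primB H0 P0.
  have e1 := poincare_sq l0 D1 (L2rB H2 GL) _; have {}e1 := e1 _.
  have e0 := poincare_sq l0 D0 (L2r_cont (prim_cont D1)) _; have {}e0 := e0 _.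
  have h1 : sq 0 l (fun x => w1 n x - V1 x) <= l ^+ 2 * sq 0 l (fun x => w2 n x - G x).
    by apply: e1; rewrite z1 V10 subrr.
  have h0 : sq 0 l (fun x => w n x - V x) <= l ^+ 2 * (l ^+ 2 * sq 0 l (fun x => w2 n x - G x)).
    apply: le_trans (e0 _) _; first by rewrite z0 V0 subrr.
    by rewrite ler_wpM2l // sqr_ge0.
  rewrite (@sq_ext _ _ _ V (fun x => w n x - (w n x - V x))); last by move=> x _; ring.
  apply: le_trans (sqB_le (L2r_cont (prim_cont H0)) (L2r_cont (prim_cont D0))) _.
  by rewrite lerD2l ler_pM2l.
have V2 : sq 0 l V = 0.
  apply/eqP; rewrite eq_le sq_ge0 andbT; apply/ler_addgt0Pr => e e0; rewrite add0r.
  have h4 : 0 < 4 * l ^+ 4 by rewrite mulr_gt0 // exprn_gt0.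
  have [N1 HN1] := HL (e / 4) ltac:(by rewrite divr_gt0).
  have [N2 HN2] := HG (e / (4 * l ^+ 4)) ltac:(by rewrite divr_gt0).
  apply: le_trans (bound (maxn N1 N2)) _.
  have b1 := HN1 _ (leq_maxl N1 N2); have := HN2 _ (leq_maxr N1 N2).
  rewrite ler_pdivlMr // => b2; nra.
have Vz := sq_eq0 l0 cV V2.
have Pz : prim 0 l V (fun=> 0).
  by apply: prim_ext (prim_cst 0 l 0) => // x xl; rewrite Vz.
have V1z := prim_uniq_cont l0 P0 Pz cV1 (@cont_cst _ 0 l 0).
have Pz1 : prim 0 l V1 (fun=> 0).
  by apply: prim_ext (prim_cst 0 l 0) => // x xl; rewrite V1z.
have Gz := prim_uniq_ae l0 P1 Pz1.
have G0 : sq 0 l G = 0.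
  rewrite /sq (@Int_ae _ _ _ _ (fun=> 0)) ?Int_cst ?mul0r //.
  - exact: itg_meas GL.2.
  - exact: cont_meas (@cont_cst _ 0 l 0).
  - by apply: ae_imp Gz => x h xl; rewrite h // expr0n.
move=> e e0; have [N HN] := HG (e / 2) ltac:(by rewrite divr_gt0).
exists N => n Nn; have [_ _ H2] := HW n.
rewrite (@sq_ext _ _ _ _ (fun x => (w2 n x - G x) + G x)); last by move=> x _; ring.
apply: le_trans (sqD_le (L2rB H2 GL) GL) _.
by rewrite G0; have := HN n Nn; lra.
Qed.

End Closability.

(** * The differential equation of a Fourier coefficient *)

Section Rotation.
Context {R : realType}.

(** [P + i Q], the product of [a + i b] by [e^(- i lam t)], has zero derivative in the interior; the
    mean value theorem asks only for continuity at the ends. *)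
Lemma rotation_ode (lam T : R) (a b : R -> R) : 0 <= T -> cont 0 T a -> cont 0 T b ->
  (forall t, 0 < t < T -> is_derive t (1 : R) a (- lam * b t)) ->
  (forall t, 0 < t < T -> is_derive t (1 : R) b (lam * a t)) ->
  forall t, 0 <= t <= T ->
    a t = a 0 * cos (lam * t) - b 0 * sin (lam * t) /\
    b t = a 0 * sin (lam * t) + b 0 * cos (lam * t).
Proof.
move=> T0 ca cb Ha Hb t /andP[t0 tT].
have dc s : is_derive s (1 : R) (fun s => cos (lam * s)) (- sin (lam * s) * lam).
  by apply: is_derive_eq; rewrite /GRing.scale /=; ring.
have ds s : is_derive s (1 : R) (fun s => sin (lam * s)) (cos (lam * s) * lam).
  by apply: is_derive_eq; rewrite /GRing.scale /=; ring.
have cc : cont 0 t (fun s => cos (lam * s)) by apply: continuous_cont; exact: continuous_cos_scaled.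
have cs : cont 0 t (fun s => sin (lam * s)) by apply: continuous_cont; exact: continuous_sin_scaled.
have sub f : cont 0 T f -> cont 0 t f.
  by apply: continuous_subspaceW => x /=; rewrite !in_itv /= => /andP[-> xt]; exact: le_trans xt tT.
have {ca cb} [ca cb] := (sub _ ca, sub _ cb).
pose P s := a s * cos (lam * s) + b s * sin (lam * s).
pose Q s := b s * cos (lam * s) - a s * sin (lam * s).
have dP s : s \in `]0, t[ -> is_derive s (1 : R) P 0.
  rewrite in_itv /= => /andP[s0 st].
  have sT : 0 < s < T by rewrite s0 (lt_le_trans st).
  have := Ha s sT; have := Hb s sT => h1 h2.
  by apply: is_derive_eq; rewrite /GRing.scale /=; ring.
have dQ s : s \in `]0, t[ -> is_derive s (1 : R) Q 0.
  rewrite in_itv /= => /andP[s0 st].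
  have sT : 0 < s < T by rewrite s0 (lt_le_trans st).
  have := Ha s sT; have := Hb s sT => h1 h2.
  by apply: is_derive_eq; rewrite /GRing.scale /=; ring.
have cP : cont 0 t P by rewrite /P; cont_tac.
have cQ : cont 0 t Q by rewrite /Q; cont_tac.
have [? _ eP] := MVT_segment t0 dP cP; have [? _ eQ] := MVT_segment t0 dQ cQ.
have {}eP : P t = a 0 by apply/eqP; rewrite -subr_eq0 -[a 0](_ : P 0 = _) ?eP ?mul0r // /P mulr0 cos0 sin0; ring.
have {}eQ : Q t = b 0 by apply/eqP; rewrite -subr_eq0 -[b 0](_ : Q 0 = _) ?eQ ?mul0r // /Q mulr0 cos0 sin0; ring.
rewrite -eP -eQ /P /Q; have := cos2Dsin2 (lam * t).
set c := cos _; set s := sin _ => cs1.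
split.
  transitivity (a t * (c ^+ 2 + s ^+ 2)); first by rewrite cs1 mulr1.
  by ring.
transitivity (b t * (c ^+ 2 + s ^+ 2)); first by rewrite cs1 mulr1.
by ring.
Qed.

End Rotation.

(** * The beam equation *)

Section Beam.
Context {R : realType}.
Variables (l : R) (rho rho1 sigma sigma1 q : R -> R) (rho0 rhoM sigma0 sigmaM qM : R).
Hypotheses (l0 : 0 < l) (rho0_gt0 : 0 < rho0) (sigma0_gt0 : 0 < sigma0)
  (Hrho : prim 0 l rho rho1) (crho1 : cont 0 l rho1)
  (Hsigma : prim 0 l sigma sigma1) (csigma1 : cont 0 l sigma1) (cq : cont 0 l q)
  (rhob : forall x, 0 <= x <= l -> rho0 <= rho x <= rhoM)
  (sigmab : forall x, 0 <= x <= l -> sigma0 <= sigma x <= sigmaM)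
  (qb : forall x, 0 <= x <= l -> 0 <= q x <= qM).

Notation beam := (beam l rho sigma sigma1 q).
Notation "\I f" := (Int 0 l f) (at level 10).

Let crho : cont 0 l rho. Proof. exact: prim_cont Hrho. Qed.
Let csigma : cont 0 l sigma. Proof. exact: prim_cont Hsigma. Qed.
Let lge0 : 0 <= l. Proof. exact: ltW. Qed.
Let in0 : 0 <= (0 : R) <= l. Proof. by rewrite lexx. Qed.
Let inl : 0 <= l <= l. Proof. by rewrite lexx andbT. Qed.

Let rhoM_gt0 : 0 < rhoM.
Proof. by have /andP[h1 h2] := rhob in0; exact: lt_le_trans rho0_gt0 (le_trans h1 h2). Qed.
Let sigmaM_gt0 : 0 < sigmaM.
Proof. by have /andP[h1 h2] := sigmab in0; exact: lt_le_trans sigma0_gt0 (le_trans h1 h2). Qed.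
Let qM_ge0 : 0 <= qM.
Proof. by have /andP[h1 h2] := qb in0; exact: le_trans h1 h2. Qed.

(** One integration by parts turns the integral of [v ^ 2] into minus that of [u k], to which
    Young's inequality applies. *)
Lemma clamped_interp (u v k : R -> R) : W2 l u v k -> clamped l u v ->
  forall e, 0 < e -> 2 * sq 0 l v <= e * sq 0 l u + e^-1 * sq 0 l k.
Proof.
move=> [Hu Hv kL] [u0 v0 ul vl] e e0.
have uL := L2r_cont (prim_cont Hu).
have := prim_by_parts lge0 Hu Hv; rewrite u0 ul v0 vl !mulr0 subr0 sub0r => E.
apply: (le_trans _ (sq_young e0 uL kL)); rewrite ler_pM2l //.
rewrite (_ : sq 0 l v = Int 0 l (fun x => v x * v x)); last by apply: Int_ext => x _; rewrite expr2.
rewrite E; apply: le_trans (Int_abs (L2r_mul uL kL)).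
by rewrite -normrN ler_norm.
Qed.

(** [k1] is given as a density only; its continuity is read off the algebraic relation, divided by
    [sigma]. *)
Lemma beam_cont lam f u v k k1 W : beam lam f u v k k1 W ->
  [/\ cont 0 l u, cont 0 l v, cont 0 l k, cont 0 l k1 & cont 0 l W].
Proof.
move=> [[Hu Hv Hk HW HP] _].
have cu := prim_cont Hu; have cv := prim_cont Hv; have ck := prim_cont Hk.
have cW := prim_cont HW; split => //.
apply: (@cont_ext _ _ _ (fun x => (W x + q x * v x - sigma1 x * k x) * (sigma x)^-1)).
  move=> x xl; rewrite HP // addrC addKr mulrC mulKf // gt_eqF //.
  by have /andP[h _] := sigmab xl; exact: lt_le_trans h.
apply: contM; first by apply: contB; [apply: contD => //|]; exact: contM.
apply: contV => // x xl; rewrite gt_eqF //.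
by have /andP[h _] := sigmab xl; exact: lt_le_trans h.
Qed.

Lemma beam_W2 lam f u v k k1 W : beam lam f u v k k1 W -> W2 l u v k.
Proof. by move=> H; have [[? ? ? ? ?] _] := H; split=> //; apply: L2r_cont; case: (beam_cont H). Qed.

Lemma beamD lam f u v k k1 W f' u' v' k' k1' W' :
  beam lam f u v k k1 W -> beam lam f' u' v' k' k1' W' ->
  beam lam (fun x => f x + f' x) (fun x => u x + u' x) (fun x => v x + v' x)
    (fun x => k x + k' x) (fun x => k1 x + k1' x) (fun x => W x + W' x).
Proof.
move=> [[Hu Hv Hk HW HP] [u0 v0 ul vl]] [[Hu' Hv' Hk' HW' HP'] [u0' v0' ul' vl']].
split; last by split; rewrite ?u0 ?v0 ?ul ?vl ?u0' ?v0' ?ul' ?vl' addr0.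
split; try exact: primD.
- by apply: prim_ext (primD HW HW') => // x _; ring.
- by move=> x xl; have := HP x xl; have := HP' x xl; lra.
Qed.

Lemma beamZ lam c f u v k k1 W : beam lam f u v k k1 W ->
  beam lam (fun x => c * f x) (fun x => c * u x) (fun x => c * v x)
    (fun x => c * k x) (fun x => c * k1 x) (fun x => c * W x).
Proof.
move=> [[Hu Hv Hk HW HP] [u0 v0 ul vl]].
split; last by split; rewrite ?u0 ?v0 ?ul ?vl mulr0.
split; try exact: primZ.
- by apply: prim_ext (primZ c HW) => // x _; ring.
- move=> x xl; transitivity (c * (W x + q x * v x)); first by ring.
  by rewrite HP //; ring.
Qed.

(** A change of eigenvalue becomes a source term, so that two eigenfunctions can be subtracted
    within one system. *)
Lemma beam_shift lam lam' f u v k k1 W : beam lam f u v k k1 W ->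
  beam lam' (fun x => (lam - lam') * u x + f x) u v k k1 W.
Proof.
move=> [[Hu Hv Hk HW HP] Hc]; split=> //; split=> //.
by apply: prim_ext HW => // x _; ring.
Qed.

Lemma beam_ext lam f g u v k k1 W : (forall x, f x = g x) ->
  beam lam f u v k k1 W -> beam lam g u v k k1 W.
Proof. by move=> /funext <-. Qed.

(** The symmetric weak form. The second integration by parts bears on [W], which avoids
    differentiating [q]. *)
Lemma beam_form lam u v k k1 W w w1 w2 : beam lam (fun=> 0) u v k k1 W ->
  W2 l w w1 w2 -> clamped l w w1 ->
  \I (fun x => sigma x * k x * w2 x + q x * v x * w1 x) = lam * \I (fun x => rho x * u x * w x).
Proof.
move=> HB [Hw Hw1 w2L] [w0 w10 wl w1l]; have [cu cv ck ck1 cW] := beam_cont HB.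
have [[Hu Hv Hk HW HP] _] := HB.
have cw := prim_cont Hw; have cw1 := prim_cont Hw1.
have E1 := prim_by_parts lge0 Hw1 (prim_mul Hsigma Hk).
have E2 := prim_by_parts lge0 Hw HW.
rewrite w10 w1l !mul0r subr0 sub0r in E1; rewrite w0 wl !mul0r subr0 sub0r in E2.
have i1 : itg 0 l (fun x => sigma x * k x * w2 x).
  by apply: itg_cmul; [exact: contM|exact: L2r_itg].
have i2 : itg 0 l (fun x => q x * v x * w1 x) by apply: cont_itg; apply: contM => //; exact: contM.
have i3 : itg 0 l (fun x => w1 x * W x) by apply: cont_itg; exact: contM.
have i4 : itg 0 l (fun x => rho x * u x * w x) by apply: cont_itg; apply: contM => //; exact: contM.
rewrite IntD //.
have -> : \I (fun x => sigma x * k x * w2 x) = - (\I (fun x => w1 x * W x) + \I (fun x => q x * v x * w1 x)).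
  rewrite (@Int_ext _ _ _ _ (fun x => w2 x * (sigma x * k x))) => [|x _]; last by rewrite mulrC.
  rewrite E1 -IntD //; congr (- _); apply: Int_ext => x xl.
  by rewrite -HP //; ring.
rewrite opprD subrK E2 opprK -IntZ //; apply: Int_ext => x _; ring.
Qed.

(** The integral of the derivative of [m E - 2 m1 sigma k v], where
    [E = 2 W v - sigma k ^ 2 - lam rho u ^ 2] is conserved when [rho] and [sigma] are constant and
    [q] and [f] vanish. At clamped ends only [k] survives. *)
Lemma multiplier_identity m m1 m2 lam f u v k k1 W :
  prim 0 l m m1 -> prim 0 l m1 m2 -> beam lam f u v k k1 W ->
  m 0 * sigma 0 * k 0 ^+ 2 - m l * sigma l * k l ^+ 2 =
  \I (fun x => - 2 * m2 x * sigma x * k x * v x - 3 * m1 x * sigma x * k x ^+ 2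
     - 2 * m1 x * q x * v x ^+ 2 - lam * (m1 x * rho x * u x ^+ 2)
     + m x * (2 * rho x * f x * v x - 2 * q x * v x * k x + sigma1 x * k x ^+ 2
              - lam * (rho1 x * u x ^+ 2))).
Proof.
move=> Hm Hm1 [[Hu Hv Hk HW HP] [u0 v0 ul vl]].
have HM := prim_mul Hsigma Hk.
have HE := primB (primB (primZ 2 (prim_mul HW Hv)) (prim_mul HM Hk))
  (primZ lam (prim_mul Hrho (prim_sqr Hu))).
have HG := primB (prim_mul Hm HE) (primZ 2 (prim_mul Hm1 (prim_mul HM Hv))).
have := prim_Int HG lge0; rewrite u0 v0 ul vl => E.
transitivity (Int 0 l (fun x =>
  m1 x * (2 * (W x * v x) - sigma x * k x * k x - lam * (rho x * u x ^+ 2))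
  + m x * (2 * (rho x * (lam * u x + f x) * v x + W x * k x)
           - ((sigma1 x * k x + sigma x * k1 x) * k x + sigma x * k x * k1 x)
           - lam * (rho1 x * u x ^+ 2 + rho x * (2 * u x * v x)))
  - 2 * (m2 x * (sigma x * k x * v x)
         + m1 x * ((sigma1 x * k x + sigma x * k1 x) * v x + sigma x * k x * k x)))).
  by rewrite E; ring.
apply: Int_ext => x xl; have -> : W x = sigma1 x * k x + sigma x * k1 x - q x * v x.
  by rewrite -HP // addrK.
by ring.
Qed.

Lemma prim_expR (K : R) : prim 0 l (fun x => expR (K * x)) (fun x => K * expR (K * x)).
Proof.
have c1 : continuous (fun x : R => expR (K * x)).
  move=> x; apply: continuous_comp; last exact: continuous_expR.
  exact: mulrl_continuous.
apply: prim_classic.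
  move=> x; apply: is_derive_eq; rewrite /GRing.scale /=; ring.
by move=> x; apply: cvgM; [exact: cvg_cst|exact: c1].
Qed.

(* The multiplier [m = exp (K x)] with [K] large makes the bulk terms of
   [multiplier_identity] coercive whatever the variations of [rho] and [sigma]. *)
Lemma beam_observability : exists C s0, [/\ 0 < C, 1 <= s0 &
  forall s lam f u v k k1 W, s0 <= s -> lam = s ^+ 4 -> cont 0 l f ->
    beam lam f u v k k1 W ->
    lam * sq 0 l u + sq 0 l k <= C * (k l ^+ 2 + sq 0 l f / s ^+ 2)].
Proof.
have [R1 R1p HR1] := cont_bounded crho1.
have [S1 S1p HS1] := cont_bounded csigma1.
(* Chosen so that [K * rho + rho1] and [3 * K * sigma - sigma1] are at least 1. *)
pose K := 1 + (S1 + 1) / sigma0 + (R1 + 1) / rho0.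
have K1 : 1 <= K by rewrite /K -addrA lerDl addr_ge0 // divr_ge0 ?addr_ge0 // ltW.
have K0 : 0 < K by exact: lt_le_trans K1.
have KS : S1 + 1 <= K * sigma0.
  rewrite -ler_pdivrMr // /K; set A := (S1 + 1) / _; set B := (R1 + 1) / _.
  have : 0 <= B by rewrite divr_ge0 ?addr_ge0 // ltW.
  by lra.
have KR : R1 + 1 <= K * rho0.
  rewrite -ler_pdivrMr // /K; set A := (S1 + 1) / _; set B := (R1 + 1) / _.
  have : 0 <= A by rewrite divr_ge0 ?addr_ge0 // ltW.
  by lra.
pose M := expR (K * l).
have M1 : 1 <= M by rewrite -expR0 ler_expR mulr_ge0 // ltW.
have M0 : 0 < M by exact: lt_le_trans M1.
(* Bounds on the coefficients of the cross terms [f v] and [v k]; the latter collects [2 m q] and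
   [2 m2 sigma], with [m2 = K ^ 2 m]. *)
pose A1 := 2 * M * rhoM; pose A2 := 2 * M * (qM + K ^+ 2 * sigmaM).
have A10 : 0 < A1 by rewrite /A1 !mulr_gt0.
have A20 : 0 < A2 by rewrite /A2 mulr_gt0 // ?mulr_gt0 // ltr_wpDl // mulr_gt0 // exprn_gt0.
(* From [s0] on, the term in [v k] costs at most a quarter of the energy [X], and the term in [f v]
   another quarter besides the source. Absorbing both doubles what remains, hence [2 * M * sigmaM]
   and [A1 ^ 2]. *)
pose C := 2 * M * sigmaM + A1 ^+ 2 + 1; pose s0 := 4 * A2 + 1.
have C0 : 0 < C by rewrite /C ltr_wpDl // addr_ge0 ?sqr_ge0 // !mulr_ge0 // ltW.
exists C, s0; split => //; first by rewrite /s0 lerDr mulr_ge0 // ltW.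
move=> s lam f u v k k1 W ss lamE cf HB.
have s1 : 1 <= s by apply: le_trans ss; rewrite /s0 lerDr mulr_ge0 // ltW.
have sp : 0 < s by exact: lt_le_trans s1.
have lam0 : 0 <= lam by rewrite lamE exprn_ge0 // ltW.
have [cu cv ck ck1 cW] := beam_cont HB.
have uL := L2r_cont cu; have vL := L2r_cont cv; have kL := L2r_cont ck; have fL := L2r_cont cf.
have ifv := itg_abs (L2r_mul fL vL); have ivk := itg_abs (L2r_mul vL kL).
have HW2 := beam_W2 HB.
have Hm := prim_expR K; have Hm1 := primZ K Hm.
have := multiplier_identity Hm Hm1 HB; set H := (X in Int 0 l X) => E.
have pt x : 0 <= x <= l -> H x <=
   (A1 * `|f x * v x| + A2 * `|v x * k x|) - (lam * u x ^+ 2 + k x ^+ 2).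
  move=> xl; have /andP[x0 xl'] := xl.
  have /andP[r0 rM] := rhob xl; have /andP[g0 gM] := sigmab xl; have /andP[p0 pM] := qb xl.
  have := HR1 x xl; rewrite ler_norml => /andP[r1l _].
  have := HS1 x xl; rewrite ler_norml => /andP[_ s1u].
  rewrite /H; set m := expR (K * x).
  have m1 : 1 <= m by rewrite -expR0 ler_expR mulr_ge0 // ltW.
  have mM : m <= M by rewrite ler_expR ler_pM2l.
  have m0 : 0 < m by exact: lt_le_trans m1.
  have mge0 := ltW m0; have Kge0 := ltW K0.
  have rx0 : 0 <= rho x by exact: le_trans (ltW rho0_gt0) r0.
  have sx0 : 0 <= sigma x by exact: le_trans (ltW sigma0_gt0) g0.
  have -> : - 2 * (K * (K * m)) * sigma x * k x * v x - 3 * (K * m) * sigma x * k x ^+ 2 -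
     2 * (K * m) * q x * v x ^+ 2 - lam * (K * m * rho x * u x ^+ 2) +
     m * (2 * rho x * f x * v x - 2 * q x * v x * k x + sigma1 x * k x ^+ 2 -
       lam * (rho1 x * u x ^+ 2)) =
    (2 * m * rho x * (f x * v x) - 2 * m * (q x + K ^+ 2 * sigma x) * (v x * k x))
    - (lam * (m * (K * rho x + rho1 x) * u x ^+ 2) + m * (3 * K * sigma x - sigma1 x) * k x ^+ 2)
    - 2 * K * m * q x * v x ^+ 2 by ring.
  have a1 : 2 * m * rho x * (f x * v x) <= A1 * `|f x * v x|.
    apply: (@le_trans _ _ (2 * m * rho x * `|f x * v x|)).
      by rewrite ler_wpM2l ?ler_norm // !mulr_ge0.
    rewrite /A1 ler_wpM2r //; apply: ler_pM => //; last by rewrite ler_pM2l.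
    by rewrite mulr_ge0.
  have a2 : - (2 * m * (q x + K ^+ 2 * sigma x) * (v x * k x)) <= A2 * `|v x * k x|.
    have c0 : 0 <= q x + K ^+ 2 * sigma x by rewrite addr_ge0 // mulr_ge0 ?sqr_ge0.
    apply: (@le_trans _ _ (2 * m * (q x + K ^+ 2 * sigma x) * `|v x * k x|)).
      by rewrite -mulrN ler_wpM2l ?mulr_ge0 // -normrN ler_norm.
    rewrite /A2 ler_wpM2r //; apply: ler_pM => //; last by rewrite lerD // ler_wpM2l ?sqr_ge0.
      by rewrite mulr_ge0.
    by rewrite ler_pM2l.
  have a3 : u x ^+ 2 <= m * (K * rho x + rho1 x) * u x ^+ 2.
    rewrite -[leLHS]mul1r ler_wpM2r ?sqr_ge0 // -[1]mulr1 ler_pM //.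
    have : K * rho0 <= K * rho x by rewrite ler_pM2l.
    by lra.
  have a3' : lam * u x ^+ 2 <= lam * (m * (K * rho x + rho1 x) * u x ^+ 2).
    by rewrite ler_wpM2l.
  have a4 : k x ^+ 2 <= m * (3 * K * sigma x - sigma1 x) * k x ^+ 2.
    rewrite -[leLHS]mul1r ler_wpM2r ?sqr_ge0 // -[1]mulr1 ler_pM //.
    have : K * sigma0 <= K * sigma x by rewrite ler_pM2l.
    have : 0 <= K * sigma x by rewrite mulr_ge0.
    by lra.
  have a5 : 0 <= 2 * K * m * q x * v x ^+ 2.
    by rewrite mulr_ge0 ?sqr_ge0 // !mulr_ge0.
  by lra.
have iA : itg 0 l (fun x => A1 * `|f x * v x| + A2 * `|v x * k x|).
  by apply: itgD; exact: itgZ.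
have iB : itg 0 l (fun x => lam * u x ^+ 2 + k x ^+ 2).
  by apply: itgD; [apply: itgZ; exact: uL.2|exact: kL.2].
have iH : itg 0 l H.
  have cm := prim_cont Hm; have cm1 := prim_cont Hm1.
  by apply: cont_itg; rewrite /H; cont_tac.
have := Int_le iH (itgB iA iB) pt; rewrite -E IntB // IntD ?IntZ //; try exact: itgZ.
rewrite IntD; [|apply: itgZ; exact: uL.2|exact: kL.2].
rewrite IntZ; last exact: uL.2.
rewrite -/(sq 0 l u) -/(sq 0 l k) mulr0 expR0 mul1r -/M.
set X := lam * sq 0 l u + sq 0 l k; set I1 := Int 0 l _; set I2 := Int 0 l _ => main.
have X0 : 0 <= X by rewrite addr_ge0 ?mulr_ge0 ?sq_ge0.
have k00 : 0 <= sigma 0 * k 0 ^+ 2.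
  have /andP[g0 _] := sigmab in0; rewrite mulr_ge0 ?sqr_ge0 //; exact: le_trans (ltW sigma0_gt0) g0.
have kll : M * sigma l * k l ^+ 2 <= M * sigmaM * k l ^+ 2.
  by have /andP[_ gM] := sigmab inl; rewrite ler_wpM2r ?sqr_ge0 // ler_pM2l.
have s2p : 0 < s ^+ 2 by rewrite exprn_gt0.
(* Interpolation with parameter [s ^ 2]: this is why [lam] is written [s ^ 4]. *)
have N1 : 2 * s ^+ 2 * sq 0 l v <= X.
  have h := clamped_interp HW2 HB.2 s2p; rewrite -(ler_pM2l s2p) in h; move: h.
  have -> : s ^+ 2 * (s ^+ 2 * sq 0 l u + (s ^+ 2)^-1 * sq 0 l k) = X.
    by rewrite /X lamE; field; rewrite gt_eqF.
  by have -> : s ^+ 2 * (2 * sq 0 l v) = 2 * s ^+ 2 * sq 0 l v by ring.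
(* Young's inequality with weight [A1 / s ^ 2]: the factor [s ^ 2] available on [v] is what divides
   the source by [s ^ 2]. *)
have bI1 : A1 * I1 <= X / 4 + A1 ^+ 2 / 2 * (sq 0 l f / s ^+ 2).
  have e0 : 0 < A1 / s ^+ 2 by rewrite divr_gt0.
  have h := sq_young e0 fL vL; rewrite -/I1 invf_div in h.
  have A2p : 0 < A1 / 2 by rewrite divr_gt0.
  rewrite -(ler_pM2l A2p) mulrDr in h; move: h.
  have -> : A1 / 2 * (s ^+ 2 / A1 * sq 0 l v) = (2 * s ^+ 2 * sq 0 l v) / 4.
    by field; rewrite gt_eqF.
  have -> : A1 / 2 * (A1 / s ^+ 2 * sq 0 l f) = A1 ^+ 2 / 2 * (sq 0 l f / s ^+ 2).
    by field; rewrite gt_eqF.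
  by lra.
have bI2 : A2 * I2 <= X / 4.
  have := sq_young sp vL kL; rewrite -/I2 => y2.
  have y3 : 2 * I2 <= 2 * X / s.
    rewrite ler_pdivlMr //; rewrite -(ler_pM2r sp) in y2; move: y2.
    have -> : (s * sq 0 l v + s^-1 * sq 0 l k) * s = s ^+ 2 * sq 0 l v + sq 0 l k.
      by field; rewrite gt_eqF.
    have : sq 0 l k <= X by rewrite /X lerDr mulr_ge0 ?sq_ge0.
    by lra.
  have : 4 * A2 <= s by rewrite /s0 in ss; lra.
  move: y3; rewrite ler_pdivlMr // => y3 sA.
  rewrite -(ler_pM2r sp).
  have : A2 * (2 * I2 * s) <= A2 * (2 * X) by rewrite ler_pM2l.
  have : 4 * A2 * X <= s * X by rewrite ler_wpM2r.
  by lra.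
have Fs : 0 <= sq 0 l f / s ^+ 2 by rewrite divr_ge0 ?sq_ge0 ?sqr_ge0.
have : X <= 2 * M * sigmaM * k l ^+ 2 + A1 ^+ 2 * (sq 0 l f / s ^+ 2) by lra.
move/le_trans; apply; rewrite mulrDr; apply: lerD; rewrite /C.
  by rewrite ler_wpM2r ?sqr_ge0 // -addrA lerDl addr_ge0 // sqr_ge0.
rewrite ler_wpM2r // addrAC lerDr addr_ge0 // !mulr_ge0 // ltW //.
Qed.

Definition ip (u w : R -> R) : R := \I (fun x => rho x * u x * w x).

Lemma ip_itg u w : cont 0 l u -> cont 0 l w -> itg 0 l (fun x => rho x * u x * w x).
Proof. by move=> cu cw; apply: cont_itg; cont_tac. Qed.

Lemma ip_lower u : cont 0 l u -> rho0 * sq 0 l u <= ip u u.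
Proof.
move=> cu; rewrite -IntZ; last by apply: cont_itg; cont_tac.
apply: Int_le; [by apply: cont_itg; cont_tac|exact: ip_itg|].
by move=> x xl; rewrite -mulrA -expr2 ler_wpM2r ?sqr_ge0 //; case/andP: (rhob xl).
Qed.

Lemma ip_upper u : cont 0 l u -> ip u u <= rhoM * sq 0 l u.
Proof.
move=> cu; rewrite -IntZ; last by apply: cont_itg; cont_tac.
apply: Int_le; [exact: ip_itg|by apply: cont_itg; cont_tac|].
by move=> x xl; rewrite -mulrA -expr2 ler_wpM2r ?sqr_ge0 //; case/andP: (rhob xl).
Qed.

Lemma beam_trace_upper : exists2 C, 0 < C & forall lam u v k k1 W, 0 <= lam ->
  beam lam (fun=> 0) u v k k1 W -> k l ^+ 2 <= C * (lam * sq 0 l u + sq 0 l k).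
Proof.
have [R1 R1p HR1] := cont_bounded crho1.
have [S1 S1p HS1] := cont_bounded csigma1.
(* Dominates the coefficients of the integrand for the multiplier [x]. In the final constant,
   [1 + l ^ 2] pays for [v], which is dominated by [k] through the Poincare inequality. *)
pose A := 3 * sigmaM + 2 * qM + rhoM + l * (qM + S1 + R1).
have A0 : 0 < A.
  rewrite /A ltr_wpDr //; first by rewrite mulr_ge0 // !addr_ge0 // ltW.
  by rewrite ltr_wpDl // addr_ge0 // mulr_ge0 // ltW.
have C0 : 0 < A * (1 + l ^+ 2) / (l * sigma0).
  by rewrite divr_gt0 // !mulr_gt0 // ltr_wpDr // sqr_ge0.
exists (A * (1 + l ^+ 2) / (l * sigma0)) => // lam u v k k1 W lam0 HB.
have [cu cv ck ck1 cW] := beam_cont HB.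
have cf : cont 0 l (fun=> 0 : R) by exact: cont_cst.
have cid : cont 0 l (fun x : R => x) by exact: prim_cont (prim_id 0 l).
have := multiplier_identity (prim_id 0 l) (prim_cst 0 l 1) HB.
set H := (X in Int 0 l X) => E.
have cH : cont 0 l H by rewrite /H; cont_tac.
have iR : itg 0 l (fun x => A * (lam * u x ^+ 2 + k x ^+ 2 + v x ^+ 2)) by apply: cont_itg; cont_tac.
have pt x : 0 <= x <= l -> - H x <= A * (lam * u x ^+ 2 + k x ^+ 2 + v x ^+ 2).
  move=> xl; have /andP[x0 xl'] := xl.
  have /andP[r0 rM] := rhob xl; have /andP[g0 gM] := sigmab xl; have /andP[p0 pM] := qb xl.
  have := HR1 x xl; rewrite ler_norml => /andP[_ r1u].
  have := HS1 x xl; rewrite ler_norml => /andP[s1l _].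
  have -> : - H x = 3 * (sigma x * k x ^+ 2) + 2 * (q x * v x ^+ 2) + rho x * (lam * u x ^+ 2)
     + x * (q x * (2 * (v x * k x)) + - sigma1 x * k x ^+ 2 + rho1 x * (lam * u x ^+ 2)).
    by rewrite /H; ring.
  set U := lam * u x ^+ 2; set V := v x ^+ 2; set Kk := k x ^+ 2.
  have U0 : 0 <= U by rewrite mulr_ge0 ?sqr_ge0.
  have V0 : 0 <= V by rewrite sqr_ge0.
  have K0 : 0 <= Kk by rewrite sqr_ge0.
  have h1 : sigma x * Kk <= sigmaM * Kk by rewrite ler_wpM2r.
  have h2 : q x * V <= qM * V by rewrite ler_wpM2r.
  have h3 : rho x * U <= rhoM * U by rewrite ler_wpM2r.
  have h4 : q x * (2 * (v x * k x)) <= qM * (V + Kk).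
    apply: (@le_trans _ _ (q x * (V + Kk))); last by rewrite ler_wpM2r // addr_ge0.
    by rewrite ler_wpM2l //; have := sqr_ge0 (v x - k x); rewrite /V /Kk; lra.
  have h5 : - sigma1 x * Kk <= S1 * Kk by rewrite ler_wpM2r //; lra.
  have h6 : rho1 x * U <= R1 * U by rewrite ler_wpM2r.
  have h7 : x * (q x * (2 * (v x * k x)) + - sigma1 x * Kk + rho1 x * U) <=
      l * ((qM + S1 + R1) * (U + Kk + V)).
    apply: (@le_trans _ _ (x * ((qM + S1 + R1) * (U + Kk + V)))); last first.
      by rewrite ler_wpM2r // mulr_ge0 ?addr_ge0 // ltW.
    rewrite ler_wpM2l //.
    have : 0 <= qM * U by rewrite mulr_ge0.
    have : 0 <= S1 * U by rewrite mulr_ge0 // ltW.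
    have : 0 <= S1 * V by rewrite mulr_ge0 // ltW.
    have : 0 <= R1 * V by rewrite mulr_ge0 // ltW.
    have : 0 <= R1 * Kk by rewrite mulr_ge0 // ltW.
    by lra.
  have : 0 <= sigmaM * U by rewrite mulr_ge0 // ltW.
  have : 0 <= sigmaM * V by rewrite mulr_ge0 // ltW.
  have : 0 <= qM * U by rewrite mulr_ge0.
  have : 0 <= qM * Kk by rewrite mulr_ge0.
  have : 0 <= rhoM * V by rewrite mulr_ge0 // ltW.
  have : 0 <= rhoM * Kk by rewrite mulr_ge0 // ltW.
  by rewrite /A; lra.
have iH := cont_itg cH.
have := Int_le (itgN iH) iR pt; rewrite IntN // -E IntZ; last by apply: cont_itg; cont_tac.
have -> : Int 0 l (fun x => lam * u x ^+ 2 + k x ^+ 2 + v x ^+ 2) =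
   lam * sq 0 l u + sq 0 l k + sq 0 l v.
  rewrite IntD ?IntD ?IntZ //; by apply: cont_itg; cont_tac.
have [Hu Hv kL] := beam_W2 HB; have [u0 v0 ul vl] := HB.2.
have := poincare_sq l0 Hv kL v0; set N0 := lam * _; set N1 := sq 0 l v; set N2 := sq 0 l k => pv.
rewrite !mul0r sub0r opprK => main.
have : l * sigma0 * k l ^+ 2 <= l * sigma l * k l ^+ 2.
  by rewrite ler_wpM2r ?sqr_ge0 // ler_pM2l //; case/andP: (sigmab inl).
move=> main2; have {}main := le_trans main2 main.
rewrite [leRHS]mulrAC ler_pdivlMr ?mulr_gt0 // mulrC; apply: (le_trans main).
rewrite -mulrA ler_pM2l //.
have : 0 <= l ^+ 2 * N0 by rewrite mulr_ge0 ?sqr_ge0 // mulr_ge0 // sq_ge0.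
by lra.
Qed.

Lemma beam_energy lam u v k k1 W : beam lam (fun=> 0) u v k k1 W ->
  sigma0 * sq 0 l k <= lam * ip u u.
Proof.
move=> HB; have [cu cv ck ck1 cW] := beam_cont HB.
rewrite /ip -(beam_form HB (beam_W2 HB) HB.2) -IntZ; last by apply: cont_itg; cont_tac.
apply: Int_le; [by apply: cont_itg; cont_tac|by apply: cont_itg; cont_tac|].
move=> x xl; have /andP[g0 _] := sigmab xl; have /andP[p0 _] := qb xl.
rewrite -mulrA -expr2 -(mulrA (q x)) -expr2.
have : sigma0 * k x ^+ 2 <= sigma x * k x ^+ 2 by rewrite ler_wpM2r ?sqr_ge0.
have : 0 <= q x * v x ^+ 2 by rewrite mulr_ge0 ?sqr_ge0.
by lra.
Qed.

(** The Poincare inequality, applied twice, against [beam_energy]. No sign is assumed of [lam]: the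
    positivity of eigenvalues comes from here. *)
Lemma beam_eigenvalue_lower lam u v k k1 W : beam lam (fun=> 0) u v k k1 W ->
  0 < ip u u -> sigma0 / (l ^+ 4 * rhoM) <= lam.
Proof.
move=> HB u0; have [cu cv ck ck1 cW] := beam_cont HB.
have [Hu Hv kL] := beam_W2 HB; have [u00 v0 _ _] := HB.2.
have h1 := poincare_sq l0 Hv kL v0; have h2 := poincare_sq l0 Hu (L2r_cont cv) u00.
have h3 := beam_energy HB; have h4 := ip_upper cu.
rewrite ler_pdivrMr ?mulr_gt0 ?exprn_gt0 // -(ler_pM2r u0).
apply: (@le_trans _ _ (sigma0 * (rhoM * (l ^+ 2 * (l ^+ 2 * sq 0 l k))))).
  rewrite ler_pM2l //; apply: (le_trans h4); rewrite ler_pM2l //.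
  by apply: (le_trans h2); rewrite ler_wpM2l ?sqr_ge0.
have -> : sigma0 * (rhoM * (l ^+ 2 * (l ^+ 2 * sq 0 l k))) = (l ^+ 4 * rhoM) * (sigma0 * sq 0 l k).
  by ring.
have -> : lam * (l ^+ 4 * rhoM) * ip u u = (l ^+ 4 * rhoM) * (lam * ip u u) by ring.
by rewrite ler_pM2l // mulr_gt0 // exprn_gt0.
Qed.

Lemma ipC u w : ip u w = ip w u.
Proof. by apply: Int_ext => x _; ring. Qed.

Lemma beam_orthogonal lam lam' u v k k1 W u' v' k' k1' W' : lam != lam' ->
  beam lam (fun=> 0) u v k k1 W -> beam lam' (fun=> 0) u' v' k' k1' W' -> ip u u' = 0.
Proof.
move=> ne HB HB'.
have E1 := beam_form HB (beam_W2 HB') HB'.2; have E2 := beam_form HB' (beam_W2 HB) HB.2.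
have : lam * ip u u' = lam' * ip u u'.
  by rewrite {2}ipC /ip -E1 -E2; apply: Int_ext => x _; ring.
by move/eqP; rewrite -subr_eq0 -mulrBl mulf_eq0 subr_eq0 (negbTE ne) /= => /eqP.
Qed.

(* Leighton-Nehari: going left from [l], the system for [u], [- u'], [sigma u''] and
   [- W] is cooperative, hence preserves nonnegativity; Gronwall on the negative parts. *)
Lemma beam_nonneg lam u v k k1 W : 0 <= lam -> beam lam (fun=> 0) u v k k1 W ->
  k l = 0 -> W l <= 0 -> forall x, 0 <= x <= l -> 0 <= u x /\ v x <= 0.
Proof.
move=> lam0 HB kl Wl; have [cu cv ck ck1 cW] := beam_cont HB.
have [[Hu Hv Hk HW HP] [u0 v0 ul vl]] := HB.
pose n1 x := Num.min (u x) 0; pose n2 x := Num.min (- v x) 0.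
pose n3 x := Num.min (sigma x * k x) 0; pose n4 x := Num.min (- W x) 0.
have P1 := prim_min2 Hu; have P2 := prim_min2 (primN Hv).
have P3 := prim_min2 (prim_mul Hsigma Hk); have P4 := prim_min2 (primN HW).
have PP := primD (primD P1 P2) (primD P3 P4).
(* Twice the sum of the bounds on the entries of the system. The derivative of the sum of squared
   negative parts is at least [- C] times that sum, so its product with [exp (C x)] is
   nondecreasing; it vanishes at [l]. *)
pose C := 2 * (1 + sigma0^-1 + qM + lam * rhoM).
have PC := prim_mul (prim_expR C) PP.
have key x : 0 <= x <= l -> n1 x ^+ 2 + n2 x ^+ 2 + (n3 x ^+ 2 + n4 x ^+ 2) <= 0.
  move=> /andP[x0 xl]; have PCx := prim_sub x0 (lexx l) PC.
  have := prim_le xl PCx; rewrite ul vl kl mulr0 !oppr0.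
  have -> : Num.min (- W l) 0 = 0 by apply/min_idPr; rewrite oppr_ge0.
  rewrite !minxx !expr0n /= !addr0 mulr0 => main.
  rewrite -(pmulr_rle0 _ (expR_gt0 (C * x))); apply: main => y /andP[xy yl].
  have yl' : 0 <= y <= l by rewrite (le_trans x0 xy).
  have Pe : sigma1 y * k y + sigma y * k1 y = W y + q y * v y by rewrite HP.
  rewrite Pe addr0.
  have /andP[r0 rM] := rhob yl'; have /andP[g0 gM] := sigmab yl'; have /andP[p0 pM] := qb yl'.
  have gp : 0 < sigma y by exact: lt_le_trans g0.
  have gi : 0 < (sigma y)^-1 <= sigma0^-1 by rewrite invr_gt0 gp lef_pV2.
  have rx0 : 0 <= rho y by exact: le_trans (ltW rho0_gt0) r0.
  rewrite -(pmulr_rge0 _ (expR_gt0 (- (C * y)))).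
  set e := expR (C * y).
  have ee : expR (- (C * y)) * e = 1 by rewrite expRN mulVf // gt_eqF // expR_gt0.
  set Q := n1 y ^+ 2 + n2 y ^+ 2 + (n3 y ^+ 2 + n4 y ^+ 2).
  rewrite [X in 0 <= X](_ : _ = C * Q + (2 * n1 y * v y + 2 * n2 y * (- k y)
     + (2 * n3 y * (W y + q y * v y) + 2 * n4 y * (- (rho y * (lam * u y)))))); last first.
    rewrite -[RHS]mul1r -ee /Q /n1 /n2 /n3 /n4 /e; ring.
  have neg (a : R) : Num.min a 0 <= 0 /\ Num.min a 0 <= a by rewrite !ge_min !lexx orbT.
  (* Coupling, through a nonnegative entry [A], of a negative part [a] with a variable [c] whose
     negative part is [b]: replacing [c] by [b] can only increase [a * c]. *)
  have coop (a b c B : R) : a <= 0 -> b <= 0 -> b <= c -> 0 <= B -> forall A, 0 <= A <= B ->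
      - (B * (a ^+ 2 + b ^+ 2)) <= - 2 * (A * (a * c)).
    move=> a0 b0 bc B0 A /andP[A0 AB].
    have h1 : a * c <= a * b by rewrite ler_wnM2l.
    have h2 : 2 * (a * b) <= a ^+ 2 + b ^+ 2 by have := sqr_ge0 (a - b); lra.
    have h3 : A * (2 * (a * c)) <= A * (a ^+ 2 + b ^+ 2).
      by rewrite ler_wpM2l //; lra.
    have h4 : A * (a ^+ 2 + b ^+ 2) <= B * (a ^+ 2 + b ^+ 2).
      by rewrite ler_wpM2r // addr_ge0 // sqr_ge0.
    by lra.
  have [a1 b1] := neg (u y); have [a2 b2] := neg (- v y).
  have [a3 b3] := neg (sigma y * k y); have [a4 b4] := neg (- W y).
  rewrite -/(n1 y) in a1 b1; rewrite -/(n2 y) in a2 b2.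
  rewrite -/(n3 y) in a3 b3; rewrite -/(n4 y) in a4 b4.
  have s0i : 0 <= sigma0^-1 by rewrite invr_ge0 ltW.
  have lr0 : 0 <= lam * rhoM by rewrite mulr_ge0 // ltW.
  have le11 : ((0 : R) <= 1) && ((1 : R) <= 1) by rewrite ler01 lexx.
  have le2 : 0 <= (sigma y)^-1 <= sigma0^-1 by case/andP: gi => /ltW -> ->.
  have le5 : 0 <= lam * rho y <= lam * rhoM by rewrite mulr_ge0 // ler_wpM2l.
  (* One bound for each nonzero entry: [1], [1 / sigma], [1], [q] and [lam * rho], in this order. *)
  have c1 := coop _ _ _ _ a1 a2 b2 ler01 _ le11.
  have c2 := coop _ _ _ _ a2 a3 b3 s0i _ le2.
  have c3 := coop _ _ _ _ a3 a4 b4 ler01 _ le11.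
  have c4 := coop _ _ _ _ a3 a2 b2 qM_ge0 _ (qb yl').
  have c5 := coop _ _ _ _ a4 a1 b1 lr0 _ le5.
  have ke : (sigma y)^-1 * (n2 y * (sigma y * k y)) = n2 y * k y by field; rewrite gt_eqF.
  rewrite ke in c2; rewrite /C /Q.
  have sq4 : [/\ 0 <= n1 y ^+ 2, 0 <= n2 y ^+ 2, 0 <= n3 y ^+ 2 & 0 <= n4 y ^+ 2].
    by split; exact: sqr_ge0.
  move: sq4 c1 c2 c3 c4 c5.
  set b1' := n1 y ^+ 2; set b2' := n2 y ^+ 2; set b3' := n3 y ^+ 2; set b4' := n4 y ^+ 2.
  move=> [q1 q2 q3 q4] c1 c2 c3 c4 c5.
  have t B : 0 <= B -> [/\ 0 <= B * b1', 0 <= B * b2', 0 <= B * b3' & 0 <= B * b4'].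
    by move=> B0; split; exact: mulr_ge0.
  have [t1 t2 t3 t4] := t _ s0i; have [t5 t6 t7 t8] := t _ qM_ge0; have [t9 t10 t11 t12] := t _ lr0.
  by lra.
move=> x xl; have := key x xl.
have h1 := sqr_ge0 (n1 x); have h2 := sqr_ge0 (n2 x).
have h3 := sqr_ge0 (n3 x); have h4 := sqr_ge0 (n4 x) => h5.
have e1 : n1 x ^+ 2 = 0 by lra.
have e2 : n2 x ^+ 2 = 0 by lra.
move/eqP: e1; rewrite sqrf_eq0 => /eqP e1; move/eqP: e2; rewrite sqrf_eq0 => /eqP e2.
split; first by rewrite -e1 /n1 ge_min lexx.
by rewrite -oppr_ge0 -e2 /n2 ge_min lexx.
Qed.

(** Up to a change of sign [W l <= 0], so that [u] is nonnegative and nonincreasing; it starts from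
    [u 0 = 0]. *)
Lemma beam_unique lam u v k k1 W : 0 <= lam -> beam lam (fun=> 0) u v k k1 W ->
  k l = 0 -> forall x, 0 <= x <= l -> u x = 0.
Proof.
have main u' v' k' k1' W' : 0 <= lam -> beam lam (fun=> 0) u' v' k' k1' W' ->
    k' l = 0 -> W' l <= 0 -> forall x, 0 <= x <= l -> u' x = 0.
  move=> lam0 HB kl Wl x xl; have H := beam_nonneg lam0 HB kl Wl.
  have [ux _] := H x xl; apply/eqP; rewrite eq_le ux andbT.
  have [[Hu _ _ _ _] [u0 _ _ _]] := HB; have /andP[x0 xl'] := xl.
  have Hn := primN (prim_sub (lexx 0) xl' Hu).
  have := prim_le x0 Hn; rewrite u0 oppr0 oppr_ge0; apply => y /andP[y0 yx].
  by rewrite oppr_ge0; case: (H y _) => //; rewrite y0 (le_trans yx xl').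
move=> lam0 HB kl x xl; have [Wl|Wl] := leP (W l) 0; first exact: main HB kl Wl x xl.
have HB' : beam lam (fun=> 0) (fun x => -1 * u x) (fun x => -1 * v x)
   (fun x => -1 * k x) (fun x => -1 * k1 x) (fun x => -1 * W x).
  by apply: beam_ext (beamZ (-1) HB) => y; rewrite mulr0.
have := main _ _ _ _ _ lam0 HB' _ _ x xl; rewrite kl mulr0 !mulN1r => /(_ erefl).
by rewrite oppr_le0 (ltW Wl) => /(_ isT) /eqP; rewrite oppr_eq0 => /eqP.
Qed.

Lemma ip_eq0 u w : (forall x, 0 <= x <= l -> u x = 0) -> ip u w = 0.
Proof.
move=> u0; rewrite /ip (@Int_ext _ _ _ _ (fun=> 0)) => [|x xl].
  by rewrite Int_cst // mul0r.
by rewrite u0 // mulr0 mul0r.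
Qed.

Lemma beam_trace_neq0 lam u v k k1 W : 0 <= lam -> beam lam (fun=> 0) u v k k1 W ->
  0 < ip u u -> k l != 0.
Proof.
move=> lam0 HB u0; apply/eqP => kl; move: u0.
by rewrite ip_eq0 ?ltxx //; exact: beam_unique HB kl.
Qed.

(* The difference of two eigenfunctions normalized by [k l = 1] has zero trace at
   [l] and solves the equation of the first with a source proportional to the gap. *)
Lemma beam_gap : exists c L0, [/\ 0 < c, 1 <= L0 &
  forall lam lam' u v k k1 W u' v' k' k1' W', L0 <= lam -> 0 <= lam' -> lam != lam' ->
    beam lam (fun=> 0) u v k k1 W -> beam lam' (fun=> 0) u' v' k' k1' W' ->
    0 < ip u u -> 0 < ip u' u' -> c * lam <= (lam - lam') ^+ 2].
Proof.
have [C [s0 [C0 s01 obs]]] := beam_observability.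
have s0p : 0 < s0 by exact: lt_le_trans s01.
exists (rho0 / (rhoM * C)), (s0 ^+ 4); split.
- by rewrite divr_gt0 // mulr_gt0.
- by rewrite exprn_ege1.
move=> lam lam' u v k k1 W u' v' k' k1' W' Llam lam'0 ne HB HB' up up'.
have lam0 : 0 <= lam by apply: le_trans Llam; rewrite exprn_ge0 // ltW.
pose s := Num.sqrt (Num.sqrt lam).
have sE : lam = s ^+ 4.
  by rewrite -[4%N]/(2 * 2)%N exprM !sqr_sqrtr // sqrtr_ge0.
have ss : s0 <= s.
  by rewrite -(@ler_pXn2r _ 4) ?nnegrE ?sqrtr_ge0 // -?sE // ltW.
have s1 : 1 <= s by exact: le_trans ss.
have [cu cv ck ck1 cW] := beam_cont HB; have [cu' cv' ck' ck1' cW'] := beam_cont HB'.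
have kl := beam_trace_neq0 lam0 HB up; have kl' := beam_trace_neq0 lam'0 HB' up'.
pose a := (k l)^-1; pose a' := (k' l)^-1.
have B := beamD (beamZ a HB) (beamZ (- a') (beam_shift lam HB')).
have := obs s lam _ _ _ _ _ _ ss sE _ B.
set F := (X in cont 0 l X -> _);
have cF : cont 0 l F by rewrite /F; cont_tac.
move=> /(_ cF); rewrite mulVf // mulNr mulVf // subrr expr0n /= add0r => main.
have cw : cont 0 l (fun x => a * u x + - a' * u' x) by cont_tac.
pose Z := a' ^+ 2 * sq 0 l u'.
have Zp : 0 < Z.
  rewrite mulr_gt0 ?exprn_even_gt0 ?invr_eq0 //.
  by rewrite -(pmulr_rgt0 _ rhoM_gt0); exact: lt_le_trans (ip_upper cu').
have FE : sq 0 l F = (lam - lam') ^+ 2 * Z.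
  rewrite /Z mulrA -exprMn -sqZ; last exact: L2r_cont.
  by rewrite /sq; apply: Int_ext => x _; rewrite /F; ring.
(* Orthogonality rules out cancellation: the difference dominates its second component, which is the
   one that appears in the source. *)
have wE : ip (fun x => a * u x + - a' * u' x) (fun x => a * u x + - a' * u' x) =
   a ^+ 2 * ip u u + a' ^+ 2 * ip u' u'.
  have o := beam_orthogonal ne HB HB'.
  transitivity (a ^+ 2 * ip u u + a' ^+ 2 * ip u' u' + (- 2 * a * a') * ip u u'); last first.
    by rewrite o mulr0 addr0.
  rewrite /ip -!IntZ -?IntD; try (by apply: cont_itg; cont_tac).
  by apply: Int_ext => x _; ring.
have h1 := ip_upper cw; have h2 := ip_lower cu'.
have h3 : rho0 * Z <= rhoM * sq 0 l (fun x => a * u x + - a' * u' x).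
  apply: le_trans h1; rewrite wE /Z mulrCA.
  have : 0 <= a ^+ 2 * ip u u by rewrite mulr_ge0 ?sqr_ge0 // ltW.
  have : a' ^+ 2 * (rho0 * sq 0 l u') <= a' ^+ 2 * ip u' u' by rewrite ler_wpM2l ?sqr_ge0.
  by lra.
have k2 := sq_ge0 0 l (fun x => a * k x + - a' * k' x).
have h4 : lam * sq 0 l (fun x => a * u x + - a' * u' x) <= C * ((lam - lam') ^+ 2 * Z).
  (* Keeping [1 / s ^ 2] would give a gap of order [lam] to the power [3 / 4]; the power [1 / 2] is
     enough, and the factor is bounded by 1. *)
  have : C * (sq 0 l F / s ^+ 2) <= C * sq 0 l F.
    rewrite ler_pM2l // ler_pdivrMr ?exprn_gt0 //; last exact: lt_le_trans s1.
    by rewrite ler_peMr ?sq_ge0 // exprn_ege1.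
  by rewrite FE; move: main; rewrite FE; lra.
rewrite mulrAC ler_pdivrMr ?mulr_gt0 // -(ler_pM2r Zp).
have h5 : lam * (rho0 * Z) <= lam * (rhoM * sq 0 l (fun x => a * u x + - a' * u' x)).
  by rewrite ler_wpM2l.
have h6 : rhoM * (lam * sq 0 l (fun x => a * u x + - a' * u' x)) <=
    rhoM * (C * ((lam - lam') ^+ 2 * Z)) by rewrite ler_pM2l.
by lra.
Qed.

(** The spectrum is defined by real normalized solutions, without reference to an eigenbasis, so
    that the constants obtained on it depend on the coefficients alone. *)
Definition eigenval (lam : R) : Prop :=
  exists u v k k1 W, beam lam (fun=> 0) u v k k1 W /\ ip u u = 1.

(* Bessel's inequality for the evaluation at [x]: the sum [S] of the squares of the
   normalized eigenfunctions at [x] is the value there of a function of energy at most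
   [L S], so [S ^+ 2 <= l ^+ 3 / sigma0 * L * S]. *)
Lemma eigenval_card (L : R) : 0 <= L -> exists N : nat, forall s : seq R, uniq s ->
  (forall lam, lam \in s -> lam <= L /\ eigenval lam) -> (size s <= N)%N.
Proof.
move=> L0; pose M := l ^+ 3 * L / sigma0.
(* [M] bounds the sum of squares at each point. Integrated against [rho], each eigenfunction
   contributes 1, so the list has at most [rhoM * M * l] elements. *)
exists (Num.truncn (rhoM * M * l)).+1 => s us Hs.
have [U [V [K [K1 [W HU]]]]] : exists U V K K1 W : R -> R -> R, forall lam, lam \in s ->
   beam lam (fun=> 0) (U lam) (V lam) (K lam) (K1 lam) (W lam) /\ ip (U lam) (U lam) = 1.
  have /choice[F HF] : forall lam, exists p : (R -> R) * (R -> R) * (R -> R) * (R -> R) * (R -> R),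
      lam \in s -> beam lam (fun=> 0) p.1.1.1.1 p.1.1.1.2 p.1.1.2 p.1.2 p.2 /\
         ip p.1.1.1.1 p.1.1.1.1 = 1.
    move=> lam; case lams : (lam \in s); last by exists (id, id, id, id, id).
    have [_ [u [v [k [k1 [W [H1 H2]]]]]]] := Hs lam lams.
    by exists (u, v, k, k1, W).
  by exists (fun x => (F x).1.1.1.1), (fun x => (F x).1.1.1.2), (fun x => (F x).1.1.2),
    (fun x => (F x).1.2), (fun x => (F x).2).
have cU lam : lam \in s -> cont 0 l (U lam) by move=> /HU[/beam_cont[]].
have cV lam : lam \in s -> cont 0 l (V lam) by move=> /HU[/beam_cont[]].
have cK lam : lam \in s -> cont 0 l (K lam) by move=> /HU[/beam_cont[]].
have pt x : 0 <= x <= l -> \sum_(i <- s) U i x ^+ 2 <= M.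
  move=> xl; set S := \sum_(i <- s) _.
  have S0 : 0 <= S by apply: sumr_ge0 => i _; exact: sqr_ge0.
  (* The representer of the evaluation at [x] on the span of the eigenfunctions:
     [ip (U i) g = U i x] and [g x = S]. The filter [i \in s] carries membership into the lemmas on
     sums. *)
  pose g y := \sum_(i <- s | i \in s) U i x * U i y.
  pose g1 y := \sum_(i <- s | i \in s) U i x * V i y.
  pose g2 y := \sum_(i <- s | i \in s) U i x * K i y.
  have gW : W2 l g g1 g2.
    by apply: W2_sum => i /HU[/beam_W2 h _]; exact: W2Z.
  have gc : clamped l g g1.
    apply: clamped_sum => i /HU[[_ [h1 h2 h3 h4]] _].
    by split; rewrite ?h1 ?h2 ?h3 ?h4 mulr0.
  have [Hg Hg1 g2L] := gW; have cg := prim_cont Hg; have cg1 := prim_cont Hg1.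
  have cg2 : cont 0 l g2.
    by apply: cont_sum => i si; apply: contZ; exact: cK.
  have gx : g x = S by rewrite /g /S big_seq; apply: eq_bigr => i _; rewrite expr2.
  have ipg i : i \in s -> ip (U i) g = U i x.
    move=> si; have -> : ip (U i) g = \sum_(j <- s | j \in s) U j x * ip (U i) (U j).
      transitivity (Int 0 l (fun y => \sum_(j <- s | j \in s) U j x * (rho y * U i y * U j y))).
        apply: Int_ext => y _; rewrite /g mulr_sumr; apply: eq_bigr => j _; ring.
      rewrite Int_sum; last by move=> j js; apply: itgZ; apply: ip_itg; exact: cU.
      apply: eq_bigr => j js; rewrite IntZ //; apply: ip_itg; exact: cU.
    rewrite -big_seq (bigD1_seq i) //= (HU i si).2 mulr1 big1_seq ?addr0 // => j /andP[ji js].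
    by rewrite (beam_orthogonal _ (HU i si).1 (HU j js).1) ?mulr0 // eq_sym.
  have en : Int 0 l (fun y => sigma y * g2 y * g2 y + q y * g1 y * g1 y) =
     \sum_(i <- s | i \in s) i * U i x ^+ 2.
    transitivity (Int 0 l (fun y => \sum_(i <- s | i \in s)
       U i x * (sigma y * K i y * g2 y + q y * V i y * g1 y))).
      apply: Int_ext => y _.
      transitivity (sigma y * g2 y * (\sum_(i <- s | i \in s) U i x * K i y) +
         q y * g1 y * (\sum_(i <- s | i \in s) U i x * V i y)); first by [].
      rewrite 2!mulr_sumr -big_split /=.
      by apply: eq_bigr => i _; ring.
    have it i : i \in s -> itg 0 l (fun y => sigma y * K i y * g2 y + q y * V i y * g1 y).
      by move=> si; have := cK i si; have := cV i si => ? ?; apply: cont_itg; cont_tac.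
    rewrite Int_sum => [|i si]; last by apply: itgZ; exact: it.
    apply: eq_bigr => i si; rewrite IntZ; last exact: it.
    by rewrite (beam_form (HU i si).1 gW gc) -/(ip (U i) g) ipg //; ring.
  have e1 : sigma0 * sq 0 l g2 <= L * S.
    apply: (@le_trans _ _ (\sum_(i <- s | i \in s) i * U i x ^+ 2)); last first.
      rewrite /S mulr_sumr [leRHS]big_seq; apply: ler_sum => i si.
      by rewrite ler_wpM2r ?sqr_ge0 //; case: (Hs i si).
    rewrite -en -IntZ; last by apply: cont_itg; cont_tac.
    apply: Int_le; [by apply: cont_itg; cont_tac|by apply: cont_itg; cont_tac|].
    move=> y yl; have /andP[h1 _] := sigmab yl; have /andP[h2 _] := qb yl.
    rewrite -mulrA -expr2 -(mulrA (q y)) -expr2.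
    have : sigma0 * g2 y ^+ 2 <= sigma y * g2 y ^+ 2 by rewrite ler_wpM2r ?sqr_ge0.
    have : 0 <= q y * g1 y ^+ 2 by rewrite mulr_ge0 ?sqr_ge0.
    by lra.
  have [g0 g10 _ _] := gc.
  have e2 := poincare Hg (L2r_cont cg1) g0 xl; rewrite gx in e2.
  have e3 := poincare_sq l0 Hg1 g2L g10.
  have e4 : sigma0 * S ^+ 2 <= l ^+ 3 * L * S.
    apply: (@le_trans _ _ (l ^+ 3 * (sigma0 * sq 0 l g2))); last first.
      by rewrite -mulrA ler_wpM2l // exprn_ge0.
    rewrite [leRHS]mulrCA ler_pM2l //; apply: (le_trans e2).
    by rewrite exprS -mulrA ler_wpM2l.
  have [->|Sne] := eqVneq S 0; first by rewrite /M divr_ge0 ?mulr_ge0 ?exprn_ge0 // ltW.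
  have Sp : 0 < S by rewrite lt_neqAle eq_sym Sne.
  by rewrite /M ler_pdivlMr // -(ler_pM2r Sp) mulrAC -expr2 mulrC.
have tot : (size s)%:R <= rhoM * M * l.
  have -> : (size s)%:R = Int 0 l (fun y => \sum_(i <- s | i \in s) rho y * U i y * U i y).
    rewrite Int_sum => [|i si]; last by apply: ip_itg; exact: cU.
    rewrite -big_seq.
    transitivity (\sum_(i <- s) (1 : R)); first by rewrite big_const_seq count_predT iter_addr_0.
    apply: eq_big_seq => i si.
    by rewrite -/(ip (U i) (U i)) (HU i si).2.
  have -> : rhoM * M * l = Int 0 l (fun=> rhoM * M) by rewrite Int_cst // subr0.
  apply: Int_le; [|exact: itg_cst|].
    by apply: itg_sum => i si; apply: ip_itg; exact: cU.
  move=> y yl; have := pt y yl; rewrite big_seq => h; have /andP[h1 h2] := rhob yl.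
  apply: (@le_trans _ _ (rhoM * \sum_(i <- s | i \in s) U i y ^+ 2)); last by rewrite ler_pM2l.
  rewrite mulr_sumr; apply: ler_sum => i _; rewrite -mulrA -expr2.
  by rewrite ler_wpM2r ?sqr_ge0.
by apply: ltnW; rewrite -(ltr_nat R); apply: le_lt_trans tot _; exact: truncnS_gt.
Qed.

Lemma beam_eigenval lam u v k k1 W : beam lam (fun=> 0) u v k k1 W -> 0 < ip u u ->
  eigenval lam.
Proof.
move=> HB up; pose a := (Num.sqrt (ip u u))^-1; have [cu _ _ _ _] := beam_cont HB.
exists (fun x => a * u x), (fun x => a * v x), (fun x => a * k x), (fun x => a * k1 x), (fun x => a * W x).
split; first by apply: beam_ext (beamZ a HB) => x; rewrite mulr0.
transitivity (a ^+ 2 * ip u u).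
  by rewrite /ip -IntZ; [apply: Int_ext => x _; ring|exact: ip_itg].
by rewrite /a exprVn sqr_sqrtr ?ltW // mulVf // gt_eqF.
Qed.

(* Eigenfunctions of a given eigenvalue are proportional to each other. *)
Lemma beam_trace_lower_at lam : 0 <= lam -> exists2 c, 0 < c &
  forall u v k k1 W, beam lam (fun=> 0) u v k k1 W -> c * ip u u <= k l ^+ 2.
Proof.
move=> lam0; have [[u' [v' [k' [k1' [W' [HB' u'1]]]]]]|none] := pselect (eigenval lam).
  have kl' : k' l != 0 by apply: (beam_trace_neq0 lam0 HB'); rewrite u'1.
  exists (k' l ^+ 2) => [|u v k k1 W HB]; first by rewrite exprn_even_gt0.
  have HD : beam lam (fun=> 0) (fun x => k' l * u x + - k l * u' x)
      (fun x => k' l * v x + - k l * v' x) (fun x => k' l * k x + - k l * k' x)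
      (fun x => k' l * k1 x + - k l * k1' x) (fun x => k' l * W x + - k l * W' x).
    by apply: beam_ext (beamD (beamZ (k' l) HB) (beamZ (- k l) HB')) => x; rewrite !mulr0 addr0.
  have z := beam_unique lam0 HD _; have {}z := z _.
  have E : k' l ^+ 2 * ip u u = k l ^+ 2 * ip u' u'.
    have [cu _ _ _ _] := beam_cont HB; have [cu' _ _ _ _] := beam_cont HB'.
    rewrite /ip -!IntZ; try exact: ip_itg.
    apply: Int_ext => x xl.
    have zx : k' l * u x = k l * u' x.
      by apply/eqP; rewrite -subr_eq0 -mulNr; apply/eqP; apply: z => //; ring.
    transitivity (rho x * (k' l * u x) * (k' l * u x)); first by ring.
    by rewrite zx; ring.
  by rewrite E u'1 mulr1.
exists 1 => // u v k k1 W HB; rewrite mul1r.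
suff -> : ip u u = 0 by rewrite sqr_ge0.
have [cu _ _ _ _] := beam_cont HB.
have u0 : 0 <= ip u u by apply: le_trans (ip_lower cu); rewrite mulr_ge0 ?sq_ge0 // ltW.
apply/eqP; apply: contrapT => /negP ne; apply: none.
by apply: beam_eigenval HB _; rewrite lt_neqAle eq_sym ne.
Qed.

(** If no list exhausted the eigenvalues up to [L], lists of every length could be built one element
    at a time, against [eigenval_card]. That bound is for nonnegative levels, hence [max L 0]. *)
Lemma eigenval_finite (L : R) : exists t : seq R, forall lam, eigenval lam -> lam <= L -> lam \in t.
Proof.
pose L' := Num.max L 0.
have L'0 : 0 <= L' by rewrite le_max lexx orbT.
have [N HN] := eigenval_card L'0.
pose good (s : seq R) := uniq s /\ forall lam, lam \in s -> lam <= L' /\ eigenval lam.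
have ext (s : seq R) : good s -> (forall lam, eigenval lam -> lam <= L -> lam \in s) \/
    exists s', good s' /\ size s' = (size s).+1.
  move=> [us Hs]; have [H|/existsNP[lam /not_implyP[e /not_implyP[lL /negP ls]]]] :=
    pselect (forall lam, eigenval lam -> lam <= L -> lam \in s); first by left.
  right; exists (lam :: s); split=> //; split; first by rewrite /= ls.
  move=> m; rewrite inE => /predU1P[->|]; last exact: Hs.
  by split => //; rewrite le_max lL.
apply: contrapT => none.
have big n : exists s, good s /\ size s = n.
  elim: n => [|n [s [gs sn]]]; first by exists [::].
  have [H|[s' [gs' s'n]]] := ext s gs; first by exfalso; apply: none; exists s.
  by exists s'; rewrite s'n sn.
have [s [[us Hs] sN]] := big N.+1.
by have := HN s us Hs; rewrite sN ltnn.
Qed.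

Lemma beam_trace_equiv : exists c C, [/\ 0 < c, 0 < C & forall lam u v k k1 W, 0 <= lam ->
  beam lam (fun=> 0) u v k k1 W ->
  c * (lam * ip u u) <= k l ^+ 2 <= C * (lam * ip u u)].
Proof.
have [C1 C10 H1] := beam_trace_upper.
have [C2 [s0 [C20 s01 H2]]] := beam_observability.
pose L0 := s0 ^+ 4; have L00 : 0 < L0 by rewrite exprn_gt0 //; exact: lt_le_trans s01.
have [t Ht] := eigenval_finite L0.
(* The least of the constants of [beam_trace_lower_at] over a finite list; a negative entry differs
   from [lam] and leaves the constant as it is. *)
have [c3 c30 H3] : exists2 c, 0 < c & forall lam u v k k1 W, lam \in t -> 0 <= lam ->
    beam lam (fun=> 0) u v k k1 W -> c * ip u u <= k l ^+ 2.
  elim: (t) => [|m t' [c c0 Hc]]; first by exists 1.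
  have [m0|m0] := leP 0 m; last first.
    exists c => // lam u v k k1 W; rewrite inE => /predU1P[->|]; last exact: Hc.
    by rewrite leNgt m0.
  have [c' c'0 Hc'] := beam_trace_lower_at m0.
  exists (Num.min c c'); first by rewrite lt_min c0.
  move=> lam u v k k1 W lt lam0 HB.
  have [cu _ _ _ _] := beam_cont HB.
  have u0 : 0 <= ip u u by apply: le_trans (ip_lower cu); rewrite mulr_ge0 ?sq_ge0 // ltW.
  move: lt; rewrite inE => /predU1P[lE|lt].
    rewrite lE in HB; apply: le_trans (Hc' _ _ _ _ _ HB).
    by rewrite ler_wpM2r // ge_min lexx orbT.
  apply: le_trans (Hc _ _ _ _ _ _ lt lam0 HB).
  by rewrite ler_wpM2r // ge_min lexx.
(* The first value serves above [L0], by observability without source. The second serves below,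
   where [lam <= L0] converts a bound in [ip u u] into one in [lam * ip u u]. *)
pose c := Num.min (rhoM * C2)^-1 (c3 / L0).
have c0 : 0 < c by rewrite lt_min invr_gt0 mulr_gt0 // divr_gt0.
pose C := C1 * (rho0^-1 + sigma0^-1).
have C0 : 0 < C by rewrite mulr_gt0 // addr_gt0 // invr_gt0.
exists c, C; split => // lam u v k k1 W lam0 HB.
have [cu _ _ _ _] := beam_cont HB.
have u0 : 0 <= ip u u by apply: le_trans (ip_lower cu); rewrite mulr_ge0 ?sq_ge0 // ltW.
have lu0 : 0 <= lam * ip u u by exact: mulr_ge0.
apply/andP; split; last first.
  apply: (le_trans (H1 _ _ _ _ _ _ lam0 HB)); rewrite /C -mulrA ler_pM2l // mulrDl.
  have h1 := ip_lower cu; have h2 := beam_energy HB.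
  apply: lerD.
    by rewrite [leRHS]mulrC ler_pdivlMr // -mulrA ler_wpM2l // mulrC.
  by rewrite [leRHS]mulrC ler_pdivlMr // mulrC.
have [up|] := ltP 0 (ip u u); last first.
  move=> u1; have -> : ip u u = 0 by apply/eqP; rewrite eq_le u1.
  by rewrite !mulr0 sqr_ge0.
have [lL|lL] := leP lam L0.
  have ev : eigenval lam.
    pose a := (Num.sqrt (ip u u))^-1.
    exists (fun x => a * u x), (fun x => a * v x), (fun x => a * k x), (fun x => a * k1 x), (fun x => a * W x).
    split; first by apply: beam_ext (beamZ a HB) => x; rewrite mulr0.
    transitivity (a ^+ 2 * ip u u).
      by rewrite /ip -IntZ; [apply: Int_ext => x _; ring|exact: ip_itg].
    by rewrite /a exprVn sqr_sqrtr // mulVf // gt_eqF.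
  apply: le_trans (H3 _ _ _ _ _ _ (Ht _ ev lL) lam0 HB).
  apply: (@le_trans _ _ (c3 / L0 * (lam * ip u u))).
    by rewrite ler_wpM2r // /c ge_min lexx orbT.
  by rewrite mulrAC ler_pdivrMr // -!mulrA ler_pM2l // mulrC ler_wpM2l.
pose s := Num.sqrt (Num.sqrt lam).
have sE : lam = s ^+ 4.
  by rewrite -[4%N]/(2 * 2)%N exprM !sqr_sqrtr // sqrtr_ge0.
have ss : s0 <= s.
  rewrite -(@ler_pXn2r _ 4) ?nnegrE ?sqrtr_ge0 // -?sE ?(ltW lL) //.
  by rewrite ltW //; exact: lt_le_trans s01.
have cz : cont 0 l (fun=> 0 : R) by exact: cont_cst.
have := H2 s lam _ _ _ _ _ _ ss sE cz HB.
have -> : sq 0 l (fun=> 0 : R) = 0.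
  by rewrite /sq (@Int_ext _ _ _ _ (fun=> 0)) ?Int_cst ?mul0r // => x _; rewrite expr0n.
rewrite mul0r addr0 => main.
apply: (@le_trans _ _ ((rhoM * C2)^-1 * (lam * ip u u))).
  by rewrite ler_wpM2r // /c ge_min lexx.
rewrite mulrC ler_pdivrMr ?mulr_gt0 // mulrC -mulrA.
apply: (@le_trans _ _ (rhoM * (lam * sq 0 l u))).
  by rewrite mulrC [leRHS]mulrCA; apply: ler_wpM2l => //; exact: ip_upper.
have h : rhoM * (lam * sq 0 l u) <= rhoM * (C2 * k l ^+ 2).
  by rewrite ler_pM2l //; have := sq_ge0 0 l k; lra.
by apply: le_trans h _; rewrite le_eqVlt; apply/orP; left; apply/eqP; ring.
Qed.

Lemma eigenval_ge0 lam : eigenval lam -> 0 < lam.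
Proof.
move=> [u [v [k [k1 [W [HB u1]]]]]].
have := beam_eigenvalue_lower HB; rewrite u1 => /(_ ltr01); apply: lt_le_trans.
by rewrite divr_gt0 // mulr_gt0 // exprn_gt0.
Qed.

Lemma eigenval_gap (G : R) : exists L, forall x y, eigenval x -> eigenval y ->
  L <= x -> L <= y -> x != y -> G <= `|x - y|.
Proof.
have [c [L0 [c0 L01 H]]] := beam_gap.
exists (Num.max L0 (G ^+ 2 / c)) => x y ex ey; rewrite ge_max => /andP[Lx Gx] _ xy.
have y0 := ltW (eigenval_ge0 ey).
have [u [v [k [k1 [W [HB u1]]]]]] := ex; have [u' [v' [k' [k1' [W' [HB' u'1]]]]]] := ey.
have := H _ _ _ _ _ _ _ _ _ _ _ _ Lx y0 xy HB HB'; rewrite u1 u'1 => /(_ ltr01 ltr01).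
rewrite ler_pdivrMr // mulrC in Gx => /(le_trans Gx) h.
have [G0|G0] := leP G 0; first exact: le_trans G0 _.
by rewrite -(@ler_pXn2r _ 2) ?nnegrE ?(ltW G0) // real_normK ?num_real.
Qed.

Lemma ipDl u v w : cont 0 l u -> cont 0 l v -> cont 0 l w ->
  ip (fun x => u x + v x) w = ip u w + ip v w.
Proof.
by move=> cu cv cw; rewrite /ip -IntD; [apply: Int_ext => x _; ring|exact: ip_itg|exact: ip_itg].
Qed.

Lemma ipZl c u w : cont 0 l u -> cont 0 l w -> ip (fun x => c * u x) w = c * ip u w.
Proof. by move=> cu cw; rewrite /ip -IntZ; [apply: Int_ext => x _; ring|exact: ip_itg]. Qed.

Lemma ipBl u v w : cont 0 l u -> cont 0 l v -> cont 0 l w ->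
  ip (fun x => u x - v x) w = ip u w - ip v w.
Proof.
by move=> cu cv cw; rewrite /ip -IntB; [apply: Int_ext => x _; ring|exact: ip_itg|exact: ip_itg].
Qed.

Lemma ip_suml (I : Type) (s : seq I) (P : pred I) (F : I -> R -> R) w :
  (forall i, P i -> cont 0 l (F i)) -> cont 0 l w ->
  ip (fun x => \sum_(i <- s | P i) F i x) w = \sum_(i <- s | P i) ip (F i) w.
Proof.
move=> cF cw; rewrite /ip -Int_sum => [|i Pi]; last by apply: ip_itg => //; exact: cF.
by apply: Int_ext => x _; rewrite mulr_sumr mulr_suml.
Qed.

(* The energy form of [u] and [w], given by their first two derivatives. *)
Definition en (u1 u2 w1 w2 : R -> R) : R :=
  \I (fun x => sigma x * u2 x * w2 x + q x * u1 x * w1 x).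

Definition adm (u1 u2 : R -> R) : Prop := cont 0 l u1 /\ L2r 0 l u2.

Lemma W2_adm u u1 u2 : W2 l u u1 u2 -> adm u1 u2.
Proof. by move=> [_ H1 H2]; split => //; exact: prim_cont H1. Qed.

Lemma admB u1 u2 w1 w2 : adm u1 u2 -> adm w1 w2 ->
  adm (fun x => u1 x - w1 x) (fun x => u2 x - w2 x).
Proof. by move=> [? ?] [? ?]; split; [exact: contB|exact: L2rB]. Qed.

Lemma admZ c u1 u2 : adm u1 u2 -> adm (fun x => c * u1 x) (fun x => c * u2 x).
Proof. by move=> [? ?]; split; [exact: contZ|exact: L2rZ]. Qed.

Lemma en_itg u1 u2 w1 w2 : adm u1 u2 -> adm w1 w2 ->
  itg 0 l (fun x => sigma x * u2 x * w2 x + q x * u1 x * w1 x).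
Proof.
move=> [cu1 u2L] [cw1 w2L]; apply: itgD; last by apply: cont_itg; cont_tac.
apply: itg_ext (itg_cmul csigma (L2r_mul u2L w2L)) => x _; exact: mulrA.
Qed.

Lemma enC u1 u2 w1 w2 : en u1 u2 w1 w2 = en w1 w2 u1 u2.
Proof. by apply: Int_ext => x _; ring. Qed.

Lemma enBl u1 u2 v1 v2 w1 w2 : adm u1 u2 -> adm v1 v2 -> adm w1 w2 ->
  en (fun x => u1 x - v1 x) (fun x => u2 x - v2 x) w1 w2 = en u1 u2 w1 w2 - en v1 v2 w1 w2.
Proof.
move=> a b c; rewrite /en -IntB; [|exact: en_itg|exact: en_itg].
by apply: Int_ext => x _; ring.
Qed.

Lemma enZl c u1 u2 w1 w2 : adm u1 u2 -> adm w1 w2 ->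
  en (fun x => c * u1 x) (fun x => c * u2 x) w1 w2 = c * en u1 u2 w1 w2.
Proof.
move=> a b; rewrite /en -IntZ; last exact: en_itg.
by apply: Int_ext => x _; ring.
Qed.

(** Removing a complex mode [(d + i e) (p + i r)] subtracts [d p - e r] from the real part. The
    imaginary part obeys the same formula with [p] and [r] exchanged and [e] negated. *)
Lemma en_quad w1 w2 p1 p2 r1 r2 d e : adm w1 w2 -> adm p1 p2 -> adm r1 r2 ->
  en (fun x => w1 x - (d * p1 x - e * r1 x)) (fun x => w2 x - (d * p2 x - e * r2 x))
     (fun x => w1 x - (d * p1 x - e * r1 x)) (fun x => w2 x - (d * p2 x - e * r2 x)) =
  en w1 w2 w1 w2 - 2 * d * en w1 w2 p1 p2 + 2 * e * en w1 w2 r1 r2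
  + d ^+ 2 * en p1 p2 p1 p2 - 2 * d * e * en p1 p2 r1 r2 + e ^+ 2 * en r1 r2 r1 r2.
Proof.
move=> aw ap ar.
have az : adm (fun x => d * p1 x - e * r1 x) (fun x => d * p2 x - e * r2 x).
  by apply: admB; exact: admZ.
have az' := admB aw az; have adp := admZ d ap; have aer := admZ e ar.
have E v1 v2 : adm v1 v2 ->
    en (fun x => w1 x - (d * p1 x - e * r1 x)) (fun x => w2 x - (d * p2 x - e * r2 x)) v1 v2 =
    en w1 w2 v1 v2 - (d * en p1 p2 v1 v2 - e * en r1 r2 v1 v2).
  by move=> av; rewrite enBl // enBl // enZl // enZl.
rewrite E // !(enC _ _ (fun x => w1 x - _)) !E // (enC p1 p2 w1) (enC r1 r2 w1) (enC r1 r2 p1).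
by ring.
Qed.

Lemma en_lower u1 u2 : adm u1 u2 -> sigma0 * sq 0 l u2 <= en u1 u2 u1 u2.
Proof.
move=> a; have [c1 L2] := a; rewrite -IntZ; last exact: L2.2.
apply: Int_le; [by apply: itgZ; exact: L2.2|exact: en_itg|].
move=> x xl; have /andP[g0 _] := sigmab xl; have /andP[p0 _] := qb xl.
rewrite -mulrA -expr2 -(mulrA (q x)) -expr2.
by apply: ler_wpDr; [rewrite mulr_ge0 ?sqr_ge0|rewrite ler_wpM2r ?sqr_ge0].
Qed.

Lemma en_upper u u1 u2 : W2 l u u1 u2 -> u1 0 = 0 ->
  en u1 u2 u1 u2 <= (sigmaM + qM * l ^+ 2) * sq 0 l u2.
Proof.
move=> [Hu Hu1 u2L] u10; have cu1 := prim_cont Hu1.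
have b := poincare_sq l0 Hu1 u2L u10.
apply: (@le_trans _ _ (sigmaM * sq 0 l u2 + qM * sq 0 l u1)); last first.
  by rewrite mulrDl lerD2l -mulrA ler_wpM2l.
have u1L := L2r_cont cu1.
rewrite -!IntZ; [|exact: u1L.2|exact: u2L.2].
rewrite -IntD; [|by apply: itgZ; exact: u2L.2|by apply: itgZ; exact: u1L.2].
apply: Int_le; first by apply: en_itg; split.
  by apply: itgD; apply: itgZ; [exact: u2L.2|exact: u1L.2].
move=> x xl; have /andP[_ gM] := sigmab xl; have /andP[_ pM] := qb xl.
by rewrite -mulrA -expr2 -(mulrA (q x)) -expr2 lerD // ler_wpM2r ?sqr_ge0.
Qed.

Lemma en_beam lam u v k k1 W w w1 w2 : beam lam (fun=> 0) u v k k1 W ->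
  W2 l w w1 w2 -> clamped l w w1 -> en w1 w2 v k = lam * ip w u.
Proof. by move=> HB Hw Hc; rewrite enC ipC; exact: beam_form HB Hw Hc. Qed.

(** * Expansion in a complex eigenbasis, by real and imaginary parts *)

Section Basis.
(* A complex orthonormal family of eigenfunctions [p n + i r n]. *)
Variables (lam : nat -> R) (p p1 p2 r r1 r2 : nat -> R -> R).
Hypotheses (Hp : forall n, exists k1 W, beam (lam n) (fun=> 0) (p n) (p1 n) (p2 n) k1 W)
  (Hr : forall n, exists k1 W, beam (lam n) (fun=> 0) (r n) (r1 n) (r2 n) k1 W)
  (orthoRe : forall m n, ip (p m) (p n) + ip (r m) (r n) = (m == n)%:R)
  (orthoIm : forall m n, ip (r m) (p n) - ip (p m) (r n) = 0).

Let cp n : cont 0 l (p n).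
Proof. by have [? [? /beam_cont[]]] := Hp n. Qed.
Let cr n : cont 0 l (r n).
Proof. by have [? [? /beam_cont[]]] := Hr n. Qed.
Let Wp n : W2 l (p n) (p1 n) (p2 n).
Proof. by have [? [? /beam_W2]] := Hp n. Qed.
Let Wr n : W2 l (r n) (r1 n) (r2 n).
Proof. by have [? [? /beam_W2]] := Hr n. Qed.
Let Cp n : clamped l (p n) (p1 n).
Proof. by have [? [? []]] := Hp n. Qed.
Let Cr n : clamped l (r n) (r1 n).
Proof. by have [? [? []]] := Hr n. Qed.

Lemma ip_ge0 u : cont 0 l u -> 0 <= ip u u.
Proof. by move=> cu; apply: le_trans (ip_lower cu); rewrite mulr_ge0 ?sq_ge0 // ltW. Qed.

(** The squared norms of the two parts add up to 1, so one part is a nonzero real eigenfunction. *)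
Lemma basis_eigenval n : eigenval (lam n).
Proof.
have := orthoRe n n; rewrite eqxx => E.
have [k1 [W HB]] := Hp n; have [k1' [W' HB']] := Hr n.
have [p0|p0] := ltP 0 (ip (p n) (p n)); first exact: beam_eigenval HB p0.
apply: beam_eigenval HB' _; have := ip_ge0 (@cp n); move: E p0; rewrite /=; lra.
Qed.

Lemma basis_gt0 n : 0 < lam n.
Proof. exact: eigenval_ge0 (basis_eigenval n). Qed.

Lemma basis_trace c C : (forall lam u v k k1 W, 0 <= lam -> beam lam (fun=> 0) u v k k1 W ->
    c * (lam * ip u u) <= k l ^+ 2 <= C * (lam * ip u u)) ->
  forall n, c * lam n <= p2 n l ^+ 2 + r2 n l ^+ 2 <= C * lam n.
Proof.
move=> H n; have [k1 [W HB]] := Hp n; have [k1' [W' HB']] := Hr n.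
have E := orthoRe n n; rewrite eqxx /= in E.
have ln := ltW (basis_gt0 n).
have /andP[h1 h2] := H _ _ _ _ _ _ ln HB; have /andP[h3 h4] := H _ _ _ _ _ _ ln HB'.
have e D : D * lam n = D * (lam n * ip (p n) (p n)) + D * (lam n * ip (r n) (r n)).
  by rewrite -mulrDr -mulrDr E mulr1.
by rewrite !e !lerD.
Qed.

(* If [lam m = lam n], the combination of the two eigenfunctions with zero trace
   vanishes. *)
Lemma basis_inj m n : lam m = lam n -> m = n.
Proof.
move=> E; apply/eqP; apply: contrapT => /negP ne.
have [kp [Wp' HBp]] := Hp n; have [kr [Wr' HBr]] := Hr n.
have [kp' [Wp'' HBp']] := Hp m; have [kr' [Wr'' HBr']] := Hr m; rewrite E in HBp' HBr'.
have ln := ltW (basis_gt0 n).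
have Z a b c d : a * p2 n l + b * r2 n l + (c * p2 m l + d * r2 m l) = 0 ->
    forall x, 0 <= x <= l -> a * p n x + b * r n x + (c * p m x + d * r m x) = 0.
  move=> z; have HB := beamD (beamD (beamZ a HBp) (beamZ b HBr)) (beamD (beamZ c HBp') (beamZ d HBr')).
  by apply: (beam_unique ln) z; apply: beam_ext HB => x; rewrite !mulr0 !addr0.
have L a b c d w : cont 0 l w ->
    ip (fun x => a * p n x + b * r n x + (c * p m x + d * r m x)) w =
    a * ip (p n) w + b * ip (r n) w + (c * ip (p m) w + d * ip (r m) w).
  have cZ e f : cont 0 l f -> cont 0 l (fun x => e * f x) by exact: contZ.
  have cD f g : cont 0 l f -> cont 0 l g -> cont 0 l (fun x => f x + g x) by exact: contD.
  move=> cw; rewrite ipDl //; try by apply: cD; exact: cZ.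
  by rewrite ipDl ?ipZl //; try exact: cZ; rewrite ipDl ?ipZl //; exact: cZ.
(* [z1] and [z2] are the two parts of [Phi_m''(l) Phi_n - Phi_n''(l) Phi_m], whose trace vanishes.
   Its products with [Phi_n] give [Phi_m''(l) = 0], against the lower bound on traces. *)
have z1 := Z (p2 m l) (- r2 m l) (- p2 n l) (r2 n l) ltac:(ring).
have z2 := Z (r2 m l) (p2 m l) (- r2 n l) (- p2 n l) ltac:(ring).
have a1 := etrans (esym (L _ _ _ _ _ (@cp n))) (ip_eq0 (p n) z1).
have a2 := etrans (esym (L _ _ _ _ _ (@cr n))) (ip_eq0 (r n) z2).
have a3 := etrans (esym (L _ _ _ _ _ (@cr n))) (ip_eq0 (r n) z1).
have a4 := etrans (esym (L _ _ _ _ _ (@cp n))) (ip_eq0 (p n) z2).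
have o1 := orthoRe n n; have o2 := orthoRe m n; have o3 := orthoIm n n; have o4 := orthoIm m n.
rewrite eqxx /= in o1; rewrite (negbTE ne) /= in o2.
have e1 : ip (r n) (r n) = 1 - ip (p n) (p n) by move: o1; lra.
have e2 : ip (r m) (r n) = - ip (p m) (p n) by move: o2; lra.
have e3 : ip (r n) (p n) = ip (p n) (r n) by move: o3; lra.
have e4 : ip (r m) (p n) = ip (p m) (r n) by move: o4; lra.
rewrite e1 e2 e3 e4 in a1 a2 a3 a4.
have tm : p2 m l = 0 by move: a1 a2; lra.
have sm : r2 m l = 0 by move: a3 a4; lra.
have [c [C [c0 C0 H]]] := beam_trace_equiv; have /andP[+ _] := basis_trace H m.
rewrite tm sm expr0n /= addr0 leNgt => /negP; apply.
by rewrite mulr_gt0 // basis_gt0.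
Qed.

Lemma basis_ingham (T : R) : 0 < T -> ingham eigenval T.
Proof.
move=> T0; apply: ingham_asymptotic_gap => //; first exact: eigenval_finite.
exact: eigenval_gap.
Qed.

(* The real part of [\sum_(n < N) (d n + i e n) (A n + i B n)]; the imaginary part is
   [lc B A d (- e) N]. *)
Definition lc (A B : nat -> R -> R) (d e : nat -> R) (N : nat) (x : R) : R :=
  \sum_(n < N) (d n * A n x - e n * B n x).

Lemma lcS A B d e N x : lc A B d e N.+1 x = lc A B d e N x + (d N * A N x - e N * B N x).
Proof. by rewrite /lc big_ord_recr. Qed.

Lemma W2_lc A A1 A2 B B1 B2 d e N : (forall n, W2 l (A n) (A1 n) (A2 n)) ->
  (forall n, W2 l (B n) (B1 n) (B2 n)) ->
  W2 l (lc A B d e N) (lc A1 B1 d e N) (lc A2 B2 d e N).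
Proof.
move=> HA HB; apply: (@W2_sum _ l 'I_N _ predT (fun n x => d n * A n x - e n * B n x)
  (fun n x => d n * A1 n x - e n * B1 n x) (fun n x => d n * A2 n x - e n * B2 n x)) => n _.
exact: W2B (W2Z (d n) (HA n)) (W2Z (e n) (HB n)).
Qed.

Lemma clamped_lc A A1 B B1 d e N : (forall n, clamped l (A n) (A1 n)) ->
  (forall n, clamped l (B n) (B1 n)) -> clamped l (lc A B d e N) (lc A1 B1 d e N).
Proof.
move=> HA HB; apply: (@clamped_sum _ l 'I_N _ predT (fun n x => d n * A n x - e n * B n x)
  (fun n x => d n * A1 n x - e n * B1 n x)) => n _.
by have [a1 a2 a3 a4] := HA n; have [b1 b2 b3 b4] := HB n; split;
   rewrite ?a1 ?a2 ?a3 ?a4 ?b1 ?b2 ?b3 ?b4 !mulr0 subrr.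
Qed.

Lemma ip_lc A B d e N w : (forall n, cont 0 l (A n)) -> (forall n, cont 0 l (B n)) ->
  cont 0 l w -> ip (lc A B d e N) w = \sum_(n < N) (d n * ip (A n) w - e n * ip (B n) w).
Proof.
move=> cA cB cw.
have cAn n : cont 0 l (fun x => d n * A n x) by apply: contZ; exact: cA.
have cBn n : cont 0 l (fun x => e n * B n x) by apply: contZ; exact: cB.
transitivity (\sum_(n < N) ip (fun x => d n * A n x - e n * B n x) w).
  apply: (@ip_suml 'I_N _ predT (fun n x => d n * A n x - e n * B n x)) => // n _.
  by apply: contB; [exact: cAn|exact: cBn].
apply: eq_bigr => n _; rewrite (ipBl (@cAn n) (@cBn n) cw).
by rewrite (ipZl _ (cA n) cw) (ipZl _ (cB n) cw).
Qed.

(* Real and imaginary parts of the coefficient of [u + i v] on [p n + i r n]. *)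
Definition cre (u v : R -> R) (n : nat) : R := ip u (p n) + ip v (r n).
Definition cim (u v : R -> R) (n : nat) : R := ip v (p n) - ip u (r n).

Section Remainder.
Variables (u u1 u2 v v1 v2 : R -> R).
Hypotheses (Wu : W2 l u u1 u2) (Cu : clamped l u u1) (Wv : W2 l v v1 v2) (Cv : clamped l v v1).

Let cu : cont 0 l u. Proof. by case: Wu => /prim_cont. Qed.
Let cv : cont 0 l v. Proof. by case: Wv => /prim_cont. Qed.

Definition EN (u1 u2 v1 v2 : R -> R) : R := en u1 u2 u1 u2 + en v1 v2 v1 v2.

Lemma cre_rem d e N k : (N <= k)%N ->
  cre (fun x => u x - lc p r d e N x) (fun x => v x - lc r p d (fun n => - e n) N x) k
  = cre u v k.
Proof.
move=> Nk.
have [/prim_cont c1 _ _] := W2_lc d e N Wp Wr.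
have [/prim_cont c2 _ _] := W2_lc d (fun n => - e n) N Wr Wp.
rewrite /cre !ipBl // !ip_lc // addrACA -opprD -big_split big1 ?subr0 // => n _ /=.
have o1 := orthoRe n k; have o2 := orthoIm n k.
rewrite (_ : (n == k :> nat) = false) /= in o1; last first.
  by apply/negbTE; rewrite neq_ltn (leq_trans (ltn_ord n) Nk).
transitivity (d n * (ip (p n) (p k) + ip (r n) (r k)) - e n * (ip (r n) (p k) - ip (p n) (r k))).
  by ring.
by rewrite o1 o2 !mulr0 subrr.
Qed.

Lemma cim_rem d e N k : (N <= k)%N ->
  cim (fun x => u x - lc p r d e N x) (fun x => v x - lc r p d (fun n => - e n) N x) k
  = cim u v k.
Proof.
move=> Nk.
have [/prim_cont c1 _ _] := W2_lc d e N Wp Wr.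
have [/prim_cont c2 _ _] := W2_lc d (fun n => - e n) N Wr Wp.
rewrite /cim !ipBl // !ip_lc //.
rewrite [LHS](_ : _ = ip v (p k) - ip u (r k) -
   \sum_(n < N) ((d n * ip (r n) (p k) - - e n * ip (p n) (p k))
                 - (d n * ip (p n) (r k) - e n * ip (r n) (r k)))); last first.
  by rewrite [X in _ = _ - X]sumrB; ring.
rewrite big1 ?subr0 // => n _ /=.
have o1 := orthoRe n k; have o2 := orthoIm n k.
rewrite (_ : (n == k :> nat) = false) /= in o1; last first.
  by apply/negbTE; rewrite neq_ltn (leq_trans (ltn_ord n) Nk).
transitivity (e n * (ip (p n) (p k) + ip (r n) (r k)) + d n * (ip (r n) (p k) - ip (p n) (r k))).
  by ring.
by rewrite o1 o2 !mulr0 addr0.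
Qed.

(** The square is completed one mode at a time, the form being diagonal on eigenfunctions. The
    coefficients [d], [e] are free: those of the function itself cancel the last sum, and applied to
    the zero function the identity gives the energy of a finite combination. *)
Lemma EN_rem d e N :
  EN (fun x => u1 x - lc p1 r1 d e N x) (fun x => u2 x - lc p2 r2 d e N x)
     (fun x => v1 x - lc r1 p1 d (fun n => - e n) N x)
     (fun x => v2 x - lc r2 p2 d (fun n => - e n) N x) =
  EN u1 u2 v1 v2 - \sum_(n < N) lam n * (cre u v n ^+ 2 + cim u v n ^+ 2)
  + \sum_(n < N) lam n * ((cre u v n - d n) ^+ 2 + (cim u v n - e n) ^+ 2).
Proof.
elim: N => [|N IH].
  rewrite !big_ord0 subr0 addr0 /EN /lc.
  by congr (_ + _); apply: Int_ext => x _; rewrite !big_ord0 !subr0.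
rewrite !big_ord_recr /=.
have HWu := W2B Wu (W2_lc d e N Wp Wr); have HCu := clampedB Cu (clamped_lc d e N Cp Cr).
have HWv := W2B Wv (W2_lc d (fun n => - e n) N Wr Wp).
have HCv := clampedB Cv (clamped_lc d (fun n => - e n) N Cr Cp).
have E A B f (w : R -> R) : (fun x => w x - lc A B d f N.+1 x) =
    (fun x => (w x - lc A B d f N x) - (d N * A N x - f N * B N x)).
  by apply/funext => x; rewrite lcS opprD addrA.
have E1 := cre_rem d e (leqnn N); have E2 := cim_rem d e (leqnn N).
have [k1 [W HB]] := Hp N; have [k1' [W' HB']] := Hr N.
have F1 := en_beam HB HWu HCu; have F2 := en_beam HB' HWu HCu.
have F3 := en_beam HB HWv HCv; have F4 := en_beam HB' HWv HCv.
have G1 := en_beam HB (Wp N) (Cp N); have G2 := en_beam HB' (Wp N) (Cp N).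
have G3 := en_beam HB (Wr N) (Cr N); have G4 := en_beam HB' (Wr N) (Cr N).
have aWu := W2_adm HWu; have aWv := W2_adm HWv.
have aWp := W2_adm (Wp N); have aWr := W2_adm (Wr N).
have o1 := orthoRe N N; rewrite eqxx /= in o1.
have o2 := orthoIm N N.
rewrite !E /EN (en_quad _ _ aWu aWp aWr) (en_quad _ _ aWv aWr aWp) F1 F2 F3 F4 G1 G2 G3 G4.
move: IH; rewrite /EN -E1 -E2 /cre /cim.
have -> : ip (r N) (r N) = 1 - ip (p N) (p N) by lra.
have -> : ip (r N) (p N) = ip (p N) (r N) by lra.
set a1 := ip _ (p N); set a2 := ip _ (p N); set a3 := ip _ (r N); set a4 := ip _ (r N).
lra.
Qed.

Definition eng (N : nat) : R := \sum_(n < N) lam n * (cre u v n ^+ 2 + cim u v n ^+ 2).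

Lemma EN_ge0 a1 a2 b1 b2 : adm a1 a2 -> adm b1 b2 -> 0 <= EN a1 a2 b1 b2.
Proof.
by move=> ha hb; rewrite addr_ge0 //; apply: le_trans (en_lower _);
   rewrite // mulr_ge0 ?sq_ge0 // ltW.
Qed.

Lemma EN_rem_coef N :
  EN (fun x => u1 x - lc p1 r1 (cre u v) (cim u v) N x)
     (fun x => u2 x - lc p2 r2 (cre u v) (cim u v) N x)
     (fun x => v1 x - lc r1 p1 (cre u v) (fun n => - cim u v n) N x)
     (fun x => v2 x - lc r2 p2 (cre u v) (fun n => - cim u v n) N x) =
  EN u1 u2 v1 v2 - eng N.
Proof.
rewrite EN_rem [X in _ + X]big1 ?addr0 // => n _.
by rewrite !subrr expr0n /= addr0 mulr0.
Qed.

Lemma eng_le N : eng N <= EN u1 u2 v1 v2.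
Proof.
rewrite -subr_ge0 -EN_rem_coef; apply: EN_ge0.
  exact: W2_adm (W2B Wu (W2_lc _ _ N Wp Wr)).
exact: W2_adm (W2B Wv (W2_lc _ _ N Wr Wp)).
Qed.

Lemma eng_diff m n : (m <= n)%N -> eng n - eng m =
  \sum_(i < n | (m <= i)%N) lam i * (cre u v i ^+ 2 + cim u v i ^+ 2).
Proof. by move=> mn; rewrite -(sum_ord_diff (fun i => lam i * (cre u v i ^+ 2 + cim u v i ^+ 2)) mn). Qed.

Lemma eng_cauchy e : 0 < e -> exists N, forall m n, (N <= m)%N -> (m <= n)%N ->
  eng n - eng m <= e.
Proof.
move=> e0.
have nd : nondecreasing_seq eng.
  apply/nondecreasing_seqP => n; rewrite -subr_ge0 (eng_diff (leqnSn n)).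
  by apply: sumr_ge0 => i _; rewrite mulr_ge0 ?addr_ge0 ?sqr_ge0 // ltW // basis_gt0.
have ub : has_ubound (range eng).
  by exists (EN u1 u2 v1 v2) => _ [n _ <-]; exact: eng_le.
have cv' := nondecreasing_is_cvgn nd ub.
have le_lim n : eng n <= limn eng by exact: nondecreasing_cvgn_le.
have /cvgrPdist_le /(_ e e0) [N _ HN] := cv'.
exists N => m n Nm mn; have := HN m Nm; rewrite /= ger0_norm ?subr_ge0 //.
by have := le_lim n; lra.
Qed.

End Remainder.

(** Turns a block of modes [m <= i < n] into a partial sum starting at 0, to which the lemmas on
    [lc] apply. *)
Definition mask (m : nat) (d : nat -> R) (i : nat) : R := if (m <= i)%N then d i else 0.

Lemma lc_diff A B d e m n x : (m <= n)%N ->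
  lc A B d e n x - lc A B d e m x = lc A B (mask m d) (mask m e) n x.
Proof.
move=> mn; rewrite /lc (sum_ord_diff (fun i => d i * A i x - e i * B i x) mn) big_mkcond /=.
by apply: eq_bigr => i _; rewrite /mask; case: ifP; rewrite // !mul0r subrr.
Qed.

Lemma EN_lc d e N :
  EN (fun x => 0 - lc p1 r1 d e N x) (fun x => 0 - lc p2 r2 d e N x)
     (fun x => 0 - lc r1 p1 d (fun n => - e n) N x)
     (fun x => 0 - lc r2 p2 d (fun n => - e n) N x) =
  \sum_(n < N) lam n * (d n ^+ 2 + e n ^+ 2).
Proof.
have W0 : W2 l (fun=> 0 : R) (fun=> 0) (fun=> 0).
  by split; [exact: prim_cst|exact: prim_cst|exact: L2r_cst].
have C0 : clamped l (fun=> 0 : R) (fun=> 0) by [].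
have z w : ip (fun=> 0 : R) w = 0 by apply: ip_eq0.
rewrite (EN_rem W0 C0 W0 C0) /cre /cim.
rewrite (_ : EN _ _ _ _ = 0); last first.
  rewrite /EN /en (@Int_ext _ _ _ _ (fun=> 0)) => [|x _]; last by ring.
  by rewrite Int_cst // mul0r addr0.
rewrite big1 ?subr0 ?add0r => [|n _]; last by rewrite !z subrr addr0 expr0n /= addr0 mulr0.
by apply: eq_bigr => n _; rewrite !z subrr addr0 !sub0r !sqrrN.
Qed.

(** * Parseval's identity for the energy and construction of the trace *)

Section Parseval.
Variables (u u1 u2 v v1 v2 : R -> R).
Hypotheses (Wu : W2 l u u1 u2) (Cu : clamped l u u1) (Wv : W2 l v v1 v2) (Cv : clamped l v v1).
Notation c := (cre u v).
Notation d := (cim u v).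
Hypothesis complete : forall e, 0 < e -> exists N, forall n, (N <= n)%N ->
  sq 0 l (fun x => u x - lc p r c d n x) +
  sq 0 l (fun x => v x - lc r p c (fun n => - d n) n x) <= e.

(** Two remainders differ by a block of modes. Its energy is a difference of partial sums [eng], and
    dominates [sigma0] times the squared norm of its second derivative. *)
Lemma rem_cauchy e : 0 < e -> exists N, forall m n, (N <= m)%N -> (N <= n)%N ->
  sq 0 l (fun x => (u2 x - lc p2 r2 c d m x) - (u2 x - lc p2 r2 c d n x)) <= e /\
  sq 0 l (fun x => (v2 x - lc r2 p2 c (fun n => - d n) m x)
                   - (v2 x - lc r2 p2 c (fun n => - d n) n x)) <= e.
Proof.
move=> e0; have [N HN] := eng_cauchy Wu Cu Wv Cv (mulr_gt0 sigma0_gt0 e0).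
have main m n : (N <= m)%N -> (m <= n)%N ->
    sq 0 l (fun x => (u2 x - lc p2 r2 c d m x) - (u2 x - lc p2 r2 c d n x)) <= e /\
    sq 0 l (fun x => (v2 x - lc r2 p2 c (fun n => - d n) m x)
                   - (v2 x - lc r2 p2 c (fun n => - d n) n x)) <= e.
  move=> Nm mn.
  have E := EN_lc (mask m c) (mask m d) n.
  have W0 : W2 l (fun=> 0 : R) (fun=> 0) (fun=> 0).
    by split; [exact: prim_cst|exact: prim_cst|exact: L2r_cst].
  have a1 := en_lower (W2_adm (W2B W0 (W2_lc (mask m c) (mask m d) n Wp Wr))).
  have a2 := en_lower (W2_adm (W2B W0 (W2_lc (mask m c) (fun n => - mask m d n) n Wr Wp))).
  have b : \sum_(i < n) lam i * (mask m c i ^+ 2 + mask m d i ^+ 2) = eng u v n - eng u v m.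
    rewrite eng_diff // [RHS]big_mkcond /=; apply: eq_bigr => i _; rewrite /mask.
    by case: ifP => // _; rewrite expr0n /= addr0 mulr0.
  have hb := HN m n Nm mn; rewrite -b -E in hb.
  have e1 : sq 0 l (fun x => (u2 x - lc p2 r2 c d m x) - (u2 x - lc p2 r2 c d n x)) =
      sq 0 l (fun x => 0 - lc p2 r2 (mask m c) (mask m d) n x).
    by apply: Int_ext => x _; rewrite -lc_diff //; ring.
  have e2 : sq 0 l (fun x => (v2 x - lc r2 p2 c (fun n => - d n) m x)
                   - (v2 x - lc r2 p2 c (fun n => - d n) n x)) =
      sq 0 l (fun x => 0 - lc r2 p2 (mask m c) (fun n => - mask m d n) n x).
    rewrite (_ : (fun n => - mask m d n) = mask m (fun n => - d n)).
      by apply: Int_ext => x _; rewrite -lc_diff //; ring.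
    by apply/funext => i; rewrite /mask; case: ifP; rewrite ?oppr0.
  have div x : sigma0 * x <= sigma0 * e -> x <= e by rewrite ler_pM2l.
  rewrite e1 e2.
  have s1 := sq_ge0 0 l (fun x => 0 - lc p2 r2 (mask m c) (mask m d) n x).
  have s2 := sq_ge0 0 l (fun x => 0 - lc r2 p2 (mask m c) (fun n => - mask m d n) n x).
  have {}s1 := mulr_ge0 (ltW sigma0_gt0) s1; have {}s2 := mulr_ge0 (ltW sigma0_gt0) s2.
  by rewrite /EN in hb; split; apply: div; lra.
exists N => m n Nm Nn; have [mn|/ltnW nm] := leqP m n; first exact: main.
have [h1 h2] := main n m Nn nm; split.
  by apply: le_trans h1; rewrite le_eqVlt; apply/orP; left; apply/eqP; apply: Int_ext => x _; ring.
by apply: le_trans h2; rewrite le_eqVlt; apply/orP; left; apply/eqP; apply: Int_ext => x _; ring.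
Qed.

(** The remainders tend to zero in mean square by completeness of the eigenbasis, and their second
    derivatives are Cauchy; closability makes the limit of the latter zero. *)
Lemma rem_cvg e : 0 < e -> exists N, forall n, (N <= n)%N ->
  sq 0 l (fun x => u2 x - lc p2 r2 c d n x) +
  sq 0 l (fun x => v2 x - lc r2 p2 c (fun n => - d n) n x) <= e.
Proof.
move=> e0; have h2 : 0 < e / 2 by rewrite divr_gt0.
have HWu n := W2B Wu (W2_lc c d n Wp Wr); have HCu n := clampedB Cu (clamped_lc c d n Cp Cr).
have HWv n := W2B Wv (W2_lc c (fun n => - d n) n Wr Wp).
have HCv n := clampedB Cv (clamped_lc c (fun n => - d n) n Cr Cp).
have [N1 HN1] : exists N, forall n, (N <= n)%N -> sq 0 l (fun x => u2 x - lc p2 r2 c d n x) <= e / 2.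
  apply: (W2_closable l0 HWu _ _ _ _ h2).
  - by move=> n; case: (HCu n).
  - by move=> n; case: (HCu n).
  - move=> e' e'0; have [N HN] := rem_cauchy e'0; exists N => m n Nm Nn.
    by case: (HN m n Nm Nn).
  - move=> e' e'0; have [N HN] := complete e'0; exists N => n Nn; apply: le_trans (HN n Nn).
    by rewrite lerDl sq_ge0.
have [N2 HN2] : exists N, forall n, (N <= n)%N ->
    sq 0 l (fun x => v2 x - lc r2 p2 c (fun n => - d n) n x) <= e / 2.
  apply: (W2_closable l0 HWv _ _ _ _ h2).
  - by move=> n; case: (HCv n).
  - by move=> n; case: (HCv n).
  - move=> e' e'0; have [N HN] := rem_cauchy e'0; exists N => m n Nm Nn.
    by case: (HN m n Nm Nn).
  - move=> e' e'0; have [N HN] := complete e'0; exists N => n Nn; apply: le_trans (HN n Nn).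
    by rewrite lerDr sq_ge0.
exists (maxn N1 N2) => n; rewrite geq_max => /andP[n1 n2].
by have := HN1 n n1; have := HN2 n n2; lra.
Qed.

(** The energy lost by truncation is that of the remainder, at most [M] times the squared norm of
    its second derivative. With [eng_le] this is Parseval's identity. *)
Lemma eng_cvg e : 0 < e -> exists N, EN u1 u2 v1 v2 - e <= eng u v N.
Proof.
move=> e0; pose M := sigmaM + qM * l ^+ 2.
have M0 : 0 < M by rewrite ltr_pwDl // mulr_ge0 // sqr_ge0.
have [N HN] := rem_cvg (divr_gt0 e0 M0); exists N.
have HWu := W2B Wu (W2_lc c d N Wp Wr); have [_ HCu _ _] := clampedB Cu (clamped_lc c d N Cp Cr).
have HWv := W2B Wv (W2_lc c (fun n => - d n) N Wr Wp).
have [_ HCv _ _] := clampedB Cv (clamped_lc c (fun n => - d n) N Cr Cp).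
have h1 := en_upper HWu HCu; have h2 := en_upper HWv HCv.
have := HN N (leqnn N); rewrite ler_pdivlMr // => h3.
have := EN_rem_coef Wu Cu Wv Cv N; rewrite /EN; move: h1 h2 h3; rewrite -/M; lra.
Qed.

(* Real and imaginary parts of the coefficients of the trace at [l]. *)
Definition tal (n : nat) : R := c n * p2 n l - d n * r2 n l.
Definition tbe (n : nat) : R := c n * r2 n l + d n * p2 n l.

(** The coefficient of [e^(i lam_n t)] has squared modulus [|c_n|^2 |Phi_n''(l)|^2], comparable to
    the energy [lam_n |c_n|^2] of the mode. Ingham's inequality on blocks of modes makes the partial
    sums Cauchy; on partial sums it yields the two bounds in the limit. *)
Lemma trace_exists (T ct Ct ci Ci : R) : 0 < ct -> 0 < Ct -> 0 < ci -> 0 < Ci ->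
  (forall n, ct * lam n <= p2 n l ^+ 2 + r2 n l ^+ 2 <= Ct * lam n) ->
  (forall (I : finType) (P : pred I) (al be la : I -> R),
    (forall i, P i -> eigenval (la i)) ->
    (forall i j, P i -> P j -> la i = la j -> i = j) ->
    ci * nrm P al be <= Int 0 T (tsq P al be la) <= Ci * nrm P al be) ->
  exists gr gi, [/\ L2r 0 T gr, L2r 0 T gi,
    forall e, 0 < e -> exists N, forall n, (N <= n)%N ->
      sq 0 T (fun t => gr t - \sum_(i < n) (tal i * cos (lam i * t) - tbe i * sin (lam i * t))) +
      sq 0 T (fun t => gi t - \sum_(i < n) (tal i * sin (lam i * t) + tbe i * cos (lam i * t))) <= e &
    ci * ct / 2 * EN u1 u2 v1 v2 <= sq 0 T gr + sq 0 T gi <= 2 * (Ci * Ct) * EN u1 u2 v1 v2].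
Proof.
move=> ct0 Ct0 ci0 Ci0 Ht Hi.
pose tr n (P : pred nat) t := \sum_(i < n | P i) (tal i * cos (lam i * t) - tbe i * sin (lam i * t)).
pose ti n (P : pred nat) t := \sum_(i < n | P i) (tal i * sin (lam i * t) + tbe i * cos (lam i * t)).
have ctr n P : cont 0 T (tr n P) by apply: continuous_cont; exact: continuous_tre.
have cti n P : cont 0 T (ti n P) by apply: continuous_cont; exact: continuous_tim.
have Ltr n P := L2r_cont (ctr n P); have Lti n P := L2r_cont (cti n P).
pose E n (P : pred nat) := \sum_(i < n | P i) lam i * (c i ^+ 2 + d i ^+ 2).
(* The predicate [P] lets one estimate serve for whole partial sums and for blocks. *)
have B n (P : pred nat) : ci * ct * E n P <= sq 0 T (tr n P) + sq 0 T (ti n P) <= Ci * Ct * E n P.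
  have -> : sq 0 T (tr n P) + sq 0 T (ti n P) =
      Int 0 T (tsq (fun i : 'I_n => P i) (fun i : 'I_n => tal i) (fun i : 'I_n => tbe i) (fun i : 'I_n => lam i)).
    by rewrite /sq -IntD //; [exact: (Ltr n P).2|exact: (Lti n P).2].
  have /andP[h1 h2] := Hi 'I_n (fun i : 'I_n => P i) (fun i : 'I_n => tal i) (fun i : 'I_n => tbe i)
    (fun i : 'I_n => lam i) (fun i _ => basis_eigenval i)
    (fun i j _ _ e => val_inj (basis_inj e)).
  have nE i : tal i ^+ 2 + tbe i ^+ 2 = (c i ^+ 2 + d i ^+ 2) * (p2 i l ^+ 2 + r2 i l ^+ 2).
    by rewrite /tal /tbe; ring.
  apply/andP; split; [apply: le_trans h1|apply: le_trans h2 _].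
    rewrite -mulrA ler_pM2l // /E /nrm mulr_sumr; apply: ler_sum => i _.
    rewrite nE mulrCA [leLHS]mulrCA mulrA [leLHS]mulrC ler_wpM2l ?addr_ge0 ?sqr_ge0 //.
    by have /andP[] := Ht i.
  rewrite -mulrA ler_pM2l // /E /nrm mulr_sumr; apply: ler_sum => i _.
  rewrite nE mulrA [leRHS]mulrC ler_wpM2l ?addr_ge0 ?sqr_ge0 //.
  by have /andP[] := Ht i.
have CC : 0 < Ci * Ct by rewrite mulr_gt0.
have cauchy e : 0 < e -> exists N, forall m n, (N <= m)%N -> (N <= n)%N ->
    sq 0 T (fun t => tr m predT t - tr n predT t) + sq 0 T (fun t => ti m predT t - ti n predT t) <= e.
  move=> e0; have [N HN] := eng_cauchy Wu Cu Wv Cv (divr_gt0 e0 CC).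
  have main m n : (N <= m)%N -> (m <= n)%N ->
      sq 0 T (fun t => tr n predT t - tr m predT t) + sq 0 T (fun t => ti n predT t - ti m predT t) <= e.
    move=> Nm mn; rewrite (@sq_ext _ _ _ _ (tr n (fun i => m <= i)%N)) => [|t _]; last first.
      exact: (sum_ord_diff (fun i => tal i * cos (lam i * t) - tbe i * sin (lam i * t)) mn).
    rewrite (@sq_ext _ _ _ (fun t => ti n _ t - _) (ti n (fun i => m <= i)%N)) => [|t _]; last first.
      exact: (sum_ord_diff (fun i => tal i * sin (lam i * t) + tbe i * cos (lam i * t)) mn).
    have /andP[_ h] := B n (fun i => m <= i)%N; apply: le_trans h _.
    have := HN m n Nm mn; rewrite eng_diff // -/(E n (fun i => m <= i)%N) ler_pdivlMr //.
    by rewrite mulrC.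
  exists N => m n Nm Nn; have [mn|/ltnW nm] := leqP m n; last exact: main.
  rewrite (@sq_ext _ _ _ _ (fun t => -1 * (tr n predT t - tr m predT t))) => [|t _]; last by ring.
  rewrite (@sq_ext _ _ _ (fun t => ti m _ t - _) (fun t => -1 * (ti n predT t - ti m predT t))) => [|t _]; last by ring.
  by rewrite !sqZ ?expr2 ?mulrNN ?mulr1 ?mul1r; [exact: main|exact: L2rB|exact: L2rB].
have [gr grL Hgr] : exists2 g, L2r 0 T g & forall e, 0 < e -> exists N, forall n, (N <= n)%N ->
     sq 0 T (fun x => tr n predT x - g x) <= e.
  apply: L2_complete => [n|e e0]; first exact: Ltr.
  have [N HN] := cauchy e e0; exists N => m n Nm Nn; apply: le_trans (HN m n Nm Nn).
  by rewrite lerDl sq_ge0.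
have [gi giL Hgi] : exists2 g, L2r 0 T g & forall e, 0 < e -> exists N, forall n, (N <= n)%N ->
     sq 0 T (fun x => ti n predT x - g x) <= e.
  apply: L2_complete => [n|e e0]; first exact: Lti.
  have [N HN] := cauchy e e0; exists N => m n Nm Nn; apply: le_trans (HN m n Nm Nn).
  by rewrite lerDr sq_ge0.
have conv e : 0 < e -> exists N, forall n, (N <= n)%N ->
    sq 0 T (fun t => gr t - tr n predT t) + sq 0 T (fun t => gi t - ti n predT t) <= e.
  move=> e0; have h2 : 0 < e / 2 by rewrite divr_gt0.
  have [N1 HN1] := Hgr _ h2; have [N2 HN2] := Hgi _ h2.
  exists (maxn N1 N2) => n; rewrite geq_max => /andP[n1 n2].
  rewrite (@sq_ext _ _ _ _ (fun t => -1 * (tr n predT t - gr t))) => [|t _]; last by ring.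
  rewrite (@sq_ext _ _ _ (fun t => gi t - _) (fun t => -1 * (ti n predT t - gi t))) => [|t _]; last by ring.
  rewrite !sqZ ?expr2 ?mulrNN ?mulr1 ?mul1r; [|exact: L2rB|exact: L2rB].
  by have := HN1 n n1; have := HN2 n n2; lra.
exists gr, gi; split => //.
(* The inequality [|a + b|^2 <= 2 |a|^2 + 2 |b|^2], used to compare the limit with partial sums, is
   the origin of the factors [1 / 2] and [2] in the final bounds. *)
have sub n : sq 0 T (tr n predT) + sq 0 T (ti n predT) <= 2 * (sq 0 T gr + sq 0 T gi)
   + 2 * (sq 0 T (fun t => gr t - tr n predT t) + sq 0 T (fun t => gi t - ti n predT t)).
  rewrite (@sq_ext _ _ _ _ (fun t => gr t - (gr t - tr n predT t))) => [|t _]; last by ring.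
  rewrite (@sq_ext _ _ _ (ti n predT) (fun t => gi t - (gi t - ti n predT t))) => [|t _]; last by ring.
  have h1 := sqB_le grL (L2rB grL (Ltr n predT)); have h2 := sqB_le giL (L2rB giL (Lti n predT)).
  lra.
have sup n : sq 0 T gr + sq 0 T gi <= 2 * (sq 0 T (tr n predT) + sq 0 T (ti n predT))
   + 2 * (sq 0 T (fun t => gr t - tr n predT t) + sq 0 T (fun t => gi t - ti n predT t)).
  rewrite (@sq_ext _ _ _ gr (fun t => tr n predT t + (gr t - tr n predT t))) => [|t _]; last by ring.
  rewrite (@sq_ext _ _ _ gi (fun t => ti n predT t + (gi t - ti n predT t))) => [|t _]; last by ring.
  have h1 := sqD_le (Ltr n predT) (L2rB grL (Ltr n predT)); have h2 := sqD_le (Lti n predT) (L2rB giL (Lti n predT)).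
  lra.
apply/andP; split; apply/ler_addgt0Pr => e e0.
- have cc : 0 < ci * ct by rewrite mulr_gt0.
  have e1 : 0 < e / (ci * ct) by rewrite divr_gt0.
  have [N1 HN1] := conv (e / 2) ltac:(by rewrite divr_gt0).
  have [N2 HN2] := eng_cvg e1.
  pose N := maxn N1 N2.
  have h1 := HN1 N (leq_maxl _ _).
  have h2 : EN u1 u2 v1 v2 - e / (ci * ct) <= eng u v N.
    apply: le_trans HN2 _; rewrite -subr_ge0 eng_diff ?leq_maxr // sumr_ge0 // => i _.
    by rewrite mulr_ge0 ?addr_ge0 ?sqr_ge0 // ltW // basis_gt0.
  have /andP[h3 _] := B N predT; have h4 := sub N.
  have : ci * ct * (EN u1 u2 v1 v2 - e / (ci * ct)) <= ci * ct * eng u v N by rewrite ler_pM2l.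
  rewrite mulrBr mulrCA mulfV ?gt_eqF // mulr1 => h5; move: h3; rewrite /E -/(eng u v N); lra.
- have [N HN] := conv (e / 2) ltac:(by rewrite divr_gt0).
  have h1 := HN N (leqnn _); have h2 := sup N; have /andP[_ h3] := B N predT.
  have h4 : Ci * Ct * eng u v N <= Ci * Ct * EN u1 u2 v1 v2 by rewrite ler_pM2l //; exact: eng_le.
  move: h3; rewrite /E -/(eng u v N); lra.
Qed.

End Parseval.

End Basis.

End Beam.

(** * The evolution problem *)

Section ComplexParts.
Context {R : realType}.
Notation mu := (@lebesgue_measure R).
Notation Rec := complex.Re.
Notation Imc := complex.Im.

Lemma Re_sumM (N : nat) (z : nat -> R[i]) (w : nat -> R[i]) :
  Rec (\sum_(n < N) z n * w n) = \sum_(n < N) (Rec (z n) * Rec (w n) - Imc (z n) * Imc (w n)).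
Proof.
elim: N => [|N IH]; first by rewrite !big_ord0.
by rewrite !big_ord_recr -IH /=; case: (\sum_(i < N) _) => a b; case: (z N) => c d; case: (w N).
Qed.

Lemma Im_sumM (N : nat) (z : nat -> R[i]) (w : nat -> R[i]) :
  Imc (\sum_(n < N) z n * w n) = \sum_(n < N) (Rec (z n) * Imc (w n) + Imc (z n) * Rec (w n)).
Proof.
elim: N => [|N IH]; first by rewrite !big_ord0.
by rewrite !big_ord_recr -IH /=; case: (\sum_(i < N) _) => a b; case: (z N) => c d; case: (w N).
Qed.

Lemma ReB (z w : R[i]) : Rec (z - w) = Rec z - Rec w.
Proof. by case: z => ? ?; case: w. Qed.

Lemma ImB (z w : R[i]) : Imc (z - w) = Imc z - Imc w.
Proof. by case: z => ? ?; case: w. Qed.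

Lemma complex_eq (z w : R[i]) : Rec z = Rec w -> Imc z = Imc w -> z = w.
Proof. by case: z => ? ?; case: w => ? ? /= -> ->. Qed.

Lemma itg_lty (a b : R) f : itg a b f -> (forall x, a <= x <= b -> 0 <= f x) ->
  (\int[mu]_(x in `[a, b]) (f x)%:E < +oo)%E.
Proof.
move=> /integrableP[_ +] f0; apply: le_lt_trans; rewrite le_eqVlt; apply/orP; left; apply/eqP.
by apply: eq_integral => x; rewrite inE /= in_itv => xl; rewrite ger0_norm // f0.
Qed.

Section Products.
Variables (l : R) (rho sigma q : R -> R).
Hypotheses (crho : cont 0 l rho) (csigma : cont 0 l sigma) (cq : cont 0 l q).

Lemma ipL2_parts (u v : R -> R[i]) :
  cont 0 l (fun x => Rec (u x)) -> cont 0 l (fun x => Imc (u x)) ->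
  cont 0 l (fun x => Rec (v x)) -> cont 0 l (fun x => Imc (v x)) ->
  ipL2 0 l rho u v =
  (ip l rho (fun x => Rec (u x)) (fun x => Rec (v x)) + ip l rho (fun x => Imc (u x)) (fun x => Imc (v x)))
  +i* (ip l rho (fun x => Imc (u x)) (fun x => Rec (v x)) - ip l rho (fun x => Rec (u x)) (fun x => Imc (v x))).
Proof.
move=> cur cui cvr cvi.
have itp f g : cont 0 l f -> cont 0 l g -> itg 0 l (fun x => rho x * f x * g x).
  by move=> cf cg; apply: cont_itg; cont_tac.
rewrite /ipL2 /cint /ip; congr (_ +i* _).
  rewrite -IntD; [|exact: itp|exact: itp].
  by apply: Int_ext => x _; case: (u x) => a b; case: (v x) => c d /=; ring.
rewrite -IntB; [|exact: itp|exact: itp].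
by apply: Int_ext => x _; case: (u x) => a b; case: (v x) => c d /=; ring.
Qed.

Lemma formA_parts (u v : R -> R[i]) : H20 l u -> H20 l v ->
  let ur := fun x => Rec (cderiv l u x) in let ui := fun x => Imc (cderiv l u x) in
  let vr := fun x => Rec (cderiv l v x) in let vi := fun x => Imc (cderiv l v x) in
  let ur2 := fun x => Rec (cderiv l (cderiv l u) x) in
  let ui2 := fun x => Imc (cderiv l (cderiv l u) x) in
  let vr2 := fun x => Rec (cderiv l (cderiv l v) x) in
  let vi2 := fun x => Imc (cderiv l (cderiv l v) x) in
  formA l sigma q u v =
  (en l sigma q ur ur2 vr vr2 + en l sigma q ui ui2 vi vi2)
  +i* (en l sigma q ui ui2 vr vr2 - en l sigma q ur ur2 vi vi2).
Proof.
move=> Hu Hv ur ui vr vi ur2 ui2 vr2 vi2.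
have [[/W2_adm aur _] [/W2_adm aui _]] := H20_parts Hu.
have [[/W2_adm avr _] [/W2_adm avi _]] := H20_parts Hv.
have eni a1 a2 b1 b2 : adm l a1 a2 -> adm l b1 b2 ->
    itg 0 l (fun x => sigma x * a2 x * b2 x + q x * a1 x * b1 x).
  move=> [ca1 La2] [cb1 Lb2]; apply: itgD; last by apply: cont_itg; cont_tac.
  by apply: itg_ext (itg_cmul csigma (L2r_mul La2 Lb2)) => x _; exact: mulrA.
rewrite /formA /cint /en; congr (_ +i* _).
  refine (etrans _ (IntD (eni _ _ _ _ aur avr) (eni _ _ _ _ aui avi))).
  apply: Int_ext => x _; rewrite /ur /ui /vr /vi /ur2 /ui2 /vr2 /vi2.
  case: (cderiv l (cderiv l u) x) => a2 b2; case: (cderiv l (cderiv l v) x) => c2 d2.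
  by case: (cderiv l u x) => a1 b1; case: (cderiv l v x) => c1 d1 /=; ring.
refine (etrans _ (IntB (eni _ _ _ _ aui avr) (eni _ _ _ _ aur avi))).
apply: Int_ext => x _; rewrite /ur /ui /vr /vi /ur2 /ui2 /vr2 /vi2.
case: (cderiv l (cderiv l u) x) => a2 b2; case: (cderiv l (cderiv l v) x) => c2 d2.
by case: (cderiv l u x) => a1 b1; case: (cderiv l v x) => c1 d1 /=; ring.
Qed.

Lemma sqnormL2_parts (u : R -> R[i]) :
  cont 0 l (fun x => Rec (u x)) -> cont 0 l (fun x => Imc (u x)) ->
  sqnormL2 0 l rho u =
  ip l rho (fun x => Rec (u x)) (fun x => Rec (u x)) + ip l rho (fun x => Imc (u x)) (fun x => Imc (u x)).
Proof.
move=> cr ci; rewrite /ip -IntD; [|by apply: cont_itg; cont_tac|by apply: cont_itg; cont_tac].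
by apply: Int_ext => x _; rewrite /sqmod; ring.
Qed.

Lemma L2_cont (u : R -> R[i]) : (forall x, 0 <= x <= l -> 0 <= rho x) ->
  cont 0 l (fun x => Rec (u x)) -> cont 0 l (fun x => Imc (u x)) -> L2 0 l rho u.
Proof.
move=> rho0 cr ci; split; [exact: cont_meas|exact: cont_meas|].
apply: itg_lty => [|x xl]; first by apply: cont_itg; rewrite /sqmod; cont_tac.
by rewrite mulr_ge0 ?rho0 // addr_ge0 ?sqr_ge0.
Qed.

End Products.

Lemma eps_cvg0 (u : nat -> R) : (forall n, 0 <= u n) ->
  (forall e, 0 < e -> exists N, forall n, (N <= n)%N -> u n <= e) ->
  u n @[n --> \oo] --> (0 : R).
Proof.
move=> u0 H; apply/cvgrPdist_le => e e0; have [N HN] := H e e0.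
by exists N => // n Nn /=; rewrite sub0r normrN ger0_norm // HN.
Qed.

Lemma cvg0_eps (u : nat -> R) : u n @[n --> \oo] --> (0 : R) ->
  forall e, 0 < e -> exists N, forall n, (N <= n)%N -> u n <= e.
Proof.
move=> /cvgrPdist_le H e e0; have [N _ HN] := H e e0.
exists N => n Nn; have := HN n Nn; rewrite /= sub0r normrN.
by apply: le_trans; exact: ler_norm.
Qed.

(** Scalar form of the continuity of a Fourier coefficient: [a] and [b] are the real products that
    compose it, [S1] and [S2] the squared norms of second derivatives, [P] and [Q] those of the
    parts of the eigenfunction. The 1 in the constant makes it positive. *)
Lemma sum_sqr_lipschitz (r B S1 S2 P Q H a b : R) : 0 < r -> 0 <= B -> 0 <= S1 -> 0 <= S2 -> 0 <= P ->
  0 <= Q -> r * (S1 + S2) <= H -> a ^+ 2 <= B * (S1 * P) -> b ^+ 2 <= B * (S2 * Q) ->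
  (a + b) ^+ 2 <= (2 * B * (P + Q) / r + 1) * H.
Proof.
move=> r0 B0 S10 S20 P0 Q0 low ha hb; set A := 2 * B * (P + Q).
have A0 : 0 <= A by rewrite !mulr_ge0 // addr_ge0.
have H0 : 0 <= H := le_trans (mulr_ge0 (ltW r0) (addr_ge0 S10 S20)) low.
have AH : A * (S1 + S2) <= (A / r + 1) * H.
  rewrite mulrDl mul1r -[leLHS]addr0 lerD // -mulrA ler_wpM2l // mulrC ler_pdivlMr //.
  by rewrite mulrC.
apply: le_trans AH.
have ab : (a + b) ^+ 2 <= 2 * (a ^+ 2 + b ^+ 2) by have := sqr_ge0 (a - b); lra.
have prod : S1 * P + S2 * Q <= (P + Q) * (S1 + S2).
  by have := mulr_ge0 S10 Q0; have := mulr_ge0 S20 P0; lra.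
have := ler_wpM2l B0 prod; rewrite /A; move: ab ha hb; lra.
Qed.

Lemma is_cderive_parts (f : R -> R[i]) t (d : R[i]) (a b : R) :
  is_cderive f t d -> (0 +i* 1) * d = - (a +i* b) ->
  is_derive t (1 : R) (fun s => Rec (f s)) (- b) /\ is_derive t (1 : R) (fun s => Imc (f s)) a.
Proof.
case: d => dr di [/= Hr Hi] []; rewrite !mul0r !mul1r sub0r add0r => /oppr_inj <- <-.
by split.
Qed.

End ComplexParts.

(** * From the complex eigenbasis to the real systems *)

Section Translation.
Context {R : realType}.
Notation Rec := complex.Re.
Notation Imc := complex.Im.
Variables (l : R) (rho rho1 sigma sigma1 q : R -> R) (rho0 rhoM sigma0 sigmaM qM : R).
Hypotheses (l0 : 0 < l) (rho0_gt0 : 0 < rho0) (sigma0_gt0 : 0 < sigma0)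
  (Hrho : prim 0 l rho rho1) (crho1 : cont 0 l rho1)
  (Hsigma : prim 0 l sigma sigma1) (csigma1 : cont 0 l sigma1) (cq : cont 0 l q)
  (rhob : forall x, 0 <= x <= l -> rho0 <= rho x <= rhoM)
  (sigmab : forall x, 0 <= x <= l -> sigma0 <= sigma x <= sigmaM)
  (qb : forall x, 0 <= x <= l -> 0 <= q x <= qM)
  (Hsigma2 : sobR l 2 sigma) (sigma1E : sigma1 = rderiv l sigma) (Hq1 : sobR l 1 q).
Variables (lambda : nat -> R) (Phi : nat -> R -> R[i]).
Hypothesis HPhi : eigenbasis l rho sigma q lambda Phi.

Notation ip := (ip l rho).
Let crho : cont 0 l rho. Proof. exact: prim_cont Hrho. Qed.
Let csigma : cont 0 l sigma. Proof. exact: prim_cont Hsigma. Qed.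
Let rho_gt0 x : 0 <= x <= l -> 0 < rho x.
Proof. by move=> /rhob /andP[h _]; exact: lt_le_trans h. Qed.
Let rho_ge0 x : 0 <= x <= l -> 0 <= rho x.
Proof. by move=> /rho_gt0 /ltW. Qed.

Definition re0 (u : R -> R[i]) x := Rec (u x).
Definition im0 (u : R -> R[i]) x := Imc (u x).
Notation re1 u := (re0 (cderiv l u)).
Notation im1 u := (im0 (cderiv l u)).
Notation re2 u := (re0 (cderiv l (cderiv l u))).
Notation im2 u := (im0 (cderiv l (cderiv l u))).
Notation p := (fun n => re0 (Phi n)).
Notation r := (fun n => im0 (Phi n)).
Notation p1 := (fun n => re1 (Phi n)).
Notation r1 := (fun n => im1 (Phi n)).
Notation p2 := (fun n => re2 (Phi n)).
Notation r2 := (fun n => im2 (Phi n)).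

Let HPhi20 n : H20 l (Phi n).
Proof. by case: HPhi => /(_ n)[]. Qed.

Lemma H20_cont u : H20 l u -> cont 0 l (re0 u) /\ cont 0 l (im0 u).
Proof. by move=> /H20_parts [[[/prim_cont ? _ _] _] [[/prim_cont ? _ _] _]]. Qed.

Lemma Phi_beam n :
  (exists k1 W, beam l rho sigma sigma1 q (lambda n) (fun=> 0) (p n) (p1 n) (p2 n) k1 W) /\
  (exists k1 W, beam l rho sigma sigma1 q (lambda n) (fun=> 0) (r n) (r1 n) (r2 n) k1 W).
Proof. by have [/(_ n) h1 /(_ n) h2 _ _] := HPhi; exact: (eigenfunction_parts l0 Hsigma2 sigma1E Hq1 crho rho_gt0 h1 h2). Qed.

Let Hp n := (Phi_beam n).1.
Let Hr n := (Phi_beam n).2.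

Lemma ipL2_H20 u v : H20 l u -> H20 l v -> ipL2 0 l rho u v =
  (ip (re0 u) (re0 v) + ip (im0 u) (im0 v)) +i* (ip (im0 u) (re0 v) - ip (re0 u) (im0 v)).
Proof. by move=> /H20_cont[? ?] /H20_cont[? ?]; exact: ipL2_parts. Qed.

Lemma Phi_ortho m n : ip (p m) (p n) + ip (r m) (r n) = (m == n)%:R /\
  ip (r m) (p n) - ip (p m) (r n) = 0.
Proof.
have [_ _ /(_ m n) + _] := HPhi; rewrite ipL2_H20 //.
by case: (m == n) => -[-> ->].
Qed.

Let oR m n := (Phi_ortho m n).1.
Let oI m n := (Phi_ortho m n).2.

Definition cr (u : R -> R[i]) := cre l rho p r (re0 u) (im0 u).
Definition ci (u : R -> R[i]) := cim l rho p r (re0 u) (im0 u).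

Lemma coefE u n : H20 l u -> coef l rho Phi u n = cr u n +i* ci u n.
Proof. by move=> Hu; rewrite /coef ipL2_H20. Qed.

Lemma rem_Re u (z : nat -> R[i]) N : re0 (fun x => u x - \sum_(n < N) z n * Phi n x) =
  (fun x => re0 u x - lc p r (fun n => Rec (z n)) (fun n => Imc (z n)) N x).
Proof. by apply/funext => x; rewrite /re0 ReB (Re_sumM N z (fun n => Phi n x)). Qed.

Lemma rem_Im u (z : nat -> R[i]) N : im0 (fun x => u x - \sum_(n < N) z n * Phi n x) =
  (fun x => im0 u x - lc r p (fun n => Rec (z n)) (fun n => - Imc (z n)) N x).
Proof.
apply/funext => x; rewrite /im0 ImB (Im_sumM N z (fun n => Phi n x)); congr (_ - _).
by apply: eq_bigr => n _; rewrite mulNr opprK.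
Qed.

Lemma weighted_sq a : L2r 0 l a ->
  rho0 * sq 0 l a <= Int 0 l (fun x => rho x * a x ^+ 2) <= rhoM * sq 0 l a.
Proof.
move=> [_ a2]; rewrite -!IntZ //; apply/andP; split; apply: Int_le.
- exact: itgZ.
- exact: itg_cmul.
- by move=> x xl; rewrite ler_wpM2r ?sqr_ge0 //; case/andP: (rhob xl).
- exact: itg_cmul.
- exact: itgZ.
- by move=> x xl; rewrite ler_wpM2r ?sqr_ge0 //; case/andP: (rhob xl).
Qed.

Lemma sqnormH20_bounds (f : R -> R[i]) a1 a2 b1 b2 : W2 l (re0 f) a1 a2 -> W2 l (im0 f) b1 b2 ->
  rho0 * (sq 0 l a2 + sq 0 l b2) <= sqnormH20 l rho f <= rhoM * (sq 0 l a2 + sq 0 l b2).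
Proof.
move=> Ha Hb; rewrite (sqnormH20E l0 crho rho_ge0 Ha Hb).
have [_ _ /weighted_sq /andP[h1 h2]] := Ha; have [_ _ /weighted_sq /andP[h3 h4]] := Hb.
by rewrite !mulrDr !lerD.
Qed.

Section Element.
Variable u : R -> R[i].
Hypothesis Hu : H20 l u.

Let Wur : W2 l (re0 u) (re1 u) (re2 u). Proof. exact: (H20_parts Hu).1.1. Qed.
Let Cur : clamped l (re0 u) (re1 u). Proof. exact: (H20_parts Hu).1.2. Qed.
Let Wui : W2 l (im0 u) (im1 u) (im2 u). Proof. exact: (H20_parts Hu).2.1. Qed.
Let Cui : clamped l (im0 u) (im1 u). Proof. exact: (H20_parts Hu).2.2. Qed.
Let WPr n : W2 l (p n) (p1 n) (p2 n). Proof. exact: (H20_parts (HPhi20 n)).1.1. Qed.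
Let WPi n : W2 l (r n) (r1 n) (r2 n). Proof. exact: (H20_parts (HPhi20 n)).2.1. Qed.

Let coef_Re : (fun n => Rec (coef l rho Phi u n)) = cr u.
Proof. by apply/funext => n; rewrite coefE. Qed.
Let coef_Im : (fun n => Imc (coef l rho Phi u n)) = ci u.
Proof. by apply/funext => n; rewrite coefE. Qed.
Let coef_ImN : (fun n => - Imc (coef l rho Phi u n)) = (fun n => - ci u n).
Proof. by apply/funext => n; rewrite coefE. Qed.

(** Completeness is known in the weighted complex norm; [rho >= rho0] transfers it to the unweighted
    norms of the two parts. *)
Lemma complete_parts e : 0 < e -> exists N, forall n, (N <= n)%N ->
  sq 0 l (fun x => re0 u x - lc p r (cr u) (ci u) n x) +
  sq 0 l (fun x => im0 u x - lc r p (cr u) (fun n => - ci u n) n x) <= e.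
Proof.
move=> e0; have [ucr uci] := H20_cont Hu.
have [_ _ _ /(_ u (L2_cont crho rho_ge0 ucr uci)) /cvg0_eps H] := HPhi.
have [N HN] := H (rho0 * e) (mulr_gt0 rho0_gt0 e0); exists N => n Nn.
have := HN n Nn.
have c1 : cont 0 l (re0 (fun x => u x - \sum_(i < n) coef l rho Phi u i * Phi i x)).
  rewrite rem_Re; apply: contB => //.
  by have [/prim_cont h _ _] := W2_lc (fun n => Rec (coef l rho Phi u n)) (fun n => Imc (coef l rho Phi u n)) n WPr WPi.
have c2 : cont 0 l (im0 (fun x => u x - \sum_(i < n) coef l rho Phi u i * Phi i x)).
  rewrite rem_Im; apply: contB => //.
  by have [/prim_cont h _ _] := W2_lc (fun n => Rec (coef l rho Phi u n)) (fun n => - Imc (coef l rho Phi u n)) n WPi WPr.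
rewrite sqnormL2_parts //.
have h1 := ip_lower Hrho rhob c1; have h2 := ip_lower Hrho rhob c2.
rewrite rem_Re coef_Re coef_Im in h1; rewrite rem_Im coef_Re coef_ImN in h2.
rewrite -/(re0 _) -/(im0 _) rem_Re rem_Im coef_Re coef_Im coef_ImN => h3.
rewrite -(ler_pM2l rho0_gt0); lra.
Qed.

(** Upgrades completeness in mean square to convergence in [H20], through [rem_cvg]. The sequence
    [z] allows the coefficients at time [t] to be written in exponential form. *)
Lemma expansion_H20 (z : nat -> R[i]) : (forall n, z n = coef l rho Phi u n) ->
  sqnormH20 l rho (fun x => u x - \sum_(n < N) z n * Phi n x) @[N --> \oo] --> (0 : R).
Proof.
move=> /funext ->.
have B N := sqnormH20_bounds
  (eq_ind_r (fun f => W2 l f _ _) (W2B Wur (W2_lc _ _ N WPr WPi)) (rem_Re u (coef l rho Phi u) N))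
  (eq_ind_r (fun f => W2 l f _ _) (W2B Wui (W2_lc _ _ N WPi WPr)) (rem_Im u (coef l rho Phi u) N)).
rewrite coef_Re coef_Im coef_ImN in B.
have rhoM0 : 0 < rhoM.
  by have /andP[h1 h2] := rhob (x := 0) ltac:(by rewrite lexx ltW); exact: lt_le_trans rho0_gt0 (le_trans h1 h2).
apply: eps_cvg0 => [N|e e0].
  have /andP[h _] := B N; apply: le_trans h.
  by rewrite mulr_ge0 ?addr_ge0 ?sq_ge0 // ltW.
have [N HN] := rem_cvg l0 rho0_gt0 sigma0_gt0 Hrho Hsigma csigma1 cq rhob sigmab qb
  Hp Hr oR oI Wur Cur Wui Cui complete_parts (divr_gt0 e0 rhoM0).
exists N => n Nn; have /andP[_ h] := B n; apply: le_trans h _.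
by have := HN n Nn; rewrite ler_pdivlMr // mulrC.
Qed.

Lemma energy_equiv (E := EN l sigma q (re1 u) (re2 u) (im1 u) (im2 u)) :
  sigma0 / rhoM * sqnormH20 l rho u <= E <= (sigmaM + qM * l ^+ 2) / rho0 * sqnormH20 l rho u.
Proof.
have in0 : 0 <= (0 : R) <= l by rewrite lexx ltW.
have rhoM0 : 0 < rhoM.
  by have /andP[h1 h2] := rhob in0; exact: lt_le_trans rho0_gt0 (le_trans h1 h2).
have M0 : 0 <= sigmaM + qM * l ^+ 2.
  have /andP[h1 h2] := sigmab in0; have /andP[h3 h4] := qb in0.
  apply: addr_ge0; first exact: le_trans (ltW sigma0_gt0) (le_trans h1 h2).
  by apply: mulr_ge0; [exact: le_trans h3 h4|exact: sqr_ge0].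
have /andP[n1 n2] := sqnormH20_bounds Wur Wui.
have a1 := en_lower Hsigma cq sigmab qb (W2_adm Wur); have a2 := en_lower Hsigma cq sigmab qb (W2_adm Wui).
have [_ z1 _ _] := Cur; have [_ z2 _ _] := Cui.
have a3 := en_upper l0 Hsigma cq sigmab qb Wur z1; have a4 := en_upper l0 Hsigma cq sigmab qb Wui z2.
rewrite /E /EN; set S := sq 0 l _ + sq 0 l _ in n1 n2.
have hS : S <= sqnormH20 l rho u / rho0 by rewrite ler_pdivlMr // mulrC.
have Sh : sqnormH20 l rho u / rhoM <= S by rewrite ler_pdivrMr // mulrC.
apply/andP; split.
  apply: (@le_trans _ _ (sigma0 * S)); last first.
    by have h := lerD a1 a2; rewrite -mulrDr in h.
  by rewrite -mulrA (mulrC rhoM^-1); apply: ler_wpM2l => //; exact: ltW.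
apply: (@le_trans _ _ ((sigmaM + qM * l ^+ 2) * S)); first by have h := lerD a3 a4; rewrite -mulrDr in h.
by rewrite -mulrA (mulrC rho0^-1); apply: ler_wpM2l.
Qed.

End Element.

Lemma ip_sqr_le a a1 a2 w : W2 l a a1 a2 -> a 0 = 0 -> a1 0 = 0 -> cont 0 l w ->
  ip a w ^+ 2 <= rhoM ^+ 2 * l ^+ 4 * (sq 0 l a2 * sq 0 l w).
Proof.
move=> [H0 H1 a2L] z0 z1 cw; have ca := prim_cont H0; have ca1 := prim_cont H1.
have b1 := poincare_sq l0 H1 a2L z1; have b0 := poincare_sq l0 H0 (L2r_cont ca1) z0.
have aL := L2r_cont ca.
apply: (@le_trans _ _ (sq 0 l (fun x => rho x * a x) * sq 0 l w)).
  by apply: cauchy_schwarz; [exact: L2r_cmul|exact: L2r_cont].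
rewrite mulrA ler_wpM2r ?sq_ge0 //.
apply: (@le_trans _ _ (rhoM ^+ 2 * sq 0 l a)).
  rewrite -IntZ; last exact: aL.2.
  apply: Int_le; [exact: (L2r_cmul crho aL).2|by apply: itgZ; exact: aL.2|].
  move=> x xl; rewrite exprMn ler_wpM2r ?sqr_ge0 //.
  have /andP[h1 h2] := rhob xl; have := rho_ge0 xl => h3.
  by rewrite ler_pXn2r // nnegrE // (le_trans h3).
rewrite -mulrA ler_wpM2l ?sqr_ge0 //; apply: le_trans b0 _.
by rewrite (_ : l ^+ 4 = l ^+ 2 * l ^+ 2); [rewrite -mulrA ler_wpM2l ?sqr_ge0|ring].
Qed.

(** A solution is continuous in time with values in [H20]; this makes its Fourier coefficients
    continuous up to both ends of [[0, T]]. *)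
Lemma coef_lipschitz n : exists2 K, 0 < K & forall u v, H20 l u -> H20 l v ->
  (cr u n - cr v n) ^+ 2 <= K * sqnormH20 l rho (fun x => u x - v x) /\
  (ci u n - ci v n) ^+ 2 <= K * sqnormH20 l rho (fun x => u x - v x).
Proof.
have P0 := sq_ge0 0 l (p n); have Q0 := sq_ge0 0 l (r n).
have B0 : 0 <= rhoM ^+ 2 * l ^+ 4.
  by apply: mulr_ge0; [exact: sqr_ge0|rewrite exprn_ge0 // ltW].
exists (2 * (rhoM ^+ 2 * l ^+ 4) * (sq 0 l (p n) + sq 0 l (r n)) / rho0 + 1) => [|u v Hu Hv].
  rewrite ltr_wpDl // divr_ge0 ?(ltW rho0_gt0) //.
  by apply: mulr_ge0; [apply: mulr_ge0|exact: addr_ge0].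
have [[Wu Cu] [Wu' Cu']] := H20_parts Hu; have [[Wv Cv] [Wv' Cv']] := H20_parts Hv.
have [cpn crn] := H20_cont (HPhi20 n).
have [cu cu'] := H20_cont Hu; have [cv cv'] := H20_cont Hv.
have WD := W2B Wu Wv; have WD' := W2B Wu' Wv'.
have [z0 z1 _ _] := clampedB Cu Cv; have [z0' z1' _ _] := clampedB Cu' Cv'.
have e1 : re0 (fun x => u x - v x) = (fun x => re0 u x - re0 v x) by apply/funext => x; exact: ReB.
have e2 : im0 (fun x => u x - v x) = (fun x => im0 u x - im0 v x) by apply/funext => x; exact: ImB.
have WE := WD; have WE' := WD'.
rewrite -/(re0 u) -/(re0 v) in WE; rewrite -e1 in WE.
rewrite -/(im0 u) -/(im0 v) in WE'; rewrite -e2 in WE'.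
have /andP[low _] := sqnormH20_bounds WE WE'.
have q1 := ip_sqr_le WD z0 z1 cpn; have q2 := ip_sqr_le WD z0 z1 crn.
have q3 := ip_sqr_le WD' z0' z1' cpn; have q4 := ip_sqr_le WD' z0' z1' crn.
have ipB x y w : cont 0 l x -> cont 0 l y -> cont 0 l w ->
    ip (fun z => x z - y z) w = ip x w - ip y w by move=> *; apply: (ipBl Hrho).
have i1 := ipB _ _ _ cu cv cpn; have i2 := ipB _ _ _ cu cv crn.
have i3 := ipB _ _ _ cu' cv' cpn; have i4 := ipB _ _ _ cu' cv' crn.
rewrite i1 in q1; rewrite i2 -sqrrN in q2; rewrite i3 in q3; rewrite i4 in q4.
split.
  rewrite (_ : cr u n - cr v n = (ip (re0 u) (p n) - ip (re0 v) (p n))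
       + (ip (im0 u) (r n) - ip (im0 v) (r n))); last by rewrite /cr /cre; ring.
  exact: sum_sqr_lipschitz rho0_gt0 B0 (sq_ge0 _ _ _) (sq_ge0 _ _ _) P0 Q0 low q1 q4.
rewrite (_ : ci u n - ci v n = (ip (im0 u) (p n) - ip (im0 v) (p n))
     + - (ip (re0 u) (r n) - ip (re0 v) (r n))); last by rewrite /ci /cim; ring.
rewrite addrC in low.
exact: sum_sqr_lipschitz rho0_gt0 B0 (sq_ge0 _ _ _) (sq_ge0 _ _ _) P0 Q0 low q3 q2.
Qed.

(** * Fourier coefficients of a solution and its trace *)

Section Evolution.
Variables (T : R) (y0 : R -> R[i]) (y : R -> R -> R[i]).
Hypotheses (T0 : 0 < T) (Hy0 : H20 l y0) (Hy : solution l rho sigma q T y0 y).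

Let Hyt t : 0 <= t <= T -> H20 l (y t).
Proof. by have [h _ _ _] := Hy => tT; apply: h; rewrite in_itv. Qed.

Lemma small_cont (f : R -> R) (h : R -> R -> R) (K : R) : 0 < K ->
  (forall t s, 0 <= t <= T -> 0 <= s <= T -> (f s - f t) ^+ 2 <= K * h t s) ->
  (forall t, 0 <= t <= T -> h t s @[s --> within `[0, T] (nbhs t)] --> (0 : R)) -> cont 0 T f.
Proof.
move=> K0 fh hc; apply/subspace_continuousP => t; rewrite /= in_itv /= => tT.
apply/cvgrPdist_le => e e0.
have e1 : 0 < e ^+ 2 / K by rewrite divr_gt0 // exprn_gt0.
have /cvgrPdist_le /(_ _ e1) H := hc t tT.
near=> s.
have sT : 0 <= s <= T.
  have : s \in `[0, T] by near: s; exact: withinT.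
  by rewrite in_itv.
have hs : `|0 - h t s| <= e ^+ 2 / K by near: s.
have : h t s <= e ^+ 2 / K by apply: le_trans hs; rewrite sub0r normrN ler_norm.
rewrite ler_pdivlMr // mulrC => /(le_trans (fh t s tT sT)) h2.
have h3 : `|f s - f t| <= e.
  by rewrite -(@ler_pXn2r _ 2) ?nnegrE ?(ltW e0) // real_normK ?num_real.
by rewrite distrC.
Unshelve. all: by end_near. Qed.

Lemma coef_cont n : cont 0 T (fun t => cr (y t) n) /\ cont 0 T (fun t => ci (y t) n).
Proof.
have [K K0 HK] := coef_lipschitz n; have [_ hc _ _] := Hy.
have hc' t : 0 <= t <= T -> sqnormH20 l rho (fun x => y s x - y t x)
    @[s --> within `[0, T] (nbhs t)] --> (0 : R) by move=> tT; apply: hc; rewrite in_itv.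
split; apply: (small_cont K0 _ hc') => t s tT sT.
  by have [] := HK _ _ (Hyt sT) (Hyt tT).
by have [] := HK _ _ (Hyt sT) (Hyt tT).
Qed.

Lemma formA_Phi u n : H20 l u -> formA l sigma q u (Phi n) = (lambda n * cr u n) +i* (lambda n * ci u n).
Proof.
move=> Hu; rewrite (formA_parts csigma cq Hu (HPhi20 n)).
have [[Wu Cu] [Wu' Cu']] := H20_parts Hu.
have [k1 [W HB]] := Hp n; have [k1' [W' HB']] := Hr n.
have eb := en_beam l0 sigma0_gt0 Hrho Hsigma csigma1 cq sigmab.
have e1 := eb _ _ _ _ _ _ _ _ _ HB Wu Cu; have e2 := eb _ _ _ _ _ _ _ _ _ HB Wu' Cu'.
have e3 := eb _ _ _ _ _ _ _ _ _ HB' Wu Cu; have e4 := eb _ _ _ _ _ _ _ _ _ HB' Wu' Cu'.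
rewrite /= in e1 e2 e3 e4.
by rewrite e1 e2 e3 e4 /cr /ci /cre /cim mulrDr mulrBr.
Qed.

(** The weak equation tested with [Phi n] reads [c' = i lambda c] on the open interval, and
    continuity at 0 supplies the initial value. *)
Lemma coef_evolution n t : 0 <= t <= T ->
  coef l rho Phi (y t) n = coef l rho Phi y0 n * expi (lambda n * t).
Proof.
move=> tT; have [ca cb] := coef_cont n; have [_ _ hy0 hw] := Hy.
have ins : 0 <= (0 : R) <= T by rewrite lexx ltW.
have D s : 0 < s < T -> is_derive s (1 : R) (fun s => Rec (coef l rho Phi (y s) n)) (- (lambda n * ci (y s) n)) /\
    is_derive s (1 : R) (fun s => Imc (coef l rho Phi (y s) n)) (lambda n * cr (y s) n).
  move=> sT; have sT' : 0 <= s <= T by case/andP: sT => a b; rewrite !ltW.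
  have [|d Hd Ed] := hw _ (HPhi20 n) s; first by rewrite in_itv.
  rewrite (formA_Phi n (Hyt sT')) in Ed.
  exact: is_cderive_parts Hd Ed.
have cE s : 0 <= s <= T -> Rec (coef l rho Phi (y s) n) = cr (y s) n /\
    Imc (coef l rho Phi (y s) n) = ci (y s) n.
  by move=> sT; rewrite coefE //; exact: Hyt.
have ca' : cont 0 T (fun s => Rec (coef l rho Phi (y s) n)).
  by apply: cont_ext ca => s sT; have [-> _] := cE s sT.
have cb' : cont 0 T (fun s => Imc (coef l rho Phi (y s) n)).
  by apply: cont_ext cb => s sT; have [_ ->] := cE s sT.
have D1 s : 0 < s < T -> is_derive s (1 : R) (fun s => Rec (coef l rho Phi (y s) n))
    (- lambda n * Imc (coef l rho Phi (y s) n)).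
  move=> sT; have [h _] := D s sT; have [_ ->] := cE s ltac:(by case/andP: sT => a b; rewrite !ltW).
  by rewrite mulNr.
have D2 s : 0 < s < T -> is_derive s (1 : R) (fun s => Imc (coef l rho Phi (y s) n))
    (lambda n * Rec (coef l rho Phi (y s) n)).
  by move=> sT; have [_ h] := D s sT; have [-> _] := cE s ltac:(by case/andP: sT => a b; rewrite !ltW).
have [h1 h2] := rotation_ode (ltW T0) ca' cb' D1 D2 tT.
(* [y 0] and [y0] agree on [[0, l]] only, which is where the coefficients are integrated. *)
have e0 : coef l rho Phi (y 0) n = coef l rho Phi y0 n.
  rewrite /coef /ipL2 /cint; congr (_ +i* _); apply: Int_ext => x xl; by rewrite hy0 // in_itv.
rewrite e0 in h1 h2; apply: complex_eq; rewrite ?h1 ?h2 /expi; case: (coef _ _ _ y0 n) => a b //=.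
Qed.

(** The constants are arguments, and what is assumed of them mentions only the beam system and
    [eigenval]: they can be fixed before any eigenbasis. *)
Lemma trace2_exists (ct Ct ki Ki : R) : 0 < ct -> 0 < Ct -> 0 < ki -> 0 < Ki ->
  (forall lam u v k k1 W, 0 <= lam -> beam l rho sigma sigma1 q lam (fun=> 0) u v k k1 W ->
    ct * (lam * ip u u) <= k l ^+ 2 <= Ct * (lam * ip u u)) ->
  (forall (I : finType) (P : pred I) (al be la : I -> R),
    (forall i, P i -> eigenval l rho sigma sigma1 q (la i)) ->
    (forall i j, P i -> P j -> la i = la j -> i = j) ->
    ki * nrm P al be <= Int 0 T (tsq P al be la) <= Ki * nrm P al be) ->
  exists2 g, trace2 l rho lambda Phi T y0 y g &
    ki * ct / 2 * (sigma0 / rhoM) * sqnormH20 l rho y0 <= sqnormL2 0 T (fun=> 1) g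
    <= 2 * (Ki * Ct) * ((sigmaM + qM * l ^+ 2) / rho0) * sqnormH20 l rho y0.
Proof.
move=> ct0 Ct0 ki0 Ki0 Htr Hin.
have Ht := basis_trace l0 rho0_gt0 sigma0_gt0 Hrho Hsigma csigma1 cq rhob sigmab qb Hp Hr oR Htr.
have [[Wu Cu] [Wv Cv]] := H20_parts Hy0.
have [gr [gi [grL giL Hg Hb]]] := trace_exists l0 rho0_gt0 sigma0_gt0 Hrho crho1 Hsigma csigma1 cq
  rhob sigmab qb Hp Hr oR oI Wu Cu Wv Cv (complete_parts Hy0) ct0 Ct0 ki0 Ki0 Ht Hin.
pose g t := gr t +i* gi t.
have sqE (f1 f2 : R -> R) : L2r 0 T f1 -> L2r 0 T f2 ->
    sqnormL2 0 T (fun=> 1) (fun t => f1 t +i* f2 t) = sq 0 T f1 + sq 0 T f2.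
  move=> h1 h2; rewrite -(IntD h1.2 h2.2); apply: Int_ext => t _.
  by rewrite /sqmod /= mulr1.
exists g; last first.
  rewrite sqE //; have /andP[e1 e2] := energy_equiv Hy0.
  have /andP[b1 b2] := Hb; apply/andP; split.
    apply: le_trans b1; rewrite -mulrA ler_wpM2l // divr_ge0 // mulr_ge0 // ltW //.
  apply: le_trans b2 _; rewrite -[leRHS]mulrA ler_wpM2l // mulr_ge0 // mulr_ge0 // ltW //.
split.
- move=> t tT; have tT' : 0 <= t <= T by move: tT; rewrite in_itv.
  have zE n : coef l rho Phi y0 n * expi (lambda n * t) = coef l rho Phi (y t) n.
    by rewrite coef_evolution.
  exact: (expansion_H20 (Hyt tT') zE).
- split; [exact: grL.1|exact: giL.1|].
  apply: itg_lty => [|t _]; last by rewrite mulr1 addr_ge0 ?sqr_ge0.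
  apply: itg_ext (itgD grL.2 giL.2) => t _; by rewrite /sqmod mulr1.
apply: eps_cvg0 => [N|e e0].
  by apply: Int_ge0 => t _; rewrite mulr1 addr_ge0 ?sqr_ge0.
have [N HN] := Hg e e0; exists N => n Nn; apply: le_trans (HN n Nn).
pose z t i := coef l rho Phi y0 i * expi (lambda i * t).
pose w i := cderiv l (cderiv l (Phi i)) l.
have E t : g t - \sum_(i < n) z t i * w i =
    (gr t - \sum_(i < n) (tal l rho p p2 r r2 (re0 y0) (im0 y0) i * cos (lambda i * t)
       - tbe l rho p p2 r r2 (re0 y0) (im0 y0) i * sin (lambda i * t))) +i*
    (gi t - \sum_(i < n) (tal l rho p p2 r r2 (re0 y0) (im0 y0) i * sin (lambda i * t)
       + tbe l rho p p2 r r2 (re0 y0) (im0 y0) i * cos (lambda i * t))).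
  have zE i : z t i = (cr y0 i +i* ci y0 i) * (cos (lambda i * t) +i* sin (lambda i * t)).
    by rewrite /z coefE.
  apply: complex_eq; rewrite ?ReB ?ImB; congr (_ - _).
    rewrite (Re_sumM n (z t) w); apply: eq_bigr => i _; rewrite zE /tal /tbe -/(cr y0 i) -/(ci y0 i).
    rewrite /w /re0 /im0; case: (cderiv l _ l) => P Q /=; ring.
  rewrite (Im_sumM n (z t) w); apply: eq_bigr => i _; rewrite zE /tal /tbe -/(cr y0 i) -/(ci y0 i).
  rewrite /w /re0 /im0; case: (cderiv l _ l) => P Q /=; ring.
rewrite (_ : (fun t => _) = (fun t => g t - \sum_(i < n) z t i * w i)) // (funext E) sqE //.
- by apply: L2rB => //; apply: L2r_cont; apply: continuous_cont; exact: continuous_tre.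
- by apply: L2rB => //; apply: L2r_cont; apply: continuous_cont; exact: continuous_tim.
Qed.

End Evolution.

End Translation.

Theorem proposition4p1 (R : realType) (l : R) (rho sigma q : R -> R)
    (rho0 sigma0 : R) (T : R) :
  0 < l ->
  sobolev l 2 (fun x => (rho x)%:C) ->
  sobolev l 2 (fun x => (sigma x)%:C) ->
  sobolev l 1 (fun x => (q x)%:C) ->
  0 < rho0 -> 0 < sigma0 ->
  (forall x, x \in `[0, l] ->
     [/\ rho0 <= rho x, sigma0 <= sigma x & 0 <= q x]) ->
  0 < T ->
  exists c1 c2 : R, [/\ 0 < c1, 0 < c2 &
    forall (lambda : nat -> R) (Phi : nat -> R -> R[i]),
      eigenbasis l rho sigma q lambda Phi ->
    forall (y0 : R -> R[i]) (y : R -> R -> R[i]),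
      H20 l y0 -> solution l rho sigma q T y0 y ->
    exists2 g : R -> R[i], trace2 l rho lambda Phi T y0 y g &
      c1 * sqnormH20 l rho y0 <= sqnormL2 0 T (fun=> 1) g
        <= c2 * sqnormH20 l rho y0].
Proof.
move=> l0 /sobolev_parts[srho _] /sobolev_parts[ssigma _] /sobolev_parts[sq1 _] rho00 sigma00 low T0.
have {}srho : sobR l 2 rho by exact: srho.
have {}ssigma : sobR l 2 sigma by exact: ssigma.
have {}sq1 : sobR l 1 q by exact: sq1.
have [Hrho [Hrho' _]] := srho; have [Hsigma [Hsigma' _]] := ssigma; have [Hq _] := sq1.
have crho1 := prim_cont Hrho'; have csigma1 := prim_cont Hsigma'.
have cq := prim_cont Hq; have crho := prim_cont Hrho; have csigma := prim_cont Hsigma.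
have lowx x : 0 <= x <= l -> [/\ rho0 <= rho x, sigma0 <= sigma x & 0 <= q x].
  by move=> xl; apply: low; rewrite in_itv.
have [rhoM rhoM0 HrhoM] := cont_bounded crho.
have [sigmaM sigmaM0 HsigmaM] := cont_bounded csigma.
have [qM qM0 HqM] := cont_bounded cq.
have rhob x : 0 <= x <= l -> rho0 <= rho x <= rhoM.
  by move=> xl; have [-> _ _] := lowx x xl; exact: le_trans (ler_norm _) (HrhoM x xl).
have sigmab x : 0 <= x <= l -> sigma0 <= sigma x <= sigmaM.
  by move=> xl; have [_ -> _] := lowx x xl; exact: le_trans (ler_norm _) (HsigmaM x xl).
have qb x : 0 <= x <= l -> 0 <= q x <= qM.
  by move=> xl; have [_ _ ->] := lowx x xl; exact: le_trans (ler_norm _) (HqM x xl).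
have [ct [Ct [ct0 Ct0 Htr]]] :=
  beam_trace_equiv l0 rho00 sigma00 Hrho crho1 Hsigma csigma1 cq rhob sigmab qb.
have [ki [Ki [ki0 Ki0 Hin]]] :=
  basis_ingham l0 rho00 sigma00 Hrho crho1 Hsigma csigma1 cq rhob sigmab qb T0.
(* Ingham's constant, times that of the traces, times that of the equivalence between energy and
   norm. *)
exists (ki * ct / 2 * (sigma0 / rhoM)), (2 * (Ki * Ct) * ((sigmaM + qM * l ^+ 2) / rho0)).
split.
- by apply: mulr_gt0; [apply: divr_gt0 => //; exact: mulr_gt0|exact: divr_gt0].
- apply: mulr_gt0; first by rewrite !mulr_gt0.
  by apply: divr_gt0 => //; apply: addr_gt0 => //; apply: mulr_gt0; rewrite ?exprn_gt0.
move=> lambda Phi HPhi y0 y Hy0 Hy.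
exact: (trace2_exists l0 rho00 sigma00 Hrho crho1 Hsigma csigma1 cq rhob sigmab qb ssigma
  erefl sq1 HPhi T0 Hy0 Hy ct0 Ct0 ki0 Ki0 Htr Hin).
Qed.
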